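(* Let $d\in\mathbb{N}$, $m\in\mathbb{Z}_+$, and let $\mathbf{k},\mathbf{r}^0,\ldots,\mathbf{r}^m\in\mathbb{R}^d$ and $\lambda_0,\ldots,\lambda_m>0$ be such that $\lambda_0+\ldots+\lambda_m=1$ and $\mathbf{k}=\lambda_0\mathbf{r}^0+\ldots+\lambda_m\mathbf{r}^m$ (so $\mathbf{k}$ belongs to the convex hull of $\mathbf{r}^0,\ldots,\mathbf{r}^m$). Then for every $x\in\bigcap_{j=0}^m\mathcal{L}^{\mathbf{r}^j}$ there holds the sharp inequality $$\|\mathcal{D}^{\mathbf{k}}x\|_{L_2(\mathbb{R}^d)}\leqslant\prod_{j=0}^m\|\mathcal{D}^{\mathbf{r}^j}x\|_{L_2(\mathbb{R}^d)}^{\lambda_j}.$$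
   Context: $\mathbb{Z}_+$ is the set of non-negative integers. $\mathcal{F}:L_2(\mathbb{R}^d)\to L_2(\mathbb{R}^d)$ is the Fourier transform $\widehat{x}(\mathbf{u})=(\mathcal{F}x)(\mathbf{u})=\int_{\mathbb{R}^d}x(\mathbf{t})e^{-2\pi i(t_1u_1+\ldots+t_du_d)}\,d\mathbf{t}$, and $\mathcal{F}^{-1}$ its inverse. For $\mathbf{k}\in\mathbb{R}^d$, $\mathcal{E}^{\mathbf{k}}$ is the multiplication operator $(\mathcal{E}^{\mathbf{k}}x)(\mathbf{t})=(2\pi it_1)^{k_1}\cdots(2\pi it_d)^{k_d}x(\mathbf{t})$, where $(2\pi ia)^b=|2\pi a|^be^{i\pi b\,\mathrm{sign}(a)/2}$ for real $a,b$; and $\mathcal{D}^{\mathbf{k}}=\mathcal{F}^{-1}\circ\mathcal{E}^{\mathbf{k}}\circ\mathcal{F}$. $\mathcal{L}^{\mathbf{k}}$ is the space of functions $x:\mathbb{R}^d\to\mathbb{C}$, $x\in L_2(\mathbb{R}^d)$, with $\|x\|_{\mathcal{L}^{\mathbf{k}}}^2:=(2\pi)^{2k_1+\ldots+2k_d}\int_{\mathbb{R}^d}|t_1|^{2k_1}\cdots|t_d|^{2k_d}|\widehat{x}(\mathbf{t})|^2\,d\mathbf{t}<\infty$; on it $\|\mathcal{D}^{\mathbf{k}}x\|_{L_2(\mathbb{R}^d)}=\|x\|_{\mathcal{L}^{\mathbf{k}}}$. Sharp means that the constant $1$ in front of the product cannot be reduced. *)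

(* Defs.v *)
From HB Require Import structures.
From mathcomp Require Import all_boot all_order all_algebra.
From mathcomp Require Import complex.
From mathcomp Require Import all_classical all_reals all_analysis.

Set Implicit Arguments.
Unset Strict Implicit.
Unset Printing Implicit Defensive.

Import Order.TTheory GRing.Theory Num.Theory.
Import numFieldNormedType.Exports.

Local Open Scope complex_scope.
Local Open Scope classical_set_scope.
Local Open Scope ring_scope.

Definition cons_point (R : realType) (d : nat) (p : d.-tuple R * R) :
  d.+1.-tuple R := [tuple of p.2 :: p.1].

Lemma measurable_cons_point (R : realType) (d : nat) :
  measurable_fun [set: d.-tuple R * R] (@cons_point R d).
Proof. exact: measurable_cons. Qed.

Definition lebesgue_cons (R : realType) (d : nat)
    (mu : {measure set (d.-tuple R) -> \bar R}) :
    set (d.+1.-tuple R) -> \bar R :=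
  pushforward (mu \x @lebesgue_measure R)%E (@cons_point R d).

Section lebesgue_cons_measure.
Variables (R : realType) (d : nat) (mu : {measure set (d.-tuple R) -> \bar R}).

Let measurable_cons_preimage (A : set (d.+1.-tuple R)) :
  measurable A -> measurable (@cons_point R d @^-1` A).
Proof. by move=> mA; rewrite -[X in measurable X]setTI; exact: measurable_cons_point. Qed.

Let lebesgue_cons0 : lebesgue_cons mu set0 = 0%E.
Proof. by rewrite /lebesgue_cons /pushforward preimage_set0 measure0. Qed.

Let lebesgue_cons_ge0 A : (0 <= lebesgue_cons mu A)%E.
Proof.
exact: (measure_ge0 (mu \x @lebesgue_measure R)%E).
Qed.

Let lebesgue_cons_sigma_additive : semi_sigma_additive (lebesgue_cons mu).
Proof.
move=> F mF tF mUF; rewrite /lebesgue_cons /pushforward preimage_bigcup.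
apply: measure_semi_sigma_additive.
- by move=> n; exact: measurable_cons_preimage.
- apply/trivIsetP => /= i j _ _ ij; rewrite -preimage_setI.
  by move/trivIsetP : tF => /(_ _ _ _ _ ij) ->//; rewrite preimage_set0.
- by rewrite -preimage_bigcup; exact: measurable_cons_preimage.
Qed.

HB.instance Definition _ := isMeasure.Build _ _ _ (lebesgue_cons mu)
  lebesgue_cons0 lebesgue_cons_ge0 lebesgue_cons_sigma_additive.

End lebesgue_cons_measure.

(* The points of R^d are the d-tuples; lebesgue_Rd is the d-fold product of the
   Lebesgue measure of R (for d = 0, the unit mass on the one-point space). *)
Fixpoint lebesgue_Rd (R : realType) (d : nat) :
    {measure set (d.-tuple R) -> \bar R} :=
  match d with
  | 0 => dirac [tuple]
  | d'.+1 => lebesgue_cons (lebesgue_Rd R d')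
  end.

Local Notation cmod := (@Normc.normc _).

Definition L2norm (R : realType) (d : nat) (x : d.-tuple R -> R[i]) : \bar R :=
  ('N[lebesgue_Rd R d]_2%:E [EFin \o cmod \o x])%E.

(* Elements of L_2 are represented by functions, not by classes of functions. *)
Definition L2 (R : realType) (d : nat) : set (d.-tuple R -> R[i]) :=
  [set x | [/\ measurable_fun setT (fun t => complex.Re (x t)),
               measurable_fun setT (fun t => complex.Im (x t)) &
               (L2norm x < +oo)%E]].

Definition Cintegral (R : realType) (d : nat) (D : set (d.-tuple R))
    (f : d.-tuple R -> R[i]) : R[i] :=
  Rintegral (lebesgue_Rd R d) D (fun t => complex.Re (f t)) +i*
  Rintegral (lebesgue_Rd R d) D (fun t => complex.Im (f t)).

Definition expi (R : realType) (a : R) : R[i] := cos a +i* sin a.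

Definition dotp (R : realType) (d : nat) (t u : d.-tuple R) : R :=
  \sum_(i < d) tnth t i * tnth u i.

Definition cube (R : realType) (d n : nat) : set (d.-tuple R) :=
  [set t | forall i : 'I_d, `|tnth t i| <= n%:R].

(* For x in L_2 the integral over all of R^d need not converge; over a cube it
   does, since there x is integrable. *)
Definition fourier_cube (R : realType) (d n : nat) (x : d.-tuple R -> R[i]) :
    d.-tuple R -> R[i] :=
  fun u => Cintegral (@cube R d n) (fun t => x t * expi (- (2 * pi * dotp t u))).

(* The Fourier-Plancherel transform: the limit in the norm of L_2, as n tends to
   infinity, of the integrals over the cubes [-n, n]^d. The limit is determined
   up to a null set, and a representative is chosen; the zero function is the
   value where there is no limit, which does not happen on L_2. *)
Definition fourier (R : realType) (d : nat) (x : d.-tuple R -> R[i]) :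
    d.-tuple R -> R[i] :=
  xget (fun=> 0) [set y | L2 y /\
    (fun n => L2norm (fun u => fourier_cube n x u - y u)) @ \oo --> 0%E].

Definition inv_fourier (R : realType) (d : nat) (z : d.-tuple R -> R[i]) :
    d.-tuple R -> R[i] :=
  xget (fun=> 0) [set y | L2 y /\ {ae lebesgue_Rd R d, forall t, fourier y t = z t}].

(* (2 pi i a)^b. On the null set a = 0, `^ gives 0 for b <> 0 and 1 for b = 0. *)
Definition ipow (R : realType) (a b : R) : R[i] :=
  (`|2 * pi * a| `^ b)%:C * expi (pi * b * Num.sg a / 2).

Definition Emul (R : realType) (d : nat) (k : 'rV[R]_d) (x : d.-tuple R -> R[i]) :
    d.-tuple R -> R[i] :=
  fun t => (\prod_(i < d) ipow (tnth t i) (k 0 i)) * x t.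

Definition Dder (R : realType) (d : nat) (k : 'rV[R]_d) (x : d.-tuple R -> R[i]) :
    d.-tuple R -> R[i] :=
  inv_fourier (Emul k (fourier x)).

Definition Lknorm_sq (R : realType) (d : nat) (k : 'rV[R]_d)
    (x : d.-tuple R -> R[i]) : \bar R :=
  (((2 * pi) `^ (\sum_(i < d) 2 * k 0 i))%:E *
   \int[lebesgue_Rd R d]_t
     ((\prod_(i < d) `|tnth t i| `^ (2 * k 0 i)) * cmod (fourier x t) ^+ 2)%:E)%E.

Definition Lk (R : realType) (d : nat) (k : 'rV[R]_d) : set (d.-tuple R -> R[i]) :=
  [set x | L2 x /\ (Lknorm_sq k x < +oo)%E].

(* Main.v *)
(* Since the inverse transform is an isometry, ||D^k x||^2 is the integral of
   |2 pi t|^(2 k) |F x (t)|^2, and off the coordinate hyperplanes this integrand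
   is the product of the powers lam_j of the integrands for r^j, so the
   inequality is Hoelder's. It is sharp because on functions whose transform is
   the indicator of a small cube next to the point where all |2 pi t_i| = 1 all
   the norms are equal up to a factor close to 1.

   The isometry property is Plancherel's theorem. In dimension one, for functions
   supported in a segment, the integral of exp (- e |u|) |F x (u)|^2 is by Fubini
   a quadratic form in x with the Poisson kernel, which tends to ||x||^2 with
   e -> 0. Partial transforms give the cubes of R^d, and completeness of L2
   extends the transform to L2(R^d). Surjectivity follows from the symmetry of
   the kernel: ||F y - conj w|| = ||y - conj (F w)||. *)

Require Import Defs.
From HB Require Import structures.
From mathcomp Require Import all_boot all_order all_algebra.
From mathcomp Require Import complex.
From mathcomp Require Import all_classical all_reals all_analysis.
From mathcomp Require Import measurable_realfun.
From mathcomp Require Import ring lra.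

Set Implicit Arguments.
Unset Strict Implicit.
Unset Printing Implicit Defensive.

Import Order.TTheory GRing.Theory Num.Theory.
Import numFieldNormedType.Exports.

Local Open Scope classical_set_scope.
Local Open Scope ring_scope.

(** * Abel weights and the Poisson kernel *)

(** In dimension one the obstacle is that the square of the transform, written as a double integral
    over s and t, need not be integrable jointly in s, t and u. The weight exp (- e |u|) repairs
    this. It increases to 1 as e decreases, and its cosine transform is explicit: the Poisson
    kernel, which is positive and symmetric and whose masses are arctangents. The quadratic form is
    split by 2 x y = x^2 + y^2 - (x - y)^2. The squares see only the mass of the kernel. The form of
    (x - y)^2 tends to 0: the kernel has mass at most 1 in each variable, so a function may be
    replaced by a bounded one, and that one by a continuous one, with an error uniform in e. Complex
    functions are carried as pairs of real ones. The isometry is stated for an abstract measure and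
    an abstract phase, so that it passes to products and images, which is what the induction on d
    uses. Supports of finite measure make square integrable functions integrable, hence Fubini
    applicable. *)

Section Poisson.
Context {R : realType}.
Implicit Types (e v u : R).
Notation leb := (@lebesgue_measure R).

Lemma cvg_expRN_pinfty e : 0 < e -> expR (- (e * x)) @[x --> +oo] --> (0 : R).
Proof.
move=> e0; apply: (cvg_comp (fun x => e * x) (fun x => expR (- x)) _ (@cvgr_expR R)) => /=.
under eq_fun do rewrite mulrC.
exact: (gt0_cvgMly e0 cvg_id).
Qed.

(** The summand 1 keeps the integrand nonnegative, as the fundamental theorem on the half-line and
    the doubling of even integrals require. The pure cosine integral is recovered later by
    subtracting the integral of the weight. *)
Lemma integral_expRN_normr_1Dcos e v : 0 < e ->
  (\int[leb]_u (expR (- (e * `|u|)) * (1 + cos (v * u)))%:E =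
   (2 * (e^-1 + e / (e ^+ 2 + v ^+ 2)))%:E)%E.
Proof.
move=> e0.
have ev : e ^+ 2 + v ^+ 2 != 0 by rewrite gt_eqF// ltr_pwDl ?sqr_ge0// exprn_gt0.
pose f u := expR (- (e * u)) * (1 + cos (v * u)).
(* [F] is a primitive of [f] found by integration by parts; it tends to 0 at infinity, so the
   half-line integral is - F 0. *)
pose G u := (v * sin (v * u) - e * cos (v * u)) / (e ^+ 2 + v ^+ 2) - e^-1.
pose F u := expR (- (e * u)) * G u.
have dF (x : R) : is_derive x 1 F (f x).
  have -> : F = ((expR \o ((- e) \*: id)) * ((v / (e ^+ 2 + v ^+ 2)) \*: (sin \o (v \*: id)) - (e / (e ^+ 2 + v ^+ 2)) \*: (cos \o (v \*: id)) - cst (e^-1))).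
    apply/funext => u; rewrite /F /G !fctE /=.
    rewrite /GRing.scale/= mulNr; congr (_ * (_ - _)); ring.
  apply: is_derive_eq.
  rewrite /f !fctE /= /GRing.scale /= mulNr.
  set S := sin _; set C := cos _; set E := expR _.
  by field; rewrite ev gt_eqF.
have mf : continuous f.
  move=> x; have [? _] := dF x.
  apply: cvgM.
    apply: continuous_comp; last exact: continuous_expR.
    apply: cvgN; apply: cvgM; [exact: cvg_cst|exact: cvg_id].
  apply: cvgD; first exact: cvg_cst.
  apply: continuous_comp; last exact: continuous_cos.
  by apply: cvgM; [exact: cvg_cst|exact: cvg_id].
rewrite ge0_symfun_integralT.
- rewrite -set_itvcy.
  have -> : (\int[leb]_(x in `[0%R, +oo[) (expR (- (e * `|x|)) * (1 + cos (v * x)))%:E =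
      \int[leb]_(x in `[0%R, +oo[) (f x)%:E)%E.
    apply: eq_integral => x; rewrite inE/= in_itv/= andbT => x0.
    by rewrite /f ger0_norm.
  rewrite (@ge0_continuous_FTC2y _ f F 0 0).
  + rewrite /F /G !mulr0 oppr0 expR0 cos0 sin0 -EFinB -EFinM; congr (_%:E).
    by field; rewrite ev gt_eqF.
  + by move=> x _; rewrite /f mulr_ge0 ?expR_ge0// -lerBlDl sub0r cos_geN1.
  + exact: continuous_subspaceT.
  + pose M := (`|v| + e) / (e ^+ 2 + v ^+ 2) + e^-1.
    apply/norm_cvg0P; apply: (@squeeze_cvgr _ _ _ _ (cst 0) (fun x => expR (- (e * x)) * M)).
    * near=> x; rewrite normr_ge0 /= normrM ger0_norm ?expR_ge0// ler_wpM2l ?expR_ge0//.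
      apply: (le_trans (ler_normB _ _)); apply: lerD; last by rewrite ger0_norm// invr_ge0 ltW.
      have ev0 : 0 <= (e ^+ 2 + v ^+ 2)^-1 by rewrite invr_ge0 addr_ge0 ?sqr_ge0.
      rewrite normrM (ger0_norm ev0) ler_wpM2r// (le_trans (ler_normB _ _))//.
      rewrite !normrM (ger0_norm (ltW e0)); apply: lerD.
        by rewrite ler_piMr// ler_norml sin_geN1 sin_le1.
      by apply: (ler_piMr (ltW e0)); rewrite ler_norml cos_geN1 cos_le1.
    * exact: cvg_cst.
    * rewrite -[X in _ --> X](mul0r M).
      by apply: cvgM; [exact: cvg_expRN_pinfty|exact: cvg_cst].
  + by move=> x _; exact: ex_derive.
  + apply: cvg_at_right_filter.
    have /derivable1_diffP /differentiable_continuous := @ex_derive _ _ _ _ _ _ _ (dF 0).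
    exact.
  + move=> x _; rewrite derive1E; apply: derive_val.
- by move=> x; rewrite mulr_ge0 ?expR_ge0// -lerBlDl sub0r cos_geN1.
- move=> x; apply: cvgM.
    apply: continuous_comp; last exact: continuous_expR.
    apply: cvgN; apply: cvgM; [exact: cvg_cst|exact: norm_continuous].
  apply: cvgD; first exact: cvg_cst.
  apply: continuous_comp; last exact: continuous_cos.
  by apply: cvgM; [exact: cvg_cst|exact: cvg_id].
- by move=> x /=; rewrite normrN mulrN cosN.
Unshelve. all: by end_near. Qed.

Definition abelw e u : R := expR (- (e * `|u|)).

Lemma abelw_ge0 e u : 0 <= abelw e u. Proof. exact: expR_ge0. Qed.

Lemma measurable_abelw e : measurable_fun setT (abelw e).
Proof.
apply: measurableT_comp => //; apply: measurableT_comp => //.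
by apply: measurable_funM => //; exact: normr_measurable.
Qed.

Lemma measurable_cosM v : measurable_fun setT (fun u => cos (v * u)).
Proof.
apply: measurableT_comp; last exact: measurable_funM.
by apply: continuous_measurable_fun; exact: continuous_cos.
Qed.

Lemma measurable_sinM v : measurable_fun setT (fun u => sin (v * u)).
Proof.
apply: measurableT_comp; last exact: measurable_funM.
by apply: continuous_measurable_fun; exact: continuous_sin.
Qed.

Lemma integrable_abelw_1Dcos e v : 0 < e ->
  leb.-integrable setT (EFin \o (fun u => abelw e u * (1 + cos (v * u)))).
Proof.
move=> e0; apply/integrableP; split.
  apply/measurable_EFinP; apply: measurable_funM; first exact: measurable_abelw.
  by apply: measurable_funD => //; exact: measurable_cosM.
under eq_integral => u _.
  rewrite /= ger0_norm; last by rewrite mulr_ge0 ?abelw_ge0// -lerBlDl sub0r cos_geN1.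
  over.
by rewrite integral_expRN_normr_1Dcos// ltry.
Qed.

Lemma integrable_abelw e : 0 < e -> leb.-integrable setT (EFin \o abelw e).
Proof.
move=> e0; apply: le_integrable (integrable_abelw_1Dcos 0 e0) => //.
  by apply/measurable_EFinP; exact: measurable_abelw.
move=> u _ /=; rewrite lee_fin mul0r cos0 !ger0_norm ?mulr_ge0 ?abelw_ge0//.
by rewrite ler_peMr ?abelw_ge0// lerDl.
Qed.

(** The case v = 0 of the formula above, where the factor 1 + cos is the constant 2. *)
Lemma integral_abelw e : 0 < e -> (\int[leb]_u (abelw e u)%:E = (2 / e)%:E)%E.
Proof.
move=> e0; have := integral_expRN_normr_1Dcos 0 e0.
under eq_integral do rewrite mul0r cos0 mulrC EFinM.
rewrite integralZl//; last exact: integrable_abelw.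
have := integrable_fin_num measurableT (integrable_abelw e0).
rewrite /abelw; move/fineK => <-.
rewrite -EFinM => -[] h; congr (_%:E); apply: (@mulfI _ (1 + 1)) => //.
rewrite h; field; rewrite gt_eqF//.
Qed.

(** Poisson kernel of the half-plane at height [e], in the normalisation of total mass 2 pi; with v
    = 2 pi (t - s) the mass in s becomes 1. *)
Definition poisson e v : R := 2 * e / (e ^+ 2 + v ^+ 2).

Lemma integral_abelw_cos e v : 0 < e ->
  (\int[leb]_u (abelw e u * cos (v * u))%:E = (poisson e v)%:E)%E.
Proof.
move=> e0.
have ev : e ^+ 2 + v ^+ 2 != 0 by rewrite gt_eqF// ltr_pwDl ?sqr_ge0// exprn_gt0.
transitivity (\int[leb]_u ((abelw e u * (1 + cos (v * u)))%:E - (abelw e u)%:E))%E.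
  by apply: eq_integral => u _; rewrite -EFinB; congr (_%:E); ring.
rewrite integralB_EFin//; [|exact: integrable_abelw_1Dcos|exact: integrable_abelw].
rewrite integral_expRN_normr_1Dcos// integral_abelw// -EFinB; congr (_%:E).
by rewrite /poisson; field; rewrite ev gt_eqF.
Qed.

Lemma integrable_abelw_bounded e (g : R -> R) : 0 < e -> measurable_fun setT g ->
  (forall u, `|g u| <= 1) -> leb.-integrable setT (EFin \o (fun u => abelw e u * g u)).
Proof.
move=> e0 mg g1; apply: le_integrable (integrable_abelw e0) => //.
  by apply/measurable_EFinP/measurable_funM => //; exact: measurable_abelw.
by move=> u _ /=; rewrite lee_fin normrM ler_piMr.
Qed.

Lemma normr_sin_le1 u : `|sin u| <= 1 :> R.
Proof. by rewrite ler_norml sin_geN1 sin_le1. Qed.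

Lemma normr_cos_le1 u : `|cos u| <= 1 :> R.
Proof. by rewrite ler_norml cos_geN1 cos_le1. Qed.

(** The integrand is odd, so reflection gives I = - I; integrability excludes an infinite I. *)
Lemma integral_abelw_sin e v : 0 < e ->
  (\int[leb]_u (abelw e u * sin (v * u))%:E = 0)%E.
Proof.
move=> e0.
pose h u := (abelw e u * sin (v * u))%:E : \bar R.
have ih : leb.-integrable setT h.
  apply: integrable_abelw_bounded => //; first exact: measurable_sinM.
  by move=> u; exact: normr_sin_le1.
have mN : measurable_fun setT (-%R : R -> R) by exact: oppr_measurable.
have hN u : h (- u) = (- h u)%E.
  by rewrite /h /abelw normrN mulrN sinN mulrN EFinN.
have h1 : (\int[leb]_u h u = \int[leb]_u h (- u)%R)%E.
  transitivity (\int[pushforward leb (-%R : R -> measurableTypeR R)]_u h u)%E.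
    apply: eq_measure_integral => A mA _; exact/esym/lebesgue_measureN.
  rewrite integral_pushforward//=.
  - exact: measurable_int ih.
  - rewrite preimage_setT.
    by apply: eq_integrable (integrableN ih) => // u _ /=; rewrite hN.
have h2 : (\int[leb]_u h (- u)%R = - \int[leb]_u h u)%E.
  transitivity (\int[leb]_u (- h u))%E; first by apply: eq_integral => u _; rewrite hN.
  by rewrite integralN//; exact: integrable_add_def.
have := integrable_fin_num measurableT ih; move: h1; rewrite h2 -/(h _).
change (\int[leb]_u (abelw e u * sin (v * u))%:E)%E with (\int[leb]_u h u)%E.
case: (\int[leb]_u h u)%E => // r [] rr _; congr (_%:E); lra.
Qed.
End Poisson.

(** * Mass of the Poisson kernel on a segment *)

Section PoissonMass.
Context {R : realType}.
Implicit Types (e v u t s A : R).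
Notation leb := (@lebesgue_measure R).

Lemma poisson_ge0 e v : 0 < e -> 0 <= poisson e v.
Proof. by move=> e0; rewrite /poisson mulr_ge0 ?mulr_ge0 ?ltW// invr_gt0 ltr_pwDl ?sqr_ge0// exprn_gt0. Qed.

(** The part of the unit mass of the kernel centred at [t] that falls into [- A, A]. *)
Definition poisson_mass e A t : R :=
  (atan (2 * pi * (A - t) / e) + atan (2 * pi * (A + t) / e)) / pi.

Lemma integral_poisson e A t : 0 < e -> 0 < A ->
  (\int[leb]_(s in `[(- A)%R, A]) (poisson e (2 * pi * (t - s)))%:E =
   (poisson_mass e A t)%:E)%E.
Proof.
move=> e0 A0.
have pi0 := @pi_gt0 R.
pose k : R := 2 * pi / e.
have D0 s : e ^+ 2 + (2 * pi * (t - s)) ^+ 2 != 0.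
  by rewrite gt_eqF// ltr_pwDl ?sqr_ge0// exprn_gt0.
pose f s := poisson e (2 * pi * (t - s)).
pose F : R -> R := pi^-1 \*: (atan \o (k \*: id - cst (k * t))).
have dF s : is_derive s 1 F (f s).
  apply: is_derive_eq.
  rewrite !fctE /GRing.scale /= /GRing.scale /= /f /poisson /k.
  move: pi0 (D0 s); move: (pi : R) => p p0 D; field.
  by rewrite D (lt0r_neq0 p0) (lt0r_neq0 e0).
have cf : continuous f.
  move=> s; apply: cvgM; first exact: cvg_cst.
  apply: cvgV => //; apply: cvgD; first exact: cvg_cst.
  apply: cvgM; (apply: cvgM; first exact: cvg_cst; apply: cvgB; [exact: cvg_cst|exact: cvg_id]).
have dc (s : R) : {for s, continuous F}.
  by have /derivable1_diffP /differentiable_continuous := @ex_derive _ _ _ _ _ _ _ (dF s).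
rewrite (@continuous_FTC2 _ f F).
- rewrite -EFinB /F /poisson_mass !fctE /= /GRing.scale/=; congr (_%:E).
  rewrite -mulrBr mulrC; congr (_ / pi).
  rewrite -atanN; congr (atan _ + atan _); rewrite /k; move: pi0; move: (pi : R) => p p0; field; exact: lt0r_neq0.
- by rewrite gtrN.
- exact: continuous_subspaceT.
- split.
  + by move=> x _; exact: ex_derive.
  + by apply: cvg_at_right_filter; exact: dc.
  + by apply: cvg_at_left_filter; exact: dc.
- by move=> x _; rewrite derive1E; exact: derive_val.
Qed.

Lemma poisson_mass_ge0 e A t : 0 < e -> 0 < A -> 0 <= poisson_mass e A t.
Proof.
move=> e0 A0; rewrite -lee_fin -integral_poisson//.
by apply: integral_ge0 => s _; rewrite lee_fin poisson_ge0.
Qed.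

Lemma poisson_mass_le1 e A t : poisson_mass e A t <= 1.
Proof.
rewrite /poisson_mass ler_pdivrMr ?pi_gt0// mul1r.
have := atan_ltpi2 (2 * pi * (A - t) / e); have := atan_ltpi2 (2 * pi * (A + t) / e).
lra.
Qed.

(** Inside the segment both arctangents tend to pi / 2. The inequalities must be strict: at an end
    point one arctangent is 0 and the limit is 1 / 2. *)
Lemma cvg_poisson_mass A t : - A < t < A ->
  poisson_mass n.+1%:R^-1 A t @[n --> \oo] --> (1 : R).
Proof.
move=> /andP[At tA].
have pi0 := @pi_gt0 R.
have h (c : R) : 0 < c -> atan (2 * pi * c / (n.+1%:R^-1)) @[n --> \oo] --> pi / 2.
  move=> c0; apply: (cvg_comp (fun n : nat => 2 * pi * c / (n.+1%:R^-1)) _ _ (@cvgy_atan R)).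
  under eq_fun do rewrite invrK mulrC.
  have c1 : 0 < 2 * pi * c by rewrite !mulr_gt0.
  apply: (cvg_comp (fun n : nat => n.+1%:R) _ _ (gt0_cvgMly c1 cvg_id)).
  by rewrite (cvg_shiftS (fun n : nat => n%:R : R)); exact: cvgr_idn.
rewrite [X in _ --> X](_ : 1 = (pi / 2 + pi / 2) / pi :> R).
  by apply: cvgM; [apply: cvgD; apply: h; lra|exact: cvg_cst].
by rewrite -splitr divff// gt_eqF.
Qed.
End PoissonMass.

(** * Limits in the extended reals and uniform continuity *)

Section Limits.
Context {R : realType}.

Lemma cvge0_near (u : nat -> \bar R) : (forall n, 0 <= u n)%E ->
  (forall c : R, 0 < c -> \forall n \near \oo, (u n <= c%:E)%E) ->
  u @ \oo --> 0%E.
Proof.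
move=> u0 uc; apply/fine_cvgP; split.
  near=> n; rewrite ge0_fin_numE// (@le_lt_trans _ _ 1%:E) ?ltry//.
  near: n; exact: uc.
apply/cvgrPdist_le => /= c c0; near=> n.
rewrite sub0r normrN ger0_norm ?fine_ge0//.
have h : (u n <= c%:E)%E by near: n; exact: uc.
by rewrite -lee_fin fineK// ge0_fin_numE// (le_lt_trans h) ?ltry.
Unshelve. all: by end_near. Qed.

Lemma cvge0_nearP (u : nat -> \bar R) (c : R) : u @ \oo --> 0%E -> 0 < c ->
  \forall n \near \oo, (u n <= c%:E)%E.
Proof.
move=> u0 c0; move/fine_cvgP : u0 => [fu /cvgrPdist_le/(_ _ c0)].
apply: filterS2 fu => n fu; rewrite sub0r normrN => h.
by rewrite -[u n]fineK// lee_fin (le_trans (ler_norm _)).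
Qed.

(** Heine-Cantor by the near-covering form of compactness. Only [s] has to lie in [K]: the radius
    that works at a point of [K] is halved, once for [s] and once for the distance from [s] to
    [t]. *)
Lemma compact_continuous_unif (g : R -> R) (K : set R) (c : R) : compact K ->
  continuous g -> 0 < c ->
  exists2 e : R, 0 < e & forall s t, K s -> `|s - t| < e -> `|g s - g t| <= c.
Proof.
move=> /compact_near_coveringP cK cg c0.
have : \forall e \near (0:R)^'+, K `<=` (fun s => forall t, `|s - t| < e -> `|g s - g t| <= c).
  apply: cK => x Kx.
  have c2 : 0 < c / 2 by rewrite divr_gt0.
  have /cvgrPdist_le/(_ _ c2)/nbhs_ballP[r /= r0 xr] := cg x.
  exists (ball x (r / 2), [set e : R | e < r / 2]) => /=.
    split; first by apply/nbhs_ballP; exists (r / 2) => //=; rewrite divr_gt0.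
    by apply: nbhs_right_lt; rewrite divr_gt0.
  move=> [y e] /= [xy er] t yt.
  have h1 : `|g x - g y| <= c / 2.
    apply: xr; rewrite /ball/= in xy *; lra.
  have h2 : `|g x - g t| <= c / 2.
    apply: xr; rewrite /ball/= in xy *.
    rewrite (_ : x - t = (x - y) + (y - t)); last by ring.
    rewrite (le_lt_trans (ler_normD _ _))//; lra.
  rewrite (_ : g y - g t = (g x - g t) - (g x - g y)); last by ring.
  by rewrite (le_trans (ler_normB _ _))// (splitr c) lerD.
move=> h; have : \forall e \near (0:R)^'+, 0 < e /\ K `<=` (fun s => forall t, `|s - t| < e -> `|g s - g t| <= c).
  by apply: filterS2 (nbhs_right_gt _) h => e.
by move=> /filter_ex[e [e0 he]]; exists e => // s t Ks; exact: he.
Qed.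
End Limits.

(** * Double integrals against the Poisson kernel *)

Section PoissonForm.
Context {R : realType}.
Implicit Types (e v u t s A : R) (f g h : R -> R).
Notation leb := (@lebesgue_measure R).
Notation leb2 := (leb \x leb)%E.

Definition sq A : set (R * R) := `[(- A)%R, A] `*` `[(- A)%R, A].

Lemma measurable_sq A : measurable (sq A).
Proof. by apply: measurableX; exact: measurable_itv. Qed.

Lemma measurable_poisson e : 0 < e -> measurable_fun setT (poisson e).
Proof.
move=> e0; apply: continuous_measurable_fun => v.
apply: cvgM; first exact: cvg_cst.
apply: cvgV; first by rewrite gt_eqF// ltr_pwDl ?sqr_ge0// exprn_gt0.
by apply: cvgD; [exact: cvg_cst|apply: cvgM; exact: cvg_id].
Qed.

Definition pk e (p : R * R) := poisson e (2 * pi * (p.1 - p.2)).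

Lemma pk_ge0 e p : 0 < e -> 0 <= pk e p. Proof. exact: poisson_ge0. Qed.

Lemma pk_sym e s t : pk e (s, t) = pk e (t, s).
Proof. by rewrite /pk /= /poisson -(opprB t s) mulrN sqrrN. Qed.

Lemma measurable_pk e : 0 < e -> measurable_fun setT (pk e).
Proof.
move=> e0; apply: (measurableT_comp (measurable_poisson e0)).
by apply: measurable_funM => //; apply: measurable_funB; [exact: measurable_fst|exact: measurable_snd].
Qed.

(** By Tonelli: for fixed t the inner integral over s is the mass of the kernel centred at t. *)
Lemma integral_pk_fst e A h : 0 < e -> 0 < A -> measurable_fun setT h ->
  (forall t, 0 <= h t) ->
  (\int[leb2]_(p in sq A) (pk e p * h p.1)%:E =
   \int[leb]_(t in `[(- A)%R, A]) (poisson_mass e A t * h t)%:E)%E.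
Proof.
move=> e0 A0 mh h0; have mpk := measurable_pk e0.
have mpkh : measurable_fun setT (fun p : R * R => (pk e p * h p.1)%:E).
  apply/measurable_EFinP; apply: measurable_funM => //.
  exact: (measurableT_comp mh measurable_fst).
rewrite integral_mkcond fubini_tonelli1; last 2 first.
- apply/(measurable_restrictT _ _).1; first exact: measurable_sq.
  exact: measurable_funTS.
- move=> p; rewrite patchE; case: ifP => // _.
  by rewrite lee_fin mulr_ge0// pk_ge0.
rewrite [RHS]integral_mkcond; apply: eq_integral => t _.
rewrite /fubini_F patchE; case: ifPn => tA.
- transitivity (\int[leb]_(s in `[(- A)%R, A]) ((h t)%:E * (poisson e (2 * pi * (t - s)))%:E))%E.
    rewrite [RHS]integral_mkcond; apply: eq_integral => s _.
    rewrite !patchE; have -> : ((t, s) \in sq A) = (s \in `[(- A)%R, A]%classic).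
      by apply/idP/idP; rewrite !inE /sq /=; [case|move: tA; rewrite inE].
    by case: ifP => // _; rewrite -EFinM mulrC.
  rewrite ge0_integralZl//; last 3 first.
  - apply/measurable_EFinP/measurable_funTS/(measurableT_comp (measurable_poisson e0)).
    by apply: measurable_funM => //; apply: measurable_funB.
  - by move=> s _; rewrite lee_fin poisson_ge0.
  - by rewrite lee_fin.
  by rewrite integral_poisson// -EFinM mulrC.
- apply: integral0_eq => s _; rewrite patchE ifF//.
  by apply/negbTE; apply: contraNN tA; rewrite !inE => -[].
Qed.

(** The kernel and the square are symmetric, so integrating in the other order gives the same
    value. *)
Lemma integral_pk_snd e A h : 0 < e -> 0 < A -> measurable_fun setT h ->
  (forall t, 0 <= h t) ->
  (\int[leb2]_(p in sq A) (pk e p * h p.2)%:E =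
   \int[leb]_(t in `[(- A)%R, A]) (poisson_mass e A t * h t)%:E)%E.
Proof.
move=> e0 A0 mh h0; have mpk := measurable_pk e0.
have mp1 : measurable_fun setT (fun p : R * R => (pk e p * h p.1)%:E).
  apply/measurable_EFinP; apply: measurable_funM => //.
  exact: (measurableT_comp mh measurable_fst).
have mp2 : measurable_fun setT (fun p : R * R => (pk e p * h p.2)%:E).
  apply/measurable_EFinP; apply: measurable_funM => //.
  exact: (measurableT_comp mh measurable_snd).
have m1 := (measurable_restrictT _ (measurable_sq A)).1 (measurable_funTS mp1).
have m2 := (measurable_restrictT _ (measurable_sq A)).1 (measurable_funTS mp2).
rewrite -integral_pk_fst// integral_mkcond fubini_tonelli1; first last.
- by apply: erestrict_ge0 => p _; rewrite lee_fin mulr_ge0// pk_ge0.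
- exact: m2.
apply/esym; rewrite integral_mkcond fubini_tonelli2; first last.
- by apply: erestrict_ge0 => p _; rewrite lee_fin mulr_ge0// pk_ge0.
- exact: m1.
apply: eq_integral => t _; apply: eq_integral => s _; rewrite !patchE.
rewrite -pk_sym /=; have -> // : ((t, s) \in sq A) = ((s, t) \in sq A).
by apply/idP/idP; rewrite !inE => -[] /=.
Qed.

(** The mass is at most 1. The bound does not depend on [e], and this uniformity carries all the
    approximations below. *)
Lemma le_integral_pk_fst e A h : 0 < e -> 0 < A -> measurable_fun setT h ->
  (forall t, 0 <= h t) ->
  (\int[leb2]_(p in sq A) (pk e p * h p.1)%:E <=
   \int[leb]_(t in `[(- A)%R, A]) (h t)%:E)%E.
Proof.
move=> e0 A0 mh h0; rewrite integral_pk_fst//.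
have mE : measurable_fun setT (fun t => (poisson_mass e A t * h t)%:E).
  apply/measurable_EFinP/measurable_funM => //.
  have ma (g : R -> R) : measurable_fun setT g -> measurable_fun setT (fun t => atan (g t)).
    by apply: measurableT_comp; apply: continuous_measurable_fun; exact: continuous_atan.
  apply: measurable_funM => //; apply: measurable_funD; apply: ma.
    by do 2 apply: measurable_funM => //; apply: measurable_funB.
  by do 2 apply: measurable_funM => //; apply: measurable_funD.
apply: ge0_le_integral.
- exact: measurable_itv.
- by move=> t _; rewrite lee_fin mulr_ge0// poisson_mass_ge0.
- exact: measurable_funTS.
- by apply/measurable_EFinP/measurable_funTS.
- by move=> t _; rewrite lee_fin ler_piMl// poisson_mass_le1.
Qed.

Lemma le_integral_pk_snd e A h : 0 < e -> 0 < A -> measurable_fun setT h ->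
  (forall t, 0 <= h t) ->
  (\int[leb2]_(p in sq A) (pk e p * h p.2)%:E <=
   \int[leb]_(t in `[(- A)%R, A]) (h t)%:E)%E.
Proof.
move=> e0 A0 mh h0; rewrite integral_pk_snd// -integral_pk_fst//.
exact: le_integral_pk_fst.
Qed.

(** Off the diagonal the kernel is O(e): drop [e ^+ 2] from the denominator. *)
Lemma pk_far e (r : R) (p : R * R) : 0 < e -> 0 < r -> r <= `|p.1 - p.2| ->
  pk e p <= 2 * e / (2 * pi * r) ^+ 2.
Proof.
move=> e0 r0 rp; rewrite /pk /poisson.
have h : 0 < (2 * pi * r) ^+ 2 by rewrite exprn_gt0// !mulr_gt0// pi_gt0.
have e2 : 0 <= 2 * e by rewrite mulr_ge0// ltW.
rewrite ler_wpM2l// lef_pV2 ?posrE//; last first.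
  by rewrite ltr_pwDl ?sqr_ge0// exprn_gt0.
rewrite (@le_trans _ _ ((2 * pi * (p.1 - p.2)) ^+ 2))//; last by rewrite lerDr sqr_ge0.
rewrite -[leRHS]real_normK ?num_real// lerXn2r// ?nnegrE//.
  by rewrite ltW// !mulr_gt0// pi_gt0.
by rewrite normrM (ger0_norm (x := 2 * pi)) ?ler_wpM2l// mulr_ge0 ?pi_ge0.
Qed.

Lemma leb_segment A : 0 < A -> leb `[(- A)%R, A] = (2 * A)%:E.
Proof.
move=> A0; rewrite lebesgue_measure_itv/= lte_fin gtrN// -EFinD opprK.
by congr (_%:E); ring.
Qed.

Lemma leb2_sq A : 0 < A -> leb2 (sq A) = ((2 * A) ^+ 2)%:E.
Proof.
move=> A0; rewrite /sq product_measure1E//.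
by rewrite expr2 EFinM; congr (_ * _)%E; exact: leb_segment.
Qed.

Lemma integral_pk e A : 0 < e -> 0 < A ->
  (\int[leb2]_(p in sq A) (pk e p)%:E <= (2 * A)%:E)%E.
Proof.
move=> e0 A0; have := @le_integral_pk_fst e A (cst 1) e0 A0 (measurable_cst _) (fun=> ler01).
under eq_integral do rewrite /= mulr1.
rewrite -(etrans (etrans (integral_cst leb (measurable_itv `[(- A)%R, A]) 1%E) (mul1e _)) (leb_segment A0)).
exact.
Qed.

(** Near the diagonal [g] varies little and the kernel has bounded mass; away from it the kernel is
    O(e) and [g] is bounded. *)
Lemma pk_continuous_cvg0 A g : 0 < A -> continuous g ->
  (\int[leb2]_(p in sq A) (pk (n.+1%:R)^-1 p * `|g p.1 - g p.2|)%:E)%E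
    @[n --> \oo] --> 0%E.
Proof.
move=> A0 cg; have mg : measurable_fun setT g by exact: continuous_measurable_fun.
have en n : 0 < n.+1%:R^-1 :> R by rewrite invr_gt0.
apply: cvge0_near.
  by move=> n; apply: integral_ge0 => p _; rewrite lee_fin mulr_ge0// pk_ge0.
move=> c c0.
have [M M0 gM] : exists2 M : R, 0 < M & forall s, `[- A, A]%classic s -> `|g s| <= M.
  have [M [_ gM]] := compact_bounded (continuous_compact (continuous_subspaceT cg) (@segment_compact R (- A) A)).
  have M1 : M < `|M| + 1 by rewrite (le_lt_trans (ler_norm _))// ltrDl.
  exists (`|M| + 1); first by rewrite (le_lt_trans (normr_ge0 M))// ltrDl.
  by move=> s sA; apply: (gM _ M1); exists s.
(* The kernel has mass at most 2 A on the square, so an oscillation of at most [b] contributes at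
   most c / 2. *)
pose b := c / (4 * A).
have b0 : 0 < b by rewrite divr_gt0// mulr_gt0.
have [r r0 gr] := compact_continuous_unif (@segment_compact R (- A) A) cg b0.
(* The bound of the kernel off the diagonal with the factor e = 1 / (n + 1) taken out, times the
   bound 2 M of the difference of values. *)
pose K := 2 / (2 * pi * r) ^+ 2 * (2 * M).
have K0 : 0 < K.
  by apply: mulr_gt0; [apply: divr_gt0 => //; rewrite exprn_gt0// !mulr_gt0// pi_gt0|rewrite mulr_gt0].
have bnd n p : sq A p -> pk n.+1%:R^-1 p * `|g p.1 - g p.2| <= pk n.+1%:R^-1 p * b + K / n.+1%:R.
  move=> [p1 p2]; have [pr|pr] := ltP `|p.1 - p.2| r.
    rewrite -[leLHS]addr0 lerD//; first by rewrite ler_wpM2l ?pk_ge0// gr.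
    by rewrite divr_ge0// ltW.
  rewrite -[leLHS]add0r lerD//; first by rewrite mulr_ge0 ?pk_ge0// ltW.
  rewrite (_ : K / _ = 2 / n.+1%:R / (2 * pi * r) ^+ 2 * (2 * M)); last first.
    by rewrite /K [LHS]mulrAC (mulrAC 2).
  apply: ler_pM => //; [exact: pk_ge0|exact: pk_far|].
  by rewrite (le_trans (ler_normB _ _))// mulr2n mulrDl mul1r lerD// gM.
have mpk n : measurable_fun setT (fun p => (pk n.+1%:R^-1 p)%:E).
  by apply/measurable_EFinP; exact: measurable_pk.
have le n : (\int[leb2]_(p in sq A) (pk (n.+1%:R)^-1 p * `|g p.1 - g p.2|)%:E <=
    (2 * A * b + K * (2 * A) ^+ 2 / n.+1%:R)%:E)%E.
  apply: (@le_trans _ _ (\int[leb2]_(p in sq A) (b%:E * (pk n.+1%:R^-1 p)%:E + (K / n.+1%:R)%:E))%E).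
    apply: ge0_le_integral.
    - exact: measurable_sq.
    - by move=> p _; rewrite lee_fin mulr_ge0// pk_ge0.
    - apply/measurable_funTS/measurable_EFinP/measurable_funM; first exact: measurable_pk.
      apply: (measurableT_comp (@normr_measurable R setT)); apply: measurable_funB.
        exact: (measurableT_comp mg measurable_fst).
      exact: (measurableT_comp mg measurable_snd).
    - apply/measurable_funTS; apply: emeasurable_funD => //.
      by apply: measurable_funeM; exact: mpk.
    - by move=> p Ap; rewrite -EFinM -EFinD lee_fin [b * _]mulrC; exact: bnd.
  rewrite ge0_integralD; last first.
  - exact: measurable_cst.
  - by move=> p _; rewrite lee_fin divr_ge0// ltW.
  - by apply: measurable_funeM; apply: measurable_funTS; exact: mpk.
  - by move=> p _; rewrite -EFinM lee_fin mulr_ge0 ?pk_ge0 ?ltW.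
  - exact: measurable_sq.
  rewrite EFinD; apply: leeD.
    rewrite ge0_integralZl; last first.
    - by rewrite lee_fin ltW.
    - by move=> p _; rewrite lee_fin pk_ge0.
    - by apply: measurable_funTS; exact: mpk.
    - exact: measurable_sq.
    rewrite (_ : (2 * A * b)%:E = b%:E * (2 * A)%:E)%E; last by rewrite -EFinM mulrC.
    by apply: lee_wpmul2l; [rewrite lee_fin ltW|exact: integral_pk].
  have -> : (K * (2 * A) ^+ 2 / n.+1%:R)%:E = ((K / n.+1%:R)%:E * leb2 (sq A))%E.
    by rewrite leb2_sq// -EFinM mulrAC.
  by rewrite -(integral_cst leb2 (measurable_sq A)).
have K2 : 0 < K * (2 * A) ^+ 2 by rewrite mulr_gt0// exprn_gt0// mulr_gt0.
have d0 : 0 < c / 2 / (K * (2 * A) ^+ 2) by rewrite !divr_gt0.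
near=> n; rewrite (le_trans (le n))// lee_fin.
rewrite (_ : 2 * A * b = c / 2); last by rewrite /b; field; rewrite gt_eqF.
rewrite [leRHS]splitr lerD// mulrC -ler_pdivlMr// ltW//.
near: n; exact: (near_infty_natSinv_lt (PosNum d0)).
Unshelve. all: by end_near. Qed.

End PoissonForm.

(** * Vanishing of the Poisson form of squared differences *)

Section PoissonFormLimit.
Context {R : realType}.
Implicit Types (e v u t s A : R) (f g h : R -> R) (H : R * R -> R).
Notation leb := (@lebesgue_measure R).
Notation leb2 := (leb \x leb)%E.

Definition pk_form e A (H : R * R -> R) : \bar R :=
  (\int[leb2]_(p in sq A) (pk e p * H p)%:E)%E.

Lemma pk_form_ge0 e A H : 0 < e -> (forall p, 0 <= H p) -> (0 <= pk_form e A H)%E.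
Proof.
by move=> e0 H0; apply: integral_ge0 => p _; rewrite lee_fin mulr_ge0// pk_ge0.
Qed.

Lemma measurable_pkM e A H : 0 < e -> measurable_fun setT H ->
  measurable_fun (sq A) (fun p => (pk e p * H p)%:E).
Proof.
move=> e0 mH; apply/measurable_funTS/measurable_EFinP/measurable_funM => //.
exact: measurable_pk.
Qed.

(** Each of the two one-variable errors is integrated against a kernel of mass at most 1, hence the
    factor 2. *)
Lemma le_pk_form e A H (H1 : R * R -> R) h : 0 < e -> 0 < A ->
  measurable_fun setT H -> measurable_fun setT H1 -> measurable_fun setT h ->
  (forall p, 0 <= H p) -> (forall p, 0 <= H1 p) -> (forall t, 0 <= h t) ->
  (forall p, H p <= H1 p + h p.1 + h p.2) ->
  (pk_form e A H <= pk_form e A H1 + 2%:E * \int[leb]_(t in `[(- A)%R, A]) (h t)%:E)%E.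
Proof.
move=> e0 A0 mH mH1 mh H0 H10 h0 le.
pose h1 (p : R * R) := h p.1; pose h2 (p : R * R) := h p.2.
have m1 : measurable_fun setT h1 by exact: (measurableT_comp mh measurable_fst).
have m2 : measurable_fun setT h2 by exact: (measurableT_comp mh measurable_snd).
have h10 p : 0 <= h1 p by exact: h0.
have h20 p : 0 <= h2 p by exact: h0.
apply: (@le_trans _ _ (pk_form e A H1 + (pk_form e A h1 + pk_form e A h2))%E); last first.
  apply: leeD2l; rewrite mule_natl mule2n; apply: leeD.
    exact: le_integral_pk_fst.
  exact: le_integral_pk_snd.
have mA := measurable_sq A.
rewrite /pk_form -ge0_integralD; last first.
- exact: measurable_pkM.
- by move=> p _; rewrite lee_fin mulr_ge0 ?pk_ge0.
- exact: measurable_pkM.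
- by move=> p _; rewrite lee_fin mulr_ge0 ?pk_ge0.
- exact: mA.
rewrite -ge0_integralD; last first.
- by apply: emeasurable_funD; exact: measurable_pkM.
- by move=> p _; rewrite adde_ge0// lee_fin mulr_ge0 ?pk_ge0.
- exact: measurable_pkM.
- by move=> p _; rewrite lee_fin mulr_ge0 ?pk_ge0.
- exact: mA.
apply: ge0_le_integral.
- exact: mA.
- by move=> p _; rewrite lee_fin mulr_ge0 ?pk_ge0.
- exact: measurable_pkM.
- by apply: emeasurable_funD; [|apply: emeasurable_funD]; exact: measurable_pkM.
- move=> p _; rewrite -!EFinD lee_fin -!mulrDr addrA ler_wpM2l ?pk_ge0//.
Qed.

(** A density argument: the error made by replacing [H] with [H1] is bounded uniformly in n, so it
    may be fixed before n grows. *)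
Lemma pk_form_approx A H : 0 < A -> measurable_fun setT H -> (forall p, 0 <= H p) ->
  (forall c : R, 0 < c -> exists H1 : R * R -> R, exists h : R -> R,
    [/\ measurable_fun setT H1 /\ measurable_fun setT h,
        (forall p, 0 <= H1 p) /\ (forall t, 0 <= h t),
        (forall p, H p <= H1 p + h p.1 + h p.2),
        pk_form n.+1%:R^-1 A H1 @[n --> \oo] --> 0%E &
        (\int[leb]_(t in `[(- A)%R, A]) (h t)%:E <= c%:E)%E]) ->
  pk_form n.+1%:R^-1 A H @[n --> \oo] --> 0%E.
Proof.
move=> A0 mH H0 ap.
have en n : 0 < n.+1%:R^-1 :> R by rewrite invr_gt0.
apply: cvge0_near => [n|c c0]; first exact: pk_form_ge0.
(* The error counts twice and so uses c / 2; the other half is for [H1]. *)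
have c4 : 0 < c / 4 by rewrite divr_gt0.
have [H1 [h [[m1 mh] [H10 h0] le cv hc]]] := ap _ c4.
have c2 : 0 < c / 2 by rewrite divr_gt0.
apply: filterS (cvge0_nearP cv c2) => n Hn.
apply: (le_trans (le_pk_form (en n) A0 mH m1 mh H0 H10 h0 le)).
rewrite (_ : c%:E = (c / 2)%:E + 2%:E * (c / 4)%:E)%E; last first.
  by rewrite -EFinM -EFinD; congr (_%:E); field.
by apply: leeD => //; apply: lee_wpmul2l.
Qed.

Let mfst f : measurable_fun setT f -> measurable_fun setT (fun p : R * R => f p.1).
Proof. by move=> mf; exact: (measurableT_comp mf measurable_fst). Qed.

Let msnd f : measurable_fun setT f -> measurable_fun setT (fun p : R * R => f p.2).
Proof. by move=> mf; exact: (measurableT_comp mf measurable_snd). Qed.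

Lemma pk_form_scale_cvg0 A H (k : R) : 0 < A -> 0 <= k -> measurable_fun setT H ->
  (forall p, 0 <= H p) ->
  pk_form n.+1%:R^-1 A H @[n --> \oo] --> 0%E ->
  pk_form n.+1%:R^-1 A (fun p => k * H p) @[n --> \oo] --> 0%E.
Proof.
move=> A0 k0 mH H0 cv.
have en n : 0 < n.+1%:R^-1 :> R by rewrite invr_gt0.
have -> : (fun n => pk_form n.+1%:R^-1 A (fun p => k * H p)) =
          (fun n => k%:E * pk_form n.+1%:R^-1 A H)%E.
  apply/funext => n; rewrite /pk_form -ge0_integralZl; last first.
  - by rewrite lee_fin.
  - by move=> p _; rewrite lee_fin mulr_ge0 ?pk_ge0.
  - exact: measurable_pkM.
  - exact: measurable_sq.
  by apply: eq_integral => p _; rewrite -EFinM mulrCA.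
by rewrite -[X in _ --> X](mule0 k%:E); apply: cvgeZl.
Qed.

(** For |f| <= M the squared difference is at most 2 M times the difference, so approximation by
    continuous functions in L1 is enough. *)
Lemma pk_form_bounded_cvg0 A f (M : R) : 0 < A -> measurable_fun setT f ->
  (forall t, `|f t| <= M) ->
  pk_form n.+1%:R^-1 A (fun p => (f p.1 - f p.2) ^+ 2) @[n --> \oo] --> 0%E.
Proof.
move=> A0 mf fM.
have M0 : 0 <= M by rewrite (le_trans _ (fM 0)).
have mI : measurable `[(- A)%R, A] by exact: measurable_itv.
have fI : (leb `[(- A)%R, A] < +oo)%E by rewrite leb_segment// ltry.
have itf : leb.-integrable `[(- A)%R, A] (EFin \o f).
  apply: measurable_bounded_integrable => //; first exact: measurable_funTS.
  by exists M; split; [exact: num_real|move=> y My t _; exact: (le_trans (fM t) (ltW My))].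
have [g_ [cg ig cvg]] := approximation_continuous_integrable mI fI itf.
apply: pk_form_approx => //.
- by apply: measurable_funX; apply: measurable_funB; [exact: mfst|exact: msnd].
- by move=> p; exact: sqr_ge0.
- move=> c c0.
  (* The error enters with the factor 2 M; the added 1 keeps the denominator positive when M = 0. *)
  have c1 : 0 < c / (2 * M + 1) by rewrite divr_gt0// ltr_wpDl// mulr_ge0.
  have /filter_ex[k Hk] := cvge0_nearP cvg c1.
  have mg : measurable_fun setT (g_ k) by exact: continuous_measurable_fun.
  exists (fun p => 2 * M * `|g_ k p.1 - g_ k p.2|), (fun t => 2 * M * `|f t - g_ k t|).
  have M2 : 0 <= 2 * M by rewrite mulr_ge0.
  have mn (T : measurableType _) (u : T -> R) : measurable_fun setT u -> measurable_fun setT (fun x => `|u x|).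
    by move=> mu; exact: measurableT_comp.
  have mH : measurable_fun setT (fun p : R * R => `|g_ k p.1 - g_ k p.2|).
    by apply: mn; apply: measurable_funB; [exact: mfst|exact: msnd].
  have mh : measurable_fun setT (fun t => `|f t - g_ k t|).
    by apply: measurableT_comp => //; apply: measurable_funB.
  split.
  + by split; apply: measurable_funM.
  + by split=> p; rewrite mulr_ge0.
  + move=> p; rewrite -!mulrDr -[leLHS]real_normK ?num_real// expr2.
    apply: ler_pM => //.
      by rewrite (le_trans (ler_normB _ _))// mulr2n mulrDl mul1r lerD.
    rewrite (_ : f p.1 - f p.2 = (g_ k p.1 - g_ k p.2) + (f p.1 - g_ k p.1) - (f p.2 - g_ k p.2)); last by ring.
    by rewrite (le_trans (ler_normB _ _))// lerD2r ler_normD.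
  + by apply: pk_form_scale_cvg0 => //; exact: pk_continuous_cvg0.
  + under eq_integral do rewrite EFinM.
    rewrite ge0_integralZl//; last exact/measurable_EFinP/measurable_funTS.
    apply: (@le_trans _ _ ((2 * M)%:E * (c / (2 * M + 1))%:E)%E).
      by apply: lee_wpmul2l.
    rewrite -EFinM lee_fin mulrCA ger_pMr// ler_pdivrMr ?mul1r ?lerDl//.
    by rewrite ltr_wpDl.
Qed.
End PoissonFormLimit.

Lemma ge0_integrable d (T : measurableType d) (R : realType)
    (mu : {measure set T -> \bar R}) (D : set T) (f : T -> R) :
  measurable_fun D f -> (forall x, 0 <= f x) ->
  (\int[mu]_(x in D) (f x)%:E < +oo)%E -> mu.-integrable D (EFin \o f).
Proof.
move=> mf f0 fi; apply/integrableP; split; first exact/measurable_EFinP.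
by under eq_integral do rewrite /= ger0_norm//.
Qed.

Section PoissonL2.
Context {R : realType}.
Implicit Types (e v u t s A : R) (f g h : R -> R) (H : R * R -> R).
Notation leb := (@lebesgue_measure R).
Notation leb2 := (leb \x leb)%E.

(** [f] is cut off where |f| > k, and the remainder tends to 0 in L2 by dominated convergence. The
    factor 3 comes from (x + y - z)^2 <= 3 (x^2 + y^2 + z^2). *)
Lemma pk_form_L2_cvg0 A f : 0 < A -> measurable_fun setT f ->
  (\int[leb]_(t in `[(- A)%R, A]) (f t ^+ 2)%:E < +oo)%E ->
  pk_form n.+1%:R^-1 A (fun p => (f p.1 - f p.2) ^+ 2) @[n --> \oo] --> 0%E.
Proof.
move=> A0 mf f2.
have mfst g : measurable_fun setT g -> measurable_fun setT (fun p : R * R => g p.1).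
  by move=> mg; exact: (measurableT_comp mg measurable_fst).
have msnd g : measurable_fun setT g -> measurable_fun setT (fun p : R * R => g p.2).
  by move=> mg; exact: (measurableT_comp mg measurable_snd).
pose S (k : nat) := [set t | `|f t| <= k%:R].
have mS k : measurable (S k).
  rewrite -[S k]setTI; apply: (@measurable_fun_ler _ _ _ setT (fun t => `|f t|) (cst k%:R)) => //.
  exact: measurableT_comp.
pose F k t := f t * \1_(S k) t.
have mF k : measurable_fun setT (F k).
  by apply: measurable_funM => //; exact: measurable_indic.
have mFB k : measurable_fun setT (fun t => 3 * (f t - F k t) ^+ 2).
  by apply: measurable_funM => //; apply: measurable_funX; apply: measurable_funB => //; exact: mF.
have FE k t : F k t = if `|f t| <= k%:R then f t else 0.
  rewrite /F indicE; case: ifPn => h.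
    by rewrite mem_set ?mulr1.
  by rewrite memNset ?mulr0//; exact/negP.
have cv : (\int[leb]_(t in `[(- A)%R, A]) ((3 * (f t - F k t) ^+ 2)%:E))%E @[k --> \oo] --> 0%E.
  have -> : 0%E = (\int[leb]_(t in `[(- A)%R, A]) (cst 0%E t : \bar R))%E.
    by rewrite integral_cst ?mul0e//; exact: measurable_itv.
  apply: (@dominated_cvg _ _ _ leb `[(- A)%R, A] (measurable_itv _) _ _ (fun t => (3 * f t ^+ 2)%:E)).
  - by move=> k; apply/measurable_funTS/measurable_EFinP; exact: mFB.
  - move=> t _; apply: cvg_near_cst; near=> k.
    rewrite FE ifT ?subrr ?expr0n ?mulr0//.
    near: k; exact: nbhs_infty_ger.
  - by [].
  - have -> : (fun t => (3 * f t ^+ 2)%:E) = (fun t => 3%:E * (f t ^+ 2)%:E)%E by [].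
    apply: integrableZl; first exact: measurable_itv.
    apply: ge0_integrable => //; last by move=> t; exact: sqr_ge0.
    by apply/measurable_funTS; exact: measurable_funX.
  - move=> k t _; rewrite gee0_abs; last by rewrite lee_fin mulr_ge0// sqr_ge0.
    rewrite lee_fin ler_wpM2l// FE.
    by case: ifP => _; rewrite ?subr0// subrr expr0n sqr_ge0.
apply: pk_form_approx => //.
- by apply: measurable_funX; apply: measurable_funB; [exact: mfst|exact: msnd].
- by move=> p; exact: sqr_ge0.
- move=> c c0; have /filter_ex[k Hk] := cvge0_nearP cv c0.
  exists (fun p => 3 * (F k p.1 - F k p.2) ^+ 2), (fun t => 3 * (f t - F k t) ^+ 2).
  have mH : measurable_fun setT (fun p : R * R => (F k p.1 - F k p.2) ^+ 2).
    by apply: measurable_funX; apply: measurable_funB; [exact: (mfst _ (mF k))|exact: (msnd _ (mF k))].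
  split => //.
  + by split; [exact: measurable_funM|exact: mFB].
  + by split=> p; rewrite mulr_ge0 ?sqr_ge0.
  + move=> p; set x := F k p.1 - F k p.2; set y := f p.1 - F k p.1; set z := f p.2 - F k p.2.
    rewrite (_ : f p.1 - f p.2 = x + y - z); last by rewrite /x /y /z; ring.
    rewrite -subr_ge0 (_ : _ - _ = (x - y) ^+ 2 + (y + z) ^+ 2 + (x + z) ^+ 2); last by ring.
    by rewrite !addr_ge0 ?sqr_ge0.
  + apply: pk_form_scale_cvg0 => //; first by move=> p; exact: sqr_ge0.
    apply: (@pk_form_bounded_cvg0 _ A (F k) k%:R) => // t.
    by rewrite FE; case: ifP => // _; rewrite normr0.
Unshelve. all: by end_near. Qed.
End PoissonL2.

(** * Plancherel isometry on a segment *)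

Section ProductIntegrals.
Context d1 d2 (T1 : measurableType d1) (T2 : measurableType d2) (R : realType).
Variables (m1 : {sigma_finite_measure set T1 -> \bar R})
          (m2 : {sigma_finite_measure set T2 -> \bar R}).
Variables (f : T1 -> R) (g : T2 -> R).
Hypotheses (intf : m1.-integrable setT (EFin \o f))
           (intg : m2.-integrable setT (EFin \o g)).

Lemma integrable_prodM :
  (m1 \x m2)%E.-integrable setT (EFin \o (fun p => f p.1 * g p.2)).
Proof.
have mf : measurable_fun setT f by apply/measurable_EFinP; exact: measurable_int intf.
have mg : measurable_fun setT g by apply/measurable_EFinP; exact: measurable_int intg.
have mfg : measurable_fun setT (EFin \o (fun p : T1 * T2 => f p.1 * g p.2)).
  apply/measurable_EFinP/measurable_funM.
    exact: (measurableT_comp mf measurable_fst).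
  exact: (measurableT_comp mg measurable_snd).
apply/(integrable12ltyP _ _ mfg).
pose Mf := (\int[m1]_x `|(f x)%:E|)%E; pose Mg := (\int[m2]_y `|(g y)%:E|)%E.
have -> : (\int[m1]_x \int[m2]_y `|(f (x, y).1 * g (x, y).2)%:E| = Mf * Mg)%E.
  have Mgfin : Mg \is a fin_num.
    by rewrite ge0_fin_numE ?integral_ge0//; move/integrableP : intg => [].
  transitivity (\int[m1]_x (`|(f x)%:E| * Mg))%E.
    apply: eq_integral => x _; rewrite -ge0_integralZl//; last first.
      by apply/measurable_EFinP; exact: measurableT_comp.
    by apply: eq_integral => y _; rewrite -abseM -EFinM.
  rewrite ge0_integralZr//; last exact: integral_ge0.
  by apply/measurable_EFinP; exact: measurableT_comp.
rewrite lte_mul_pinfty ?integral_ge0//.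
  by rewrite ge0_fin_numE ?integral_ge0//; move/integrableP : intf => [].
by move/integrableP : intg => [].
Qed.

Lemma integral_prodM :
  (\int[(m1 \x m2)]_p (f p.1 * g p.2)%:E =
   \int[m1]_x (f x)%:E * \int[m2]_y (g y)%:E)%E.
Proof.
rewrite -(integral12_prod_meas1 integrable_prodM).
have fg := integrable_fin_num measurableT intg.
transitivity (\int[m1]_x ((f x)%:E * \int[m2]_y (g y)%:E))%E.
  apply: eq_integral => x _; rewrite /fubini_F/=.
  by under eq_integral do rewrite EFinM; rewrite integralZl.
rewrite -[X in (_ * X)%E]fineK//.
by under eq_integral do rewrite -[X in (_ * X)%E]fineK//; rewrite integralZr.
Qed.
End ProductIntegrals.

Section ProductSigmaFinite.
Context d1 d2 (T1 : measurableType d1) (T2 : measurableType d2) (R : realType).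
Variables (m1 : {sigma_finite_measure set T1 -> \bar R})
          (m2 : {sigma_finite_measure set T2 -> \bar R}).

(* The canonical sigma-finite structure of MathComp-Analysis on [m1 \x m2] is
   only inferred when [m1] and [m2] are subprobabilities. *)
Definition prod_sfinite : set (T1 * T2) -> \bar R := (m1 \x m2)%E.

HB.instance Definition _ := Measure.on prod_sfinite.

Lemma sigma_finite_prod_sfinite : sigma_finite setT prod_sfinite.
Proof.
have /sigma_finiteP[F [FT ndF Foo]] := sigma_finiteT m1.
have /sigma_finiteP[G [GT ndG Goo]] := sigma_finiteT m2.
exists (fun n => F n `*` G n).
  apply/seteqP; split => // -[x y] _.
  have [i _ Fi] : (\bigcup_i F i) x by rewrite -FT.
  have [j _ Gj] : (\bigcup_i G i) y by rewrite -GT.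
  exists (maxn i j) => //; split.
    by apply: (subsetPset _ _ (ndF _ _ (leq_maxl i j))).
  by apply: (subsetPset _ _ (ndG _ _ (leq_maxr i j))).
move=> k; have [mF Fk] := Foo k; have [mG Gk] := Goo k.
split; first exact: measurableX.
by rewrite /prod_sfinite product_measure1E// lte_mul_pinfty// ge0_fin_numE.
Qed.

HB.instance Definition _ :=
  Measure_isSigmaFinite.Build _ _ _ prod_sfinite sigma_finite_prod_sfinite.

End ProductSigmaFinite.

Section RealIntegrable.
Context d (T : measurableType d) (R : realType) (mu : {measure set T -> \bar R}).
Variables (D : set T) (mD : measurable D).
Implicit Types f g : T -> R.

Lemma integrable_EFinD f g : mu.-integrable D (EFin \o f) ->
  mu.-integrable D (EFin \o g) -> mu.-integrable D (EFin \o (fun x => f x + g x)).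
Proof. by move=> intf intg; have := integrableD mD intf intg. Qed.

Lemma integrable_EFinB f g : mu.-integrable D (EFin \o f) ->
  mu.-integrable D (EFin \o g) -> mu.-integrable D (EFin \o (fun x => f x - g x)).
Proof. by move=> intf intg; have := integrableB mD intf intg. Qed.

Lemma integrable_EFinM_le1 f g : mu.-integrable D (EFin \o f) ->
  measurable_fun D g -> (forall t, `|g t| <= 1) ->
  mu.-integrable D (EFin \o (fun t => f t * g t)).
Proof.
move=> intf mg g1.
have mf : measurable_fun D f by apply/measurable_EFinP; exact: measurable_int intf.
apply: le_integrable intf => //; first by apply/measurable_EFinP; exact: measurable_funM.
by move=> t _; rewrite lee_fin normrM ler_piMr.
Qed.

End RealIntegrable.

Lemma measurable_fun_cos d (T : measurableType d) (R : realType) (h : T -> R) :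
  measurable_fun setT h -> measurable_fun setT (fun x => cos (h x)).
Proof. by apply: measurableT_comp; apply: continuous_measurable_fun; exact: continuous_cos. Qed.

Lemma measurable_fun_sin d (T : measurableType d) (R : realType) (h : T -> R) :
  measurable_fun setT h -> measurable_fun setT (fun x => sin (h x)).
Proof. by apply: measurableT_comp; apply: continuous_measurable_fun; exact: continuous_sin. Qed.

(** * The Abel mean of the squared transform as a Poisson form *)

Section AbelFourier.
Context {R : realType}.
Implicit Types (e v u t s A : R) (f g h : R -> R).
Notation leb := (@lebesgue_measure R).
Notation leb2 := (leb \x leb)%E.

Variables a b : R -> R.
Hypotheses (ma : measurable_fun setT a) (mb : measurable_fun setT b).
Hypotheses (ia : leb.-integrable setT (EFin \o a)).
Hypotheses (ib : leb.-integrable setT (EFin \o b)).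

Let ph u t := 2 * pi * (t * u).
Let mph u : measurable_fun setT (ph u).
Proof. by apply: measurable_funM => //; exact: measurable_funM. Qed.

(** [Phi] and [Psi] are the real and imaginary parts of w(t) = (a + i b) exp (- i ph). *)
Let Phi u t := a t * cos (ph u t) + b t * sin (ph u t).
Let Psi u t := b t * cos (ph u t) - a t * sin (ph u t).

Let iPhi u : leb.-integrable setT (EFin \o Phi u).
Proof.
apply: integrable_EFinD => //; apply: integrable_EFinM_le1 => //.
- by apply: measurable_fun_cos; exact: mph.
- by move=> t; exact: normr_cos_le1.
- by apply: measurable_fun_sin; exact: mph.
- by move=> t; exact: normr_sin_le1.
Qed.

Let iPsi u : leb.-integrable setT (EFin \o Psi u).
Proof.
apply: integrable_EFinB => //; apply: integrable_EFinM_le1 => //.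
- by apply: measurable_fun_cos; exact: mph.
- by move=> t; exact: normr_cos_le1.
- by apply: measurable_fun_sin; exact: mph.
- by move=> t; exact: normr_sin_le1.
Qed.

Let Fr u : R := \int[leb]_t Phi u t.
Let Fi u : R := \int[leb]_t Psi u t.

(** The real part of w(p.1) times the conjugate of w(p.2); only the difference of the two phases
    survives. *)
Let G u (p : R * R) : R :=
  (a p.1 * a p.2 + b p.1 * b p.2) * cos (2 * pi * (p.1 - p.2) * u) +
  (b p.1 * a p.2 - a p.1 * b p.2) * sin (2 * pi * (p.1 - p.2) * u).

Let GE u p : G u p = Phi u p.1 * Phi u p.2 + Psi u p.1 * Psi u p.2.
Proof.
rewrite /G /Phi /Psi.
have -> : 2 * pi * (p.1 - p.2) * u = ph u p.1 - ph u p.2.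
  by rewrite /ph -mulrBr -mulrBl mulrA.
by rewrite cosB sinB; ring.
Qed.

Let sqr_FrFi u : (\int[leb2]_p (G u p)%:E = (Fr u ^+ 2 + Fi u ^+ 2)%:E)%E.
Proof.
transitivity (\int[leb2]_p ((Phi u p.1 * Phi u p.2)%:E + (Psi u p.1 * Psi u p.2)%:E))%E.
  by apply: eq_integral => p _; rewrite GE EFinD.
rewrite integralD//; [|exact: integrable_prodM|exact: integrable_prodM].
rewrite !integral_prodM//.
have f1 := integrable_fin_num measurableT (iPhi u).
have f2 := integrable_fin_num measurableT (iPsi u).
rewrite -[X in (X * _ + _)%E]fineK// -[X in (_ * X + _)%E]fineK//.
rewrite -[X in (_ + X * _)%E]fineK// -[X in (_ + _ * X)%E]fineK//.
Qed.

Variable e : R.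
Hypothesis e0 : 0 < e.

Let cc t := `|a t| + `|b t|.
Let icc : leb.-integrable setT (EFin \o cc).
Proof. by apply: integrable_EFinD => //; exact: integrable_norm. Qed.

Let K (q : R * (R * R)) : \bar R := (abelw e q.1 * G q.1 q.2)%:E.

Let mG : measurable_fun setT (fun q : R * (R * R) => G q.1 q.2).
Proof.
have m1 (h : R -> R) : measurable_fun setT h -> measurable_fun setT (fun q : R * (R * R) => h q.2.1).
  by move=> mh; apply: (measurableT_comp mh); exact: (measurableT_comp measurable_fst measurable_snd).
have m2 (h : R -> R) : measurable_fun setT h -> measurable_fun setT (fun q : R * (R * R) => h q.2.2).
  by move=> mh; apply: (measurableT_comp mh); exact: (measurableT_comp measurable_snd measurable_snd).
have mth : measurable_fun setT (fun q : R * (R * R) => 2 * pi * (q.2.1 - q.2.2) * q.1).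
  apply: measurable_funM; last exact: measurable_fst.
  by apply: measurable_funM => //; apply: measurable_funB; [exact: (m1 id)|exact: (m2 id)].
have a1 := m1 _ ma; have a2' := m2 _ ma; have b1 := m1 _ mb; have b2' := m2 _ mb.
apply: measurable_funD; apply: measurable_funM.
- by apply: measurable_funD; apply: measurable_funM.
- exact: measurable_fun_cos.
- by apply: measurable_funB; apply: measurable_funM.
- exact: measurable_fun_sin.
Qed.

(** |G| is at most [cc p.1 * cc p.2] for every u, so [K] is dominated by a product of three
    integrable functions of one variable; the weight supplies the decay in u that [G] does not
    have. *)
Let iK : (leb \x prod_sfinite leb leb)%E.-integrable setT K.
Proof.
have i1 := integrable_prodM icc icc.
have i2 := @integrable_prodM _ _ _ _ _ leb (prod_sfinite leb leb) _ _ (integrable_abelw e0) i1.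
apply: le_integrable i2 => //.
  apply/measurable_EFinP/measurable_funM => //.
  exact: (measurableT_comp (measurable_abelw e) measurable_fst).
move=> q _; rewrite lee_fin /= !normrM ler_wpM2l//.
rewrite /G (le_trans (ler_normD _ _))// !normrM.
set x := `|cos _|; set y := `|sin _|.
have x1 : x <= 1 by exact: normr_cos_le1.
have y1 : y <= 1 by exact: normr_sin_le1.
rewrite (@le_trans _ _ (`|a q.2.1 * a q.2.2 + b q.2.1 * b q.2.2| + `|b q.2.1 * a q.2.2 - a q.2.1 * b q.2.2|))//.
  by rewrite lerD// ler_piMr.
apply: (le_trans (lerD (ler_normD _ _) (ler_normB _ _))).
rewrite !normrM /cc [X in _ <= X * _]ger0_norm ?addr_ge0// [X in _ <= _ * X]ger0_norm ?addr_ge0//.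
by rewrite le_eqVlt; apply/orP; left; apply/eqP; ring.
Qed.

(* The weight [abelw e] makes Fubini applicable to the double integral
   hidden in the square of the transform, and turns its phase into a Poisson
   kernel. *)
Lemma abel_fourier1 :
  leb2.-integrable setT (fun p => (pk e p * (a p.1 * a p.2 + b p.1 * b p.2))%:E) /\
  (\int[leb]_u (abelw e u * (Fr u ^+ 2 + Fi u ^+ 2))%:E =
   \int[leb2]_p (pk e p * (a p.1 * a p.2 + b p.1 * b p.2))%:E)%E.
Proof.
(* Integrating out u turns the cosine into the Poisson kernel, while the sine contributes 0. *)
have KG p : (\int[leb]_u K (u, p) = (pk e p * (a p.1 * a p.2 + b p.1 * b p.2))%:E)%E.
  rewrite /K /G /=.
  set v := 2 * pi * (p.1 - p.2); set x := _ + _; set y := b p.1 * a p.2 - _.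
  transitivity (\int[leb]_u (x%:E * (abelw e u * cos (v * u))%:E + y%:E * (abelw e u * sin (v * u))%:E))%E.
    by apply: eq_integral => u _; rewrite -!EFinM -EFinD; congr (_%:E); ring.
  have ic : leb.-integrable setT (EFin \o (fun u => abelw e u * cos (v * u))).
    by apply: integrable_abelw_bounded => //; [exact: measurable_cosM|move=> u; exact: normr_cos_le1].
  have isn : leb.-integrable setT (EFin \o (fun u => abelw e u * sin (v * u))).
    by apply: integrable_abelw_bounded => //; [exact: measurable_sinM|move=> u; exact: normr_sin_le1].
  rewrite integralD//; [|exact: integrableZl|exact: integrableZl].
  rewrite !integralZl// integral_abelw_cos// integral_abelw_sin// mule0 adde0.
  by rewrite -EFinM mulrC.
split.
  (* The kernel is largest on the diagonal, where its value is 2 / e. *)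
  have ix : leb2.-integrable setT (EFin \o (fun p => 2 / e * (a p.1 * a p.2 + b p.1 * b p.2))).
    have := integrable_EFinD measurableT (integrable_prodM ia ia) (integrable_prodM ib ib).
    by move=> /(integrableZl measurableT (2 / e)).
  apply: le_integrable ix => //.
    apply/measurable_EFinP/measurable_funM; first exact: measurable_pk.
    have m1 (h : R -> R) : measurable_fun setT h -> measurable_fun setT (fun p : R * R => h p.1).
      by move=> mh; apply: (measurableT_comp mh measurable_fst).
    have m2 (h : R -> R) : measurable_fun setT h -> measurable_fun setT (fun p : R * R => h p.2).
      by move=> mh; apply: (measurableT_comp mh measurable_snd).
    by apply: measurable_funD; apply: measurable_funM; [exact: (m1 a)|exact: (m2 a)|exact: (m1 b)|exact: (m2 b)].
  move=> p _; rewrite lee_fin /= normrM [leRHS]normrM ler_wpM2r//.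
  rewrite [leLHS]ger0_norm ?pk_ge0// [leRHS]ger0_norm ?divr_ge0 ?(ltW e0)//.
  rewrite /pk /poisson (_ : 2 / e = 2 * e / e ^+ 2); last by field; rewrite gt_eqF.
  have e20 : 0 <= 2 * e by rewrite mulr_ge0 ?ltW.
  rewrite ler_wpM2l// lef_pV2 ?posrE ?exprn_gt0//.
    by rewrite lerDl sqr_ge0.
  by rewrite ltr_pwDl ?sqr_ge0// exprn_gt0.
transitivity (\int[leb]_u \int[leb2]_p K (u, p))%E.
  apply: eq_integral => u _; rewrite /K /= EFinM -sqr_FrFi.
  under [RHS]eq_integral do rewrite EFinM.
  rewrite integralZl//.
  have -> : (fun p => (G u p)%:E) = EFin \o (fun p => Phi u p.1 * Phi u p.2 + Psi u p.1 * Psi u p.2).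
    by apply/funext => p /=; rewrite GE.
  by apply: integrable_EFinD => //; exact: integrable_prodM.
rewrite (Fubini iK).
by apply: eq_integral => p _; exact: KG.
Qed.
End AbelFourier.

Lemma measurable_poisson_mass {R : realType} (e A : R) : measurable_fun setT (poisson_mass e A).
Proof.
have ma (g : R -> R) : measurable_fun setT g -> measurable_fun setT (fun t => atan (g t)).
  by apply: measurableT_comp; apply: continuous_measurable_fun; exact: continuous_atan.
apply: measurable_funM => //; apply: measurable_funD; apply: ma.
  by do 2 apply: measurable_funM => //; apply: measurable_funB.
by do 2 apply: measurable_funM => //; apply: measurable_funD.
Qed.

(** The positive and negative parts have measurable partial integrals by Tonelli, and [fine] of
    their difference is measurable even where it is infinite or undefined. *)
Lemma measurable_Rintegral_param d1 d2 (T1 : measurableType d1) (T2 : measurableType d2)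
    (R : realType) (m2 : {sigma_finite_measure set T2 -> \bar R}) (f : T1 * T2 -> R) :
  measurable_fun setT f -> measurable_fun setT (fun x => \int[m2]_y f (x, y)).
Proof.
move=> mf; apply: measurableT_comp => //.
have mef : measurable_fun setT (EFin \o f) by exact/measurable_EFinP.
pose fp := fun x => (\int[m2]_y (EFin \o f)^\+ (x, y))%E.
pose fn := fun x => (\int[m2]_y (EFin \o f)^\- (x, y))%E.
rewrite (_ : (fun x => _) = fp \- fn)%E; last first.
  apply/funext => x; rewrite integralE.
  by congr (_ - _)%E; apply: eq_integral => y _; rewrite ?funeposE ?funenegE.
apply: emeasurable_funB.
  apply: (measurable_fun_fubini_tonelli_F _ (measurable_funepos mef)) => p; exact: funepos_ge0.
apply: (measurable_fun_fubini_tonelli_F _ (measurable_funeneg mef)) => p; exact: funeneg_ge0.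
Qed.

(* For a phase [th], [ftre] and [ftim] are the real and imaginary parts of the
   integral of [(a + i b) exp (- i th(., u))]. *)
Definition ftre d (T : measurableType d) (R : realType) (mu : {measure set T -> \bar R})
    (th : T -> T -> R) (a b : T -> R) (u : T) : R :=
  \int[mu]_t (a t * cos (th t u) + b t * sin (th t u)).

Definition ftim d (T : measurableType d) (R : realType) (mu : {measure set T -> \bar R})
    (th : T -> T -> R) (a b : T -> R) (u : T) : R :=
  \int[mu]_t (b t * cos (th t u) - a t * sin (th t u)).

Section MeasurableFT.
Context d (T : measurableType d) (R : realType) (mu : {sigma_finite_measure set T -> \bar R}).
Variables (th : T -> T -> R) (a b : T -> R).
Hypothesis mth : measurable_fun setT (fun p : T * T => th p.1 p.2).
Hypotheses (ma : measurable_fun setT a) (mb : measurable_fun setT b).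

Let msnd (h : T -> R) : measurable_fun setT h -> measurable_fun setT (fun p : T * T => h p.2).
Proof. by move=> mh; exact: (measurableT_comp mh measurable_snd). Qed.

Let mth' : measurable_fun setT (fun p : T * T => th p.2 p.1).
Proof.
have ms : measurable_fun setT (fun p : T * T => (p.2, p.1)).
  by apply: measurable_fun_pair; [exact: measurable_snd|exact: measurable_fst].
exact: (measurableT_comp mth ms).
Qed.

Lemma measurable_ftre : measurable_fun setT (ftre mu th a b).
Proof.
apply: (@measurable_Rintegral_param _ _ _ _ _ mu (fun p => a p.2 * cos (th p.2 p.1) + b p.2 * sin (th p.2 p.1))).
apply: measurable_funD; apply: measurable_funM; [exact: msnd|exact: measurable_fun_cos|exact: msnd|exact: measurable_fun_sin].
Qed.

Lemma measurable_ftim : measurable_fun setT (ftim mu th a b).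
Proof.
apply: (@measurable_Rintegral_param _ _ _ _ _ mu (fun p => b p.2 * cos (th p.2 p.1) - a p.2 * sin (th p.2 p.1))).
apply: measurable_funB; apply: measurable_funM; [exact: msnd|exact: measurable_fun_cos|exact: msnd|exact: measurable_fun_sin].
Qed.
End MeasurableFT.

(** * Passage to the limit in the Abel means *)

Section SegmentIsometry.
Context {R : realType}.
Implicit Types (e A : R).
Notation leb := (@lebesgue_measure R).
Notation leb2 := (leb \x leb)%E.

Lemma pk_formD e A (H1 H2 : R * R -> R) : 0 < e ->
  measurable_fun setT H1 -> measurable_fun setT H2 ->
  (forall p, 0 <= H1 p) -> (forall p, 0 <= H2 p) ->
  pk_form e A (fun p => H1 p + H2 p) = (pk_form e A H1 + pk_form e A H2)%E.
Proof.
move=> e0 m1 m2 h1 h2; rewrite /pk_form -ge0_integralD; last first.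
- exact: measurable_pkM.
- by move=> p _; rewrite lee_fin mulr_ge0 ?pk_ge0.
- exact: measurable_pkM.
- by move=> p _; rewrite lee_fin mulr_ge0 ?pk_ge0.
- exact: measurable_sq.
by apply: eq_integral => p _; rewrite mulrDr EFinD.
Qed.

Definition ph1 (t u : R) : R := 2 * pi * (t * u).

Lemma measurable_ph1 : measurable_fun setT (fun p : R * R => ph1 p.1 p.2).
Proof.
by apply: measurable_funM => //; apply: measurable_funM; [exact: measurable_fst|exact: measurable_snd].
Qed.

Variables (A : R) (a b : R -> R).
Hypotheses (A0 : 0 < A) (ma : measurable_fun setT a) (mb : measurable_fun setT b).
Hypotheses (a0 : forall t : R, t \notin `[- A, A] -> a t = 0).
Hypotheses (b0 : forall t : R, t \notin `[- A, A] -> b t = 0).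
Hypotheses (ia : leb.-integrable setT (EFin \o a)).
Hypotheses (ib : leb.-integrable setT (EFin \o b)).
Hypotheses (a2 : (\int[leb]_t (a t ^+ 2)%:E < +oo)%E).
Hypotheses (b2 : (\int[leb]_t (b t ^+ 2)%:E < +oo)%E).

Let h t := a t ^+ 2 + b t ^+ 2.
Let F (u : R) := ftre leb ph1 a b u ^+ 2 + ftim leb ph1 a b u ^+ 2.
Let en n : R := n.+1%:R^-1.
Let en0 n : 0 < en n. Proof. by rewrite invr_gt0. Qed.
Let J n : \bar R := (\int[leb]_u (abelw (en n) u * F u)%:E)%E.

Let h0 t : 0 <= h t. Proof. by rewrite addr_ge0 ?sqr_ge0. Qed.
Let mh : measurable_fun setT h.
Proof. by apply: measurable_funD; exact: measurable_funX. Qed.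
Let mF : measurable_fun setT F.
Proof.
apply: measurable_funD; apply: measurable_funX.
  exact: (@measurable_ftre _ _ _ leb ph1 a b measurable_ph1 ma mb).
exact: (@measurable_ftim _ _ _ leb ph1 a b measurable_ph1 ma mb).
Qed.
Let F0 u : 0 <= F u. Proof. by rewrite addr_ge0 ?sqr_ge0. Qed.

(** The weights increase to 1 as [en n] decreases, so monotone convergence applies before [F] is
    known to be integrable. *)
Let cvgJ : J n @[n --> \oo] --> (\int[leb]_u (F u)%:E)%E.
Proof.
have nd u : nondecreasing_seq (fun n => (abelw (en n) u * F u)%:E).
  move=> i j ij; rewrite lee_fin ler_wpM2r// ler_expR lerN2 ler_wpM2r//.
  by rewrite /en lef_pV2 ?posrE// ler_nat ltnS.
have c u : (abelw (en n) u * F u)%:E @[n --> \oo] --> (F u)%:E.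
  apply: cvg_EFin; first exact: nearW.
  rewrite -[X in _ --> X]mul1r; apply: cvgM; last exact: cvg_cst.
  rewrite -[X in _ --> X](@expR0 R); apply: continuous_cvg; first exact: continuous_expR.
  rewrite -oppr0; apply: cvgN; rewrite -(mul0r `|u|); apply: cvgM; last exact: cvg_cst.
  exact: cvg_harmonic.
have := @cvg_monotone_convergence _ _ R leb setT measurableT (fun n u => (abelw (en n) u * F u)%:E).
rewrite (_ : (\int[leb]_u (F u)%:E = \int[leb]_u limn (fun n => (abelw (en n) u * F u)%:E))%E); last first.
  by apply: eq_integral => u _; apply/esym/cvg_lim => //; exact: c.
apply.
- by move=> n; apply/measurable_EFinP/measurable_funM => //; exact: measurable_abelw.
- by move=> n u _; rewrite lee_fin mulr_ge0// abelw_ge0.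
- by move=> u _; exact: nd.
Qed.

Let hfin : (\int[leb]_t (h t)%:E < +oo)%E.
Proof.
under eq_integral do rewrite EFinD.
rewrite ge0_integralD; last first.
- by apply/measurable_EFinP; exact: measurable_funX.
- by move=> t _; rewrite lee_fin sqr_ge0.
- by apply/measurable_EFinP; exact: measurable_funX.
- by move=> t _; rewrite lee_fin sqr_ge0.
- by [].
exact: lte_add_pinfty.
Qed.

Let hI : (\int[leb]_(t in `[(- A)%R, A]) (h t)%:E = \int[leb]_t (h t)%:E)%E.
Proof.
rewrite integral_mkcond; apply: eq_integral => t _; rewrite patchE; case: ifPn => //.
move=> tA; rewrite /h a0 ?b0 ?expr0n ?addr0//.
all: by apply: contraNN tA; rewrite inE.
Qed.

Let S n : \bar R := (\int[leb]_(t in `[(- A)%R, A]) (poisson_mass (en n) A t * h t)%:E)%E.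

(** The mass tends to 1 only in the open segment, so the end points are removed before dominated
    convergence, with majorant [h]. *)
Let cvgS : S n @[n --> \oo] --> (\int[leb]_t (h t)%:E)%E.
Proof.
rewrite -hI /S.
have cc_oo (f : R -> R) : measurable_fun setT f ->
    (\int[leb]_(t in `[(- A)%R, A]) (f t)%:E = \int[leb]_(t in `](- A)%R, A[) (f t)%:E)%E.
  move=> mf; rewrite -integral_itv_obnd_cbnd; last exact/measurable_EFinP/measurable_funTS.
  by rewrite -integral_itv_bndo_bndc//; exact/measurable_EFinP/measurable_funTS.
have mp n : measurable_fun setT (fun t => poisson_mass (en n) A t * h t).
  by apply: measurable_funM => //; exact: measurable_poisson_mass.
rewrite (cc_oo _ mh).
rewrite (_ : (fun n => _) = (fun n => \int[leb]_(t in `](- A)%R, A[) (poisson_mass (en n) A t * h t)%:E)%E); last first.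
  by apply/funext => n; exact: cc_oo.
apply: (@dominated_cvg _ _ _ leb `](- A)%R, A[%classic (measurable_itv _) _ _ (fun t => (h t)%:E)).
- by move=> n; apply/measurable_funTS/measurable_EFinP; exact: mp.
- move=> t tA; apply: cvg_EFin; first exact: nearW.
  rewrite -[X in _ --> X]mul1r; apply: cvgM; last exact: cvg_cst.
  by apply: cvg_poisson_mass; move: tA; rewrite /= in_itv.
- by [].
- apply: (@integrableS _ _ _ leb setT) => //; apply: ge0_integrable => //; exact: hfin.
- move=> n t _; rewrite abse_EFin lee_fin normrM (ger0_norm (h0 t)) ler_piMl//.
  by rewrite ger0_norm ?poisson_mass_le1// poisson_mass_ge0.
Qed.

Let j n (p : R * R) : R := pk (en n) p * (a p.1 * a p.2 + b p.1 * b p.2).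
(** Half of |w(p.1) - w(p.2)|^2 for w = a + i b. *)
Let H (p : R * R) : R := 2^-1 * ((a p.1 - a p.2) ^+ 2) + 2^-1 * ((b p.1 - b p.2) ^+ 2).
Let s1 n (p : R * R) : R := pk (en n) p * (2^-1 * h p.1).
Let s2 n (p : R * R) : R := pk (en n) p * (2^-1 * h p.2).

Let HE n p : pk (en n) p * H p = s1 n p + s2 n p - j n p.
Proof. by rewrite /H /s1 /s2 /j /h; field. Qed.

Let mfst (f : R -> R) : measurable_fun setT f -> measurable_fun setT (fun p : R * R => f p.1).
Proof. by move=> mf; exact: (measurableT_comp mf measurable_fst). Qed.

Let msnd (f : R -> R) : measurable_fun setT f -> measurable_fun setT (fun p : R * R => f p.2).
Proof. by move=> mf; exact: (measurableT_comp mf measurable_snd). Qed.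

Let cvgH : pk_form (en n) A H @[n --> \oo] --> 0%E.
Proof.
have half (f : R -> R) : measurable_fun setT f -> (\int[leb]_t (f t ^+ 2)%:E < +oo)%E ->
    pk_form (en n) A (fun p => 2^-1 * (f p.1 - f p.2) ^+ 2) @[n --> \oo] --> 0%E.
  move=> mf f2; apply: pk_form_scale_cvg0 => //.
  - by apply: measurable_funX; apply: measurable_funB; [exact: mfst|exact: msnd].
  - by move=> p; exact: sqr_ge0.
  - apply: pk_form_L2_cvg0 => //; apply: le_lt_trans f2.
    apply: ge0_subset_integral => //.
    + by apply/measurable_EFinP; exact: measurable_funX.
    + by move=> t _; rewrite lee_fin sqr_ge0.
have m2 (f : R -> R) : measurable_fun setT f -> measurable_fun setT (fun p : R * R => 2^-1 * (f p.1 - f p.2) ^+ 2).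
  by move=> mf; apply: measurable_funM => //; apply: measurable_funX; apply: measurable_funB; [exact: mfst|exact: msnd].
have p2 (f : R -> R) (p : R * R) : 0 <= 2^-1 * (f p.1 - f p.2) ^+ 2 by rewrite mulr_ge0 ?sqr_ge0.
pose Ha (p : R * R) := 2^-1 * (a p.1 - a p.2) ^+ 2.
pose Hb (p : R * R) := 2^-1 * (b p.1 - b p.2) ^+ 2.
have -> : (fun n => pk_form (en n) A H) = (fun n => pk_form (en n) A Ha + pk_form (en n) A Hb)%E.
  apply/funext => n; apply: pk_formD => //; first exact: m2.
  exact: m2.
by rewrite -(adde0 0%E); apply: cvgeD => //; apply: half.
Qed.

Let is1 n : leb2.-integrable (sq A) (EFin \o s1 n).
Proof.
apply: ge0_integrable.
- apply: measurable_funTS; apply: measurable_funM; first exact: measurable_pk.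
  by apply: (mfst (f := fun t => 2^-1 * h t)); exact: measurable_funM.
- by move=> p; rewrite mulr_ge0 ?pk_ge0 ?mulr_ge0.
- have := @le_integral_pk_fst R (en n) A (fun t => 2^-1 * h t) (en0 n) A0.
  move=> le; apply: (le_lt_trans (le _ _)).
  + exact: measurable_funM.
  + by move=> t; rewrite mulr_ge0.
  + under eq_integral do rewrite EFinM.
    rewrite ge0_integralZl; last first.
    * by rewrite lee_fin.
    * by move=> t _; rewrite lee_fin.
    * exact/measurable_EFinP/measurable_funTS.
    * exact: measurable_itv.
    by rewrite hI; apply: lte_mul_pinfty => //; exact: hfin.
Qed.

Let is2 n : leb2.-integrable (sq A) (EFin \o s2 n).
Proof.
apply: ge0_integrable.
- apply: measurable_funTS; apply: measurable_funM; first exact: measurable_pk.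
  by apply: (@msnd (fun t => 2^-1 * h t)); exact: measurable_funM.
- by move=> p; rewrite mulr_ge0 ?pk_ge0 ?mulr_ge0.
- have := @le_integral_pk_snd R (en n) A (fun t => 2^-1 * h t) (en0 n) A0.
  move=> le; apply: (le_lt_trans (le _ _)).
  + exact: measurable_funM.
  + by move=> t; rewrite mulr_ge0.
  + under eq_integral do rewrite EFinM.
    rewrite ge0_integralZl; last first.
    * by rewrite lee_fin.
    * by move=> t _; rewrite lee_fin.
    * exact/measurable_EFinP/measurable_funTS.
    * exact: measurable_itv.
    by rewrite hI; apply: lte_mul_pinfty => //; exact: hfin.
Qed.

Let ij n : leb2.-integrable (sq A) (EFin \o j n).
Proof.
have [ijT _] := abel_fourier1 ma mb ia ib (en0 n).
by apply: integrableS ijT => //; exact: measurable_sq.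
Qed.

(** [j] vanishes off the square because [a] and [b] vanish off the segment; on the square the mass
    formulas are available. *)
Let jsq n : (\int[leb2]_(p in sq A) (j n p)%:E = J n)%E.
Proof.
have [_] := abel_fourier1 ma mb ia ib (en0 n).
rewrite -/(J n) => ->; rewrite integral_mkcond; apply: eq_integral => p _.
rewrite patchE; case: ifPn => // pA; rewrite /j.
have [p1|p1] := boolP (p.1 \in `[- A, A]); last by rewrite (a0 p1) (b0 p1) !mul0r addr0 mulr0.
have [p2|p2] := boolP (p.2 \in `[- A, A]); last by rewrite (a0 p2) (b0 p2) !mulr0 addr0 mulr0.
by exfalso; move/negP : pA; apply; rewrite inE.
Qed.

(* [2 x y = x^2 + y^2 - (x - y)^2] *)
Let JS n : J n = (S n - pk_form (en n) A H)%E.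
Proof.
have i12 : leb2.-integrable (sq A) (EFin \o (fun p => s1 n p + s2 n p)).
  by apply: integrable_EFinD; [exact: measurable_sq|exact: is1|exact: is2].
have -> : pk_form (en n) A H = (S n - J n)%E.
  rewrite /pk_form -jsq.
  transitivity (\int[leb2]_(p in sq A) ((s1 n p + s2 n p)%:E - (j n p)%:E))%E.
    by apply: eq_integral => p _; rewrite HE EFinB.
  rewrite integralB_EFin//; last exact: measurable_sq.
  congr (_ - _)%E.
  transitivity (\int[leb2]_(p in sq A) ((s1 n p)%:E + (s2 n p)%:E))%E => //.
  rewrite integralD//; [|exact: measurable_sq|exact: is1|exact: is2].
  have half : (2^-1%:E * S n = \int[leb]_(t in `[(- A)%R, A]) (poisson_mass (en n) A t * (2^-1 * h t))%:E)%E.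
    rewrite /S -ge0_integralZl//.
    - by apply: eq_integral => t _; rewrite -EFinM mulrCA.
    - apply/measurable_EFinP/measurable_funTS/measurable_funM => //.
      exact: measurable_poisson_mass.
    - by move=> t _; rewrite lee_fin mulr_ge0 ?poisson_mass_ge0.
  have hh : measurable_fun setT (fun t => 2^-1 * h t) by exact: measurable_funM.
  have hh0 t : 0 <= 2^-1 * h t by rewrite mulr_ge0.
  rewrite [X in (X + _)%E](_ : _ = 2^-1%:E * S n)%E; last first.
    by rewrite half -integral_pk_fst.
  rewrite [X in (_ + X)%E](_ : _ = 2^-1%:E * S n)%E; last first.
    by rewrite half -integral_pk_snd.
  rewrite -ge0_muleDl// -EFinD (_ : 2^-1 + 2^-1 = 1 :> R) ?mul1e//; first by field.
have Jf : J n \is a fin_num.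
  by rewrite -jsq; apply: integrable_fin_num; [exact: measurable_sq|exact: ij].
have Sf : S n \is a fin_num.
  rewrite ge0_fin_numE; last first.
    by apply: integral_ge0 => t _; rewrite lee_fin mulr_ge0 ?poisson_mass_ge0.
  rewrite /S -integral_pk_fst//; apply: (le_lt_trans (le_integral_pk_fst _ _ _ _)) => //.
  by rewrite hI; exact: hfin.
by rewrite -(fineK Sf) -(fineK Jf) -!EFinB; congr (_%:E); ring.
Qed.

(** The Abel means [J] have two limits: the integral of [F] by monotone convergence, and that of [h]
    by the splitting [JS]. *)
Theorem ft1_isometry : (\int[leb]_u (ftre leb ph1 a b u ^+ 2 + ftim leb ph1 a b u ^+ 2)%:E =
  \int[leb]_t (a t ^+ 2 + b t ^+ 2)%:E)%E.
Proof.
apply: (cvg_unique _ cvgJ) => //.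
have -> : J = (fun n => S n - pk_form (en n) A H)%E by apply/funext.
have hf : (\int[leb]_t (h t)%:E)%E \is a fin_num.
  rewrite ge0_fin_numE; first exact: hfin.
  by apply: integral_ge0 => t _; rewrite lee_fin.
rewrite /=; have -> : (\int[leb]_t (a t ^+ 2 + b t ^+ 2)%:E = \int[leb]_t (h t)%:E - 0)%E.
  by rewrite sube0.
by apply: cvgeB; [rewrite fin_num_adde_defl|exact: cvgS|exact: cvgH].
Qed.
End SegmentIsometry.

(** * Isometry for product measures *)

Section L2Support.
Context d (T : measurableType d) (R : realType) (mu : {measure set T -> \bar R}).

(** On a set of finite measure 1 + a^2 is an integrable majorant of |a|. *)
Lemma integrable_sqr (S : set T) (a : T -> R) : measurable S -> (mu S < +oo)%E ->
  measurable_fun setT a -> (forall t, ~ S t -> a t = 0) ->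
  (\int[mu]_t (a t ^+ 2)%:E < +oo)%E -> mu.-integrable setT (EFin \o a).
Proof.
move=> mS Sfin ma aS a2.
have i1 : mu.-integrable setT (EFin \o (\1_S : T -> R)).
  apply: ge0_integrable => //.
  - by rewrite integral_indic// setIT.
have i2 : mu.-integrable setT (EFin \o (fun t => a t ^+ 2)).
  by apply: ge0_integrable => //; [exact: measurable_funX|move=> t; exact: sqr_ge0].
apply: le_integrable (integrable_EFinD measurableT i1 i2) => //.
  exact/measurable_EFinP.
move=> t _; rewrite lee_fin [leRHS]ger0_norm ?addr_ge0 ?sqr_ge0//.
have [tS|tS] := pselect (S t); last by rewrite aS// normr0 addr_ge0 ?sqr_ge0.
rewrite indicE mem_set//= -[X in _ <= _ + X]real_normK ?num_real//.
have := sqr_ge0 (`|a t| - 2^-1); have := normr_ge0 (a t); move: (`|a t|) => x; nra.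
Qed.

End L2Support.

(** Plancherel's identity for square integrable a + i b supported in [S]. Measure and phase are
    arbitrary, so that the property can be carried to products and to images. *)
Definition ft_isometry d (T : measurableType d) (R : realType)
    (mu : {measure set T -> \bar R}) (th : T -> T -> R) (S : set T) : Prop :=
  forall a b : T -> R, measurable_fun setT a -> measurable_fun setT b ->
  (forall t, ~ S t -> a t = 0) -> (forall t, ~ S t -> b t = 0) ->
  (\int[mu]_t (a t ^+ 2)%:E < +oo)%E -> (\int[mu]_t (b t ^+ 2)%:E < +oo)%E ->
  (\int[mu]_u (ftre mu th a b u ^+ 2 + ftim mu th a b u ^+ 2)%:E =
   \int[mu]_t (a t ^+ 2 + b t ^+ 2)%:E)%E.

Lemma ft_isometryS d (T : measurableType d) (R : realType)
    (mu : {measure set T -> \bar R}) (th : T -> T -> R) (S1 S2 : set T) :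
  S1 `<=` S2 -> ft_isometry mu th S2 -> ft_isometry mu th S1.
Proof.
move=> S12 iso a b ma mb aS bS a2 b2; apply: iso => // t tS; [apply: aS|apply: bS];
  by move=> /S12.
Qed.

Lemma ft_isometry_segment (R : realType) (A : R) :
  ft_isometry (@lebesgue_measure R) (@ph1 R) `[- A, A]%classic.
Proof.
(* The segment is enlarged because the identity was proved for a positive half-length, whereas the
   cube with n = 0 gives A = 0. *)
have A0 : 0 < `|A| + 1 by rewrite ltr_wpDl.
have AA : `[- A, A]%classic `<=` `[- (`|A| + 1), `|A| + 1]%classic.
  move=> t /=; rewrite !in_itv/= => /andP[h1 h2]; have := ler_norm A; lra.
apply: (@ft_isometryS _ _ R (@lebesgue_measure R) (@ph1 R) _ _ AA) => a b ma mb aS bS a2 b2.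
have fI : (@lebesgue_measure R `[(- (`|A| + 1))%R, (`|A| + 1)%R]%classic < +oo)%E.
  by rewrite leb_segment// ltry.
apply: (ft1_isometry A0) => //.
- by move=> t tI; apply: aS => ti; move/negP : tI; exact.
- by move=> t tI; apply: bS => ti; move/negP : tI; exact.
- by apply: (integrable_sqr _ fI) => //; exact: measurable_itv.
- by apply: (integrable_sqr _ fI) => //; exact: measurable_itv.
Qed.

(** * Change of variables *)

Section Pushforward.
Context d1 d2 (T1 : measurableType d1) (T2 : measurableType d2) (R : realType).
Variables (mu1 : {measure set T1 -> \bar R}) (mu2 : {measure set T2 -> \bar R}).
Variables (phi : T1 -> T2) (mphi : measurable_fun setT phi).
Hypothesis muE : forall A, measurable A -> mu2 A = mu1 (phi @^-1` A).

Lemma ge0_integral_image (f : T2 -> \bar R) : measurable_fun setT f ->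
  (forall t, 0 <= f t)%E -> (\int[mu2]_t f t = \int[mu1]_t f (phi t))%E.
Proof.
move=> mf f0.
transitivity (\int[pushforward mu1 phi]_t f t)%E.
  by apply: eq_measure_integral => A mA _; rewrite muE.
by rewrite ge0_integral_pushforward.
Qed.

Lemma integrable_image (f : T2 -> \bar R) : measurable_fun setT f ->
  mu2.-integrable setT f -> mu1.-integrable setT (f \o phi).
Proof.
move=> mf /integrableP[_ fi]; apply/integrableP; split; first exact: measurableT_comp.
have := @ge0_integral_image (abse \o f) (measurableT_comp (@abse_measurable R setT) mf) (fun=> abse_ge0 _).
by move=> /= <-.
Qed.

Lemma integral_image (f : T2 -> \bar R) : measurable_fun setT f ->
  mu2.-integrable setT f -> (\int[mu2]_t f t = \int[mu1]_t f (phi t))%E.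
Proof.
move=> mf intf.
transitivity (\int[pushforward mu1 phi]_t f t)%E.
  by apply: eq_measure_integral => A mA _; rewrite muE.
by rewrite integral_pushforward//; exact: integrable_image.
Qed.

End Pushforward.

Section PushforwardFT.
Context d1 d2 (T1 : measurableType d1) (T2 : measurableType d2) (R : realType).
Variables (mu1 : {measure set T1 -> \bar R}) (mu2 : {sigma_finite_measure set T2 -> \bar R}).
Variables (phi : T1 -> T2) (mphi : measurable_fun setT phi).
Hypothesis muE : forall A, measurable A -> mu2 A = mu1 (phi @^-1` A).

(** The variable is changed twice, inside the transform and in the outer integrals. The inner
    integrands are signed; the support of finite measure makes them integrable. *)
Lemma ft_isometry_image (th1 : T1 -> T1 -> R) (th2 : T2 -> T2 -> R) (S : set T2) :
  measurable S -> (mu2 S < +oo)%E ->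
  measurable_fun setT (fun p : T2 * T2 => th2 p.1 p.2) ->
  (forall s t, th2 (phi s) (phi t) = th1 s t) ->
  ft_isometry mu1 th1 (phi @^-1` S) -> ft_isometry mu2 th2 S.
Proof.
move=> mS Sfin mth thE iso a b ma mb aS bS a2 b2.
have ia := integrable_sqr mS Sfin ma aS a2.
have ib := integrable_sqr mS Sfin mb bS b2.
have mthu u : measurable_fun setT (th2 ^~ u).
  have mp : measurable_fun setT (fun t : T2 => (t, u)).
    by apply: measurable_fun_pair => //; exact: measurable_cst.
  exact: (measurableT_comp mth mp).
have sq_img (f : T2 -> R) : measurable_fun setT f ->
    (\int[mu2]_t (f t ^+ 2)%:E = \int[mu1]_t (f (phi t) ^+ 2)%:E)%E.
  move=> mf; apply: (ge0_integral_image mphi muE (f := fun t => (f t ^+ 2)%:E)).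
    by apply/measurable_EFinP; exact: measurable_funX.
  by move=> t; rewrite lee_fin sqr_ge0.
have reE u : ftre mu2 th2 a b (phi u) = ftre mu1 th1 (a \o phi) (b \o phi) u.
  rewrite /ftre /Rintegral (integral_image mphi muE).
  - by congr fine; apply: eq_integral => t _; rewrite thE.
  - apply/measurable_EFinP/measurable_funD; apply: measurable_funM => //.
      exact: measurable_fun_cos.
    exact: measurable_fun_sin.
  - by apply: integrable_EFinD => //; apply: integrable_EFinM_le1 => //;
      [exact: measurable_fun_cos|move=> ?; exact: normr_cos_le1|exact: measurable_fun_sin|move=> ?; exact: normr_sin_le1].
have imE u : ftim mu2 th2 a b (phi u) = ftim mu1 th1 (a \o phi) (b \o phi) u.
  rewrite /ftim /Rintegral (integral_image mphi muE).
  - by congr fine; apply: eq_integral => t _; rewrite thE.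
  - apply/measurable_EFinP/measurable_funB; apply: measurable_funM => //.
      exact: measurable_fun_cos.
    exact: measurable_fun_sin.
  - by apply: integrable_EFinB => //; apply: integrable_EFinM_le1 => //;
      [exact: measurable_fun_cos|move=> ?; exact: normr_cos_le1|exact: measurable_fun_sin|move=> ?; exact: normr_sin_le1].
rewrite (ge0_integral_image mphi muE); last 2 first.
- apply/measurable_EFinP/measurable_funD; apply: measurable_funX.
    exact: measurable_ftre.
  exact: measurable_ftim.
- by move=> t; rewrite lee_fin addr_ge0 ?sqr_ge0.
rewrite (ge0_integral_image mphi muE); last 2 first.
- by apply/measurable_EFinP/measurable_funD; apply: measurable_funX.
- by move=> t; rewrite lee_fin addr_ge0 ?sqr_ge0.
under eq_integral do rewrite reE imE.
apply: (iso (a \o phi) (b \o phi)).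
- exact: measurableT_comp.
- exact: measurableT_comp.
- by move=> t tS; exact: aS.
- by move=> t tS; exact: bS.
- by rewrite -sq_img.
- by rewrite -sq_img.
Qed.
End PushforwardFT.

(** The factors [c] and [s] are free constants: they will be cosine and sine of a second phase, or
    the real and imaginary parts of a second function. *)
Lemma integral_ft_lincomb d (T : measurableType d) (R : realType)
    (mu : {measure set T -> \bar R}) (th : T -> T -> R) (a b : T -> R) u (c s : R) :
  measurable_fun setT (th ^~ u) ->
  mu.-integrable setT (EFin \o a) -> mu.-integrable setT (EFin \o b) ->
  (\int[mu]_t (((a t * cos (th t u) + b t * sin (th t u)) * c +
     (b t * cos (th t u) - a t * sin (th t u)) * s)%:E) =
   (ftre mu th a b u * c + ftim mu th a b u * s)%:E)%E.
Proof.
move=> mth ia ib.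
have mc : measurable_fun setT (fun t => cos (th t u)) by exact: measurable_fun_cos.
have ms : measurable_fun setT (fun t => sin (th t u)) by exact: measurable_fun_sin.
have iP : mu.-integrable setT (EFin \o (fun t => a t * cos (th t u) + b t * sin (th t u))).
  by apply: integrable_EFinD => //; apply: integrable_EFinM_le1 => // t; [exact: normr_cos_le1|exact: normr_sin_le1].
have iQ : mu.-integrable setT (EFin \o (fun t => b t * cos (th t u) - a t * sin (th t u))).
  by apply: integrable_EFinB => //; apply: integrable_EFinM_le1 => // t; [exact: normr_cos_le1|exact: normr_sin_le1].
under eq_integral do rewrite EFinD 2!EFinM.
rewrite integralD//; [|exact: integrableZr|exact: integrableZr].
rewrite !integralZr//.
rewrite -[X in (X * _ + _)%E]fineK ?integrable_fin_num//.
by rewrite -[X in (_ + X * _)%E]fineK ?integrable_fin_num.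
Qed.

(** * Partial transforms on a product *)

Section ProductFT.
Context d1 d2 (T1 : measurableType d1) (T2 : measurableType d2) (R : realType).
Variables (m1 : {sigma_finite_measure set T1 -> \bar R})
          (m2 : {sigma_finite_measure set T2 -> \bar R}).
Variables (th1 : T1 -> T1 -> R) (th2 : T2 -> T2 -> R).
Hypothesis mth1 : measurable_fun setT (fun p : T1 * T1 => th1 p.1 p.2).
Hypothesis mth2 : measurable_fun setT (fun p : T2 * T2 => th2 p.1 p.2).
Notation mm := (m1 \x m2)%E.
Let th (p q : T1 * T2) := th1 p.1 q.1 + th2 p.2 q.2.

Let mth1_fst u : measurable_fun setT (th1 ^~ u).
Proof.
have mp : measurable_fun setT (fun t : T1 => (t, u)).
  by apply: measurable_fun_pair => //; exact: measurable_cst.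
exact: (measurableT_comp mth1 mp).
Qed.

Let mth2_fst u : measurable_fun setT (th2 ^~ u).
Proof.
have mp : measurable_fun setT (fun t : T2 => (t, u)).
  by apply: measurable_fun_pair => //; exact: measurable_cst.
exact: (measurableT_comp mth2 mp).
Qed.

Variables (a b : T1 * T2 -> R).
Hypotheses (ma : measurable_fun setT a) (mb : measurable_fun setT b).
Hypotheses (ia : mm.-integrable setT (EFin \o a)) (ib : mm.-integrable setT (EFin \o b)).

Let gr u1 y := ftre m1 th1 (fun x => a (x, y)) (fun x => b (x, y)) u1.
Let gi u1 y := ftim m1 th1 (fun x => a (x, y)) (fun x => b (x, y)) u1.

Lemma measurable_partial_ft :
  measurable_fun setT (fun q : T1 * T2 => gr q.1 q.2) /\
  measurable_fun setT (fun q : T1 * T2 => gi q.1 q.2).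
Proof.
have mp : measurable_fun setT (fun r : (T1 * T2) * T1 => (r.2, r.1.2)).
  apply: measurable_fun_pair; first exact: measurable_snd.
  exact: (measurableT_comp measurable_snd measurable_fst).
have mq : measurable_fun setT (fun r : (T1 * T2) * T1 => (r.2, r.1.1)).
  apply: measurable_fun_pair; first exact: measurable_snd.
  exact: (measurableT_comp measurable_fst measurable_fst).
have ma' := measurableT_comp ma mp; have mb' := measurableT_comp mb mp.
have mt' := measurableT_comp mth1 mq.
split.
  apply: (@measurable_Rintegral_param _ _ _ _ _ m1 (fun r : (T1 * T2) * T1 =>
    a (r.2, r.1.2) * cos (th1 r.2 r.1.1) + b (r.2, r.1.2) * sin (th1 r.2 r.1.1))).
  apply: measurable_funD; apply: measurable_funM => //; [exact: measurable_fun_cos|exact: measurable_fun_sin].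
apply: (@measurable_Rintegral_param _ _ _ _ _ m1 (fun r : (T1 * T2) * T1 =>
    b (r.2, r.1.2) * cos (th1 r.2 r.1.1) - a (r.2, r.1.2) * sin (th1 r.2 r.1.1))).
apply: measurable_funB; apply: measurable_funM => //; [exact: measurable_fun_cos|exact: measurable_fun_sin].
Qed.

Let mgr u1 : measurable_fun setT (gr u1).
Proof.
have mp : measurable_fun setT (fun t : T2 => (u1, t)).
  by apply: measurable_fun_pair => //; exact: measurable_cst.
exact: (measurableT_comp measurable_partial_ft.1 mp).
Qed.

Let mgi u1 : measurable_fun setT (gi u1).
Proof.
have mp : measurable_fun setT (fun t : T2 => (u1, t)).
  by apply: measurable_fun_pair => //; exact: measurable_cst.
exact: (measurableT_comp measurable_partial_ft.2 mp).
Qed.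

(** The phase is a sum, so its exponential factors and Fubini applies. Sections of [a] and [b] are
    integrable only for almost every y, which suffices under the outer integral. *)
Lemma ft_prodE u1 u2 :
  ftre mm th a b (u1, u2) = ftre m2 th2 (gr u1) (gi u1) u2 /\
  ftim mm th a b (u1, u2) = ftim m2 th2 (gr u1) (gi u1) u2.
Proof.
have mcos2 : measurable_fun setT (fun y => cos (th2 y u2)) by exact: measurable_fun_cos.
have msin2 : measurable_fun setT (fun y => sin (th2 y u2)) by exact: measurable_fun_sin.
have mthu : measurable_fun setT (fun p => th p (u1, u2)).
  apply: measurable_funD; first exact: (measurableT_comp (mth1_fst u1) measurable_fst).
  exact: (measurableT_comp (mth2_fst u2) measurable_snd).
have mc : measurable_fun setT (fun p => cos (th p (u1, u2))) by exact: measurable_fun_cos.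
have ms : measurable_fun setT (fun p => sin (th p (u1, u2))) by exact: measurable_fun_sin.
(* Serves both parts: cos and sin for the real part, - sin and cos for the imaginary part. *)
have main (f : T1 * T2 -> R) (c s : T2 -> R) :
    mm.-integrable setT (EFin \o f) -> measurable_fun setT c -> measurable_fun setT s ->
    (forall x y, f (x, y) = (a (x, y) * cos (th1 x u1) + b (x, y) * sin (th1 x u1)) * c y +
      (b (x, y) * cos (th1 x u1) - a (x, y) * sin (th1 x u1)) * s y) ->
    \int[mm]_p f p = \int[m2]_y (gr u1 y * c y + gi u1 y * s y).
  move=> intf mcc mss fE; congr fine.
  rewrite -(integral21_prod_meas1 intf); apply: ae_eq_integral => //.
  - exact: (measurable_fubini_G intf).
  - by apply/measurable_EFinP/measurable_funD; apply: measurable_funM.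
  - have := ae_integrable2 ia; apply: filterS2 (ae_integrable2 ib) => y iby iay _.
    rewrite /fubini_G/= -(integral_ft_lincomb _ _ (mth1_fst u1))//.
    by apply: eq_integral => x _; rewrite /= fE.
split.
  apply: main => //.
  + by apply: integrable_EFinD => //; apply: integrable_EFinM_le1 => // p; [exact: normr_cos_le1|exact: normr_sin_le1].
  + by move=> x y; rewrite /th /= cosD sinD; ring.
transitivity (\int[m2]_y (gr u1 y * - sin (th2 y u2) + gi u1 y * cos (th2 y u2))); last first.
  by apply: eq_Rintegral => y _; rewrite mulrN addrC.
apply: main => //.
- by apply: integrable_EFinB => //; apply: integrable_EFinM_le1 => // p; [exact: normr_cos_le1|exact: normr_sin_le1].
- exact: measurable_funN.
- by move=> x y; rewrite /th /= cosD sinD; ring.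
Qed.

Variables (S1 : set T1) (S2 : set T2).
Hypotheses (mS1 : measurable S1) (mS2 : measurable S2).
Hypotheses (S1fin : (m1 S1 < +oo)%E) (S2fin : (m2 S2 < +oo)%E).
Hypotheses (iso1 : ft_isometry m1 th1 S1) (iso2 : ft_isometry m2 th2 S2).
Hypotheses (aS : forall p, ~ (S1 `*` S2) p -> a p = 0) (bS : forall p, ~ (S1 `*` S2) p -> b p = 0).
Hypotheses (a2 : (\int[mm]_p (a p ^+ 2)%:E < +oo)%E) (b2 : (\int[mm]_p (b p ^+ 2)%:E < +oo)%E).

Let fin_sqr (c : T1 * T2 -> R) : measurable_fun setT c -> (\int[mm]_p (c p ^+ 2)%:E < +oo)%E ->
  {ae m2, forall y, (\int[m1]_x (c (x, y) ^+ 2)%:E < +oo)%E}.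
Proof.
move=> mc c2.
have ic : mm.-integrable setT (EFin \o (fun p => c p ^+ 2)).
  by apply: ge0_integrable => //; [exact: measurable_funX|move=> p; exact: sqr_ge0].
apply: filterS (ae_integrable2 ic) => y /integrableP[_ /=].
by under eq_integral do rewrite ger0_norm ?sqr_ge0//.
Qed.

Let msec (c : T1 * T2 -> R) y : measurable_fun setT c -> measurable_fun setT (fun x => c (x, y)).
Proof.
move=> mc; have mp : measurable_fun setT (fun x : T1 => (x, y)).
  by apply: measurable_fun_pair => //; exact: measurable_cst.
exact: (measurableT_comp mc mp).
Qed.

Let G2 (q : T1 * T2) : \bar R := (gr q.1 q.2 ^+ 2 + gi q.1 q.2 ^+ 2)%:E.
Let mG2 : measurable_fun setT G2.
Proof.
by apply/measurable_EFinP/measurable_funD; apply: measurable_funX; have [] := measurable_partial_ft.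
Qed.
Let G20 q : (0 <= G2 q)%E. Proof. by rewrite lee_fin addr_ge0 ?sqr_ge0. Qed.

Let iso1_ae : {ae m2, forall y, (\int[m1]_x G2 (x, y) = \int[m1]_x (a (x, y) ^+ 2 + b (x, y) ^+ 2)%:E)%E}.
Proof.
apply: filterS2 (fin_sqr ma a2) (fin_sqr mb b2) => y ay b_y.
have a0 t : ~ S1 t -> a (t, y) = 0 by move=> tS; apply: aS => -[].
have b0 t : ~ S1 t -> b (t, y) = 0 by move=> tS; apply: bS => -[].
exact: (iso1 (msec y ma) (msec y mb) a0 b0 ay b_y).
Qed.

Let ab2 (p : T1 * T2) : \bar R := (a p ^+ 2 + b p ^+ 2)%:E.
Let mab2 : measurable_fun setT ab2.
Proof. by apply/measurable_EFinP/measurable_funD; apply: measurable_funX. Qed.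
Let ab20 q : (0 <= ab2 q)%E. Proof. by rewrite lee_fin addr_ge0 ?sqr_ge0. Qed.

Let ab2fin : (\int[mm]_p ab2 p < +oo)%E.
Proof.
rewrite /ab2; under eq_integral do rewrite EFinD.
rewrite ge0_integralD; last first.
- by apply/measurable_EFinP; exact: measurable_funX.
- by move=> p _; rewrite lee_fin sqr_ge0.
- by apply/measurable_EFinP; exact: measurable_funX.
- by move=> p _; rewrite lee_fin sqr_ge0.
- exact: measurableT.
by apply: lte_add_pinfty; [exact: a2|exact: b2].
Qed.

(** The isometry in the first variable holds for almost every y, so Tonelli first brings y to the
    outside. *)
Let swapG : (\int[m1]_x \int[m2]_y G2 (x, y) = \int[mm]_p ab2 p)%E.
Proof.
rewrite (fubini_tonelli G2)// (fubini_tonelli2 ab2)//.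
apply: (@ge0_ae_eq_integral _ _ _ m2 setT (fubini_G m1 G2) (fubini_G m1 ab2) measurableT).
- exact: (measurable_fun_fubini_tonelli_G (m1 := m1) _ mG2 G20).
- exact: (measurable_fun_fubini_tonelli_G (m1 := m1) _ mab2 ab20).
- by move=> y _; apply: integral_ge0 => x _; exact: G20.
- by move=> y _; apply: integral_ge0 => x _; exact: ab20.
- by apply: filterS iso1_ae => y h _.
Qed.

(** The outer integral in [swapG] is finite, so almost every section of the partial transform is
    square integrable in y, as [iso2] demands. *)
Let finG : {ae m1, forall x, (\int[m2]_y G2 (x, y) < +oo)%E}.
Proof.
have mG := measurable_fun_fubini_tonelli_F (m2 := m2) _ mG2 G20.
have iG : m1.-integrable setT (fubini_F m2 G2).
  apply/integrableP; split => //.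
  under eq_integral do rewrite gee0_abs ?integral_ge0//.
  by rewrite swapG.
apply: filterS (integrable_ae measurableT iG) => x /(_ I).
by rewrite ge0_fin_numE//; exact: integral_ge0.
Qed.

Let gr0 u y : ~ S2 y -> gr u y = 0.
Proof.
move=> yS; rewrite /gr /ftre; under eq_Rintegral.
  move=> x _; rewrite aS ?bS; [|by case|by case]. rewrite !mul0r addr0. over.
by rewrite /Rintegral integral0.
Qed.

Let gi0 u y : ~ S2 y -> gi u y = 0.
Proof.
move=> yS; rewrite /gi /ftim; under eq_Rintegral.
  move=> x _; rewrite aS ?bS; [|by case|by case]. rewrite !mul0r subr0. over.
by rewrite /Rintegral integral0.
Qed.

(** For almost every first frequency, [iso2] is applied to the partial transform, which vanishes for
    y outside [S2]; [swapG] then undoes the first transform. *)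
Lemma ft_isometry_prod_aux :
  (\int[mm]_u (ftre mm th a b u ^+ 2 + ftim mm th a b u ^+ 2)%:E = \int[mm]_p ab2 p)%E.
Proof.
pose F (p : T1 * T2) : \bar R := (ftre mm th a b p ^+ 2 + ftim mm th a b p ^+ 2)%:E.
have F0 p : (0 <= F p)%E by rewrite lee_fin addr_ge0 ?sqr_ge0.
have mF : measurable_fun setT F.
  have mt : measurable_fun setT (fun p : (T1 * T2) * (T1 * T2) => th p.1 p.2).
    apply: measurable_funD.
      have mp : measurable_fun setT (fun p : (T1 * T2) * (T1 * T2) => (p.1.1, p.2.1)).
        apply: measurable_fun_pair; first exact: (measurableT_comp measurable_fst measurable_fst).
        exact: (measurableT_comp measurable_fst measurable_snd).
      exact: (measurableT_comp mth1 mp).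
    have mp : measurable_fun setT (fun p : (T1 * T2) * (T1 * T2) => (p.1.2, p.2.2)).
      apply: measurable_fun_pair; first exact: (measurableT_comp measurable_snd measurable_fst).
      exact: (measurableT_comp measurable_snd measurable_snd).
    exact: (measurableT_comp mth2 mp).
  apply/measurable_EFinP/measurable_funD; apply: measurable_funX.
    exact: (@measurable_ftre _ _ _ (prod_sfinite m1 m2) th a b).
  exact: (@measurable_ftim _ _ _ (prod_sfinite m1 m2) th a b).
rewrite -swapG (fubini_tonelli1 F mF F0).
apply: ge0_ae_eq_integral.
- by [].
- exact: (measurable_fun_fubini_tonelli_F (m2 := m2) _ mF F0).
- exact: (measurable_fun_fubini_tonelli_F (m2 := m2) _ mG2 G20).
- by move=> x _; apply: integral_ge0 => y _; exact: F0.
- by move=> x _; apply: integral_ge0 => y _; exact: G20.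
- apply: filterS finG => x xfin _.
  have mGx : measurable_fun setT (fun y => G2 (x, y)).
    by apply/measurable_EFinP; apply: measurable_funD; apply: measurable_funX; [exact: mgr|exact: mgi].
  transitivity (\int[m2]_y (ftre m2 th2 (gr x) (gi x) y ^+ 2 + ftim m2 th2 (gr x) (gi x) y ^+ 2)%:E)%E.
    by apply: eq_integral => y _; rewrite /F; have [-> ->] := ft_prodE x y.
  apply: (iso2 (mgr x) (mgi x) (@gr0 x) (@gi0 x)).
  + apply: le_lt_trans xfin; apply: ge0_le_integral => //.
    * by move=> y _; rewrite lee_fin sqr_ge0.
    * by apply/measurable_EFinP; apply: measurable_funX; exact: mgr.
    * by move=> y _; rewrite lee_fin lerDl sqr_ge0.
  + apply: le_lt_trans xfin; apply: ge0_le_integral => //.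
    * by move=> y _; rewrite lee_fin sqr_ge0.
    * by apply/measurable_EFinP; apply: measurable_funX; exact: mgi.
    * by move=> y _; rewrite lee_fin lerDr sqr_ge0.
Qed.
End ProductFT.

Lemma ft_isometry_prod d1 d2 (T1 : measurableType d1) (T2 : measurableType d2) (R : realType)
    (m1 : {sigma_finite_measure set T1 -> \bar R})
    (m2 : {sigma_finite_measure set T2 -> \bar R})
    (th1 : T1 -> T1 -> R) (th2 : T2 -> T2 -> R) (S1 : set T1) (S2 : set T2) :
  measurable_fun setT (fun p : T1 * T1 => th1 p.1 p.2) ->
  measurable_fun setT (fun p : T2 * T2 => th2 p.1 p.2) ->
  measurable S1 -> measurable S2 -> (m1 S1 < +oo)%E -> (m2 S2 < +oo)%E ->
  ft_isometry m1 th1 S1 -> ft_isometry m2 th2 S2 ->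
  ft_isometry (m1 \x m2)%E (fun p q => th1 p.1 q.1 + th2 p.2 q.2) (S1 `*` S2).
Proof.
move=> mth1 mth2 mS1 mS2 S1fin S2fin iso1 iso2 a b ma mb aS bS a2 b2.
have mS : measurable (S1 `*` S2) by exact: measurableX.
have Sfin : ((m1 \x m2)%E (S1 `*` S2) < +oo)%E.
  by rewrite product_measure1E// lte_mul_pinfty// ge0_fin_numE.
have ia := integrable_sqr mS Sfin ma aS a2.
have ib := integrable_sqr mS Sfin mb bS b2.
exact: (ft_isometry_prod_aux mth1 mth2 ma mb ia ib iso1 iso2 aS bS a2 b2).
Qed.

(** * Isometry on the cubes of R^d *)

Section LebesgueRd.
Variable R : realType.
Notation leb := (@lebesgue_measure R).

Lemma lebesgue_RdS d (A : set (d.+1.-tuple R)) :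
  lebesgue_Rd R d.+1 A = (lebesgue_Rd R d \x leb)%E (@cons_point R d @^-1` A).
Proof. by []. Qed.

(** The ends are general because sharpness uses a box that is not centred at the origin. *)
Definition box d (a b : R) : set (d.-tuple R) := [set t | forall i, a <= tnth t i <= b].

Lemma cubeE d n : @cube R d n = @box d (- n%:R) n%:R.
Proof. by apply/seteqP; split => t /= h i; have := h i; rewrite ler_norml. Qed.

Lemma measurable_box d a b : measurable (@box d a b).
Proof.
rewrite (_ : @box d a b = \bigcap_(i in [set: 'I_d]) ((@tnth d R)^~ i @^-1` `[a, b]%classic)); last first.
  by apply/seteqP; split => t /= h i; have := h i; rewrite /= in_itv/= => // /(_ I).
apply: fin_bigcap_measurable => // i _.
rewrite -[X in measurable X]setTI; apply: measurable_tnth => //; exact: measurable_itv.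
Qed.

Lemma preimage_cons_box d a b :
  @cons_point R d @^-1` (@box d.+1 a b) = @box d a b `*` `[a, b]%classic.
Proof.
apply/seteqP; split => -[t s] /=.
  move=> h; split => /=.
    by move=> i; have := h (lift ord0 i); rewrite tnthS.
  by rewrite in_itv/=; have := h ord0; rewrite tnth0.
move=> [/= h1]; rewrite in_itv/= => h2 i.
have [j ->|->] := unliftP ord0 i; first by rewrite tnthS; exact: h1.
by rewrite tnth0.
Qed.

Lemma lebesgue_Rd_box d a b : a < b ->
  lebesgue_Rd R d (@box d a b) = ((b - a) ^+ d)%:E.
Proof.
move=> ab; elim: d => [|d ih].
  rewrite /= diracE mem_set ?expr0//.
  by move=> [[]].
rewrite lebesgue_RdS preimage_cons_box product_measure1E//; last exact: measurable_box.
rewrite exprS mulrC EFinM; congr (_ * _)%E; first exact: ih.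
by have := lebesgue_measure_itv `[a, b]; rewrite /= lte_fin ab.
Qed.

Lemma mem_cubeS d (t : d.-tuple R) : exists n, cube n.+1 t.
Proof.
pose M : R := \sum_(i < d) `|tnth t i|; exists (Num.truncn M) => i.
have iM : `|tnth t i| <= M by rewrite /M (bigD1 i)//= lerDl sumr_ge0.
by rewrite (le_trans iM)// ltW// truncnS_gt.
Qed.

Lemma sub_cube d m n : (m <= n)%N -> @cube R d m `<=` @cube R d n.
Proof. by move=> mn t tm i; rewrite (le_trans (tm i))// ler_nat. Qed.

Lemma measurable_cube d n : measurable (@cube R d n).
Proof. by rewrite cubeE; exact: measurable_box. Qed.

Lemma sigma_finite_lebesgue_Rd d : sigma_finite setT (lebesgue_Rd R d).
Proof.
(* [n.+1] because the volume formula needs an edge of positive length. *)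
exists (fun n => @cube R d n.+1).
  apply/seteqP; split => // t _.
  by have [n tn] := mem_cubeS t; exists n.
move=> n; split; first exact: measurable_cube.
by rewrite cubeE lebesgue_Rd_box ?ltry// gtrN.
Qed.

(* An alias that carries the sigma-finite structure. *)
Definition lebd d : set (d.-tuple R) -> \bar R := lebesgue_Rd R d.

HB.instance Definition _ d := Measure.on (@lebd d).
HB.instance Definition _ d :=
  Measure_isSigmaFinite.Build _ _ _ (@lebd d) (@sigma_finite_lebesgue_Rd d).

End LebesgueRd.
Arguments lebd : clear implicits.

Section FourierRd.
Variable R : realType.
Notation leb := (@lebesgue_measure R).
Notation lebd := (lebd R).

Definition phd d (t u : d.-tuple R) : R := 2 * pi * dotp t u.

Lemma measurable_phd d : measurable_fun setT (fun p : d.-tuple R * d.-tuple R => phd p.1 p.2).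
Proof.
apply: measurable_funM => //; apply: measurable_sum => i.
by apply: measurable_funM; apply: (measurableT_comp (measurable_tnth _)); [exact: measurable_fst|exact: measurable_snd].
Qed.

Lemma phd_cons d (p q : d.-tuple R * R) :
  phd (cons_point p) (cons_point q) = phd p.1 q.1 + ph1 p.2 q.2.
Proof.
rewrite /phd /ph1 -mulrDr /dotp big_ord_recl !tnth0 addrC; congr (_ * (_ + _)).
by apply: eq_bigr => i _; rewrite !tnthS.
Qed.

Lemma cube_fin d n : (lebd d (@cube R d n) < +oo)%E.
Proof.
apply: (@le_lt_trans _ _ (lebd d (@cube R d n.+1))).
  by apply: le_measure; rewrite ?inE; [exact: measurable_cube|exact: measurable_cube|exact: sub_cube].
by rewrite /lebd cubeE lebesgue_Rd_box ?ltry// gtrN.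
Qed.

(** By induction: R^(d+1) is the image of R^d x R under [cons_point], where the phase is the sum of
    the two phases. For d = 0 the measure is a unit mass and the transform is the identity. *)
Lemma ft_isometry_lebd d n : ft_isometry (lebd d) (@phd d) (@cube R d n).
Proof.
elim: d => [|d ih].
  move=> a b ma mb _ _ _ _.
  have ev (f : 0.-tuple R -> R) : (\int[lebd 0]_t (f t)%:E = (f [tuple])%:E)%E.
    have -> : (fun t => (f t)%:E) = cst (f [tuple])%:E.
      by apply/funext => t; rewrite (tuple0 t).
    rewrite integral_cst// [X in (_ * X)%E](_ : _ = 1%E) ?mule1//.
    exact: diracT.
  rewrite !ev /ftre /ftim /Rintegral !ev /= /phd.
  have -> : dotp [tuple] [tuple] = 0 :> R by rewrite /dotp big_ord0.
  by rewrite mulr0 cos0 sin0 !mulr1 !mulr0 addr0 subr0.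
apply: (@ft_isometry_image _ _ _ _ _ (lebd d \x leb)%E (lebd d.+1) _ (@measurable_cons_point R d)
  _ (fun p q => phd p.1 q.1 + ph1 p.2 q.2)).
- by [].
- exact: measurable_cube.
- exact: cube_fin.
- exact: measurable_phd.
- exact: phd_cons.
rewrite cubeE preimage_cons_box -cubeE.
apply: ft_isometry_prod.
- exact: measurable_phd.
- exact: measurable_ph1.
- exact: measurable_cube.
- exact: measurable_itv.
- exact: cube_fin.
- by have := lebesgue_measure_itv `[- n%:R : R, n%:R]; rewrite /= => ->; case: ifP; rewrite ?ltry.
- exact: ih.
- exact: ft_isometry_segment.
Qed.

(** The coordinate is the head of the tuple, and a point of R is null, or it belongs to the tail,
    and the induction hypothesis applies. *)
Lemma hyperplane_null d (i : 'I_d) : lebd d [set t | tnth t i = 0] = 0%E.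
Proof.
have mH d' (k : 'I_d') : measurable [set t : d'.-tuple R | tnth t k = 0].
  rewrite (_ : mkset _ = (@tnth d' R)^~ k @^-1` [set 0]); last by apply/seteqP; split.
  rewrite -[X in measurable X]setTI; apply: measurable_tnth => //.
elim: d i => [[]//|d ih] i.
rewrite /lebd lebesgue_RdS.
have [j ->|->] := unliftP ord0 i.
  rewrite (_ : _ @^-1` _ = [set t | tnth t j = 0] `*` setT).
    rewrite product_measure1E//; last exact: mH.
    by rewrite [X in (X * _)%E](_ : _ = 0%E) ?mul0e//; exact: ih.
  by apply/seteqP; split => -[t s]; rewrite /= tnthS; [|case].
rewrite (_ : _ @^-1` _ = setT `*` [set 0]).
  by rewrite product_measure1E//= lebesgue_measure_set1 mule0.
by apply/seteqP; split => -[t s]; rewrite /= tnth0; [|case].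
Qed.
End FourierRd.

(** * Completeness of L2 *)

Lemma limn_einf_le (R : realType) (u : nat -> \bar R) (c : \bar R) :
  (forall n, u n <= c)%E -> (limn_einf u <= c)%E.
Proof.
move=> uc; rewrite limn_einf_lim; apply: lime_le; first exact: is_cvg_einfs.
near=> n; apply: le_trans (uc n).
by apply: ereal_inf_lbound; exists n => //=.
Unshelve. all: by end_near. Qed.

Lemma sum_half_le2 (R : realType) n : \sum_(0 <= k < n) (2^-1 : R) ^+ k <= 2.
Proof.
have h : `|2^-1 : R| < 1 by rewrite ger0_norm// invf_lt1// ltr1n.
have := @geometric_le_lim R n 1 2^-1 ler01; rewrite /series /geometric /=.
rewrite (_ : 1 - 2^-1 = 2^-1 :> R); last by field.
rewrite invrK mul1r; under eq_bigr do rewrite mul1r.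
by apply.
Qed.

Section RieszFischer.
Context d (T : measurableType d) (R : realType) (mu : {measure set T -> \bar R}).

(* An increment [v] of [u] satisfies [|v| <= 2^-n + 2^n v^2], and the sum of
   the right-hand sides is integrable up to a constant. *)
Lemma fast_cauchy_cvg_ae (u : nat -> T -> R) : (forall n, measurable_fun setT (u n)) ->
  (forall n, (\int[mu]_t ((u n.+1 t - u n t) ^+ 2)%:E <= (4^-1 ^+ n)%:E)%E) ->
  {ae mu, forall t, cvgn (u ^~ t)}.
Proof.
move=> mu_ le.
pose v n t := u n.+1 t - u n t.
have mv n : measurable_fun setT (fun t => 2 ^+ n * v n t ^+ 2).
  by apply: measurable_funM => //; apply: measurable_funX; apply: measurable_funB.
have v0 n t : 0 <= 2 ^+ n * v n t ^+ 2 by apply: mulr_ge0; [exact: exprn_ge0|exact: sqr_ge0].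
pose G t := (\sum_(0 <= n <oo) (2 ^+ n * v n t ^+ 2)%:E)%E.
have Gfin : (\int[mu]_t G t < +oo)%E.
  rewrite integral_nneseries//; last 2 first.
  - by move=> n; exact/measurable_EFinP.
  - by move=> n t _; rewrite lee_fin.
  apply: (@le_lt_trans _ _ (\sum_(0 <= n <oo) (2^-1 ^+ n)%:E)%E).
    apply: lee_nneseries => n _.
      by move=> _; apply: integral_ge0 => t _; rewrite lee_fin.
    under eq_integral do rewrite EFinM.
    rewrite ge0_integralZl; last first.
    - by rewrite lee_fin exprn_ge0.
    - by move=> t _; rewrite lee_fin sqr_ge0.
    - by apply/measurable_EFinP; apply: measurable_funX; apply: measurable_funB.
    - exact: measurableT.
    (* The assumed rate 4^-n is what the factor 2^n reduces to the summable 2^-n. *)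
    rewrite (_ : 2^-1 ^+ n = 2 ^+ n * 4^-1 ^+ n); last first.
      by rewrite -exprMn; congr (_ ^+ _); field.
    by rewrite EFinM lee_wpmul2l ?lee_fin ?exprn_ge0//; exact: le.
  apply: (@le_lt_trans _ _ 2%:E); last exact: ltry.
  apply: lime_le; first by apply: is_cvg_nneseries => n _ _; rewrite lee_fin exprn_ge0.
  by near=> n; rewrite sumEFin lee_fin; exact: sum_half_le2.
have mG : measurable_fun setT G.
  apply: (ge0_emeasurable_sum (P := predT)) => [n t _ _|n _].
    by rewrite lee_fin.
  exact/measurable_EFinP.
have iG : mu.-integrable setT G.
  apply/integrableP; split => //.
  rewrite (_ : (\int[mu]_t `|G t|)%E = (\int[mu]_t G t)%E)//.
  apply: eq_integral => t _; rewrite gee0_abs//.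
  by apply: nneseries_ge0 => n _ _; rewrite lee_fin.
apply: filterS (integrable_ae measurableT iG) => t /(_ I) Gt.
have cv : cvgn (series (fun n => v n t)).
  apply: normed_cvg; apply: nondecreasing_is_cvgn.
    by apply: nondecreasing_series => n *; exact: normr_ge0.
  exists (2 + fine (G t)) => _ [n _ <-].
  rewrite /series /=.
  apply: (@le_trans _ _ (\sum_(0 <= k < n) (2^-1 ^+ k + 2 ^+ k * v k t ^+ 2))).
    apply: ler_sum => k _.
    have p2 : 0 < 2 ^+ k :> R by rewrite exprn_gt0.
    (* A large increment satisfies 1 <= 2^k |v|, hence |v| <= 2^k v^2. *)
    have [h|h] := leP `|v k t| (2^-1 ^+ k).
      by rewrite (le_trans h)// lerDl.
    rewrite -[leLHS]add0r lerD ?exprn_ge0// -(real_normK (num_real (v k t))) expr2 mulrA.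
    have h1 : 1 <= 2 ^+ k * `|v k t| by rewrite -ler_pdivrMl// mulr1 -exprVn ltW.
    by rewrite ler_peMl.
  rewrite big_split/=; apply: lerD.
    exact: sum_half_le2.
  rewrite -lee_fin fineK// -sumEFin; apply: nneseries_lim_ge => k _ _.
  by rewrite lee_fin.
have -> : u ^~ t = (fun n => u 0%N t + series (fun n => v n t) n).
  apply/funext => n; rewrite /series /= /v telescope_sumr//; ring.
by apply: is_cvgD => //; exact: is_cvg_cst.
Unshelve. all: by end_near. Qed.

(** A fast subsequence converges almost everywhere, and Fatou's lemma carries the Cauchy bound to
    its limit, so the rate [e] is kept for the whole sequence. *)
Theorem riesz_fischer (f : nat -> T -> R) (e : nat -> R) :
  (forall n, measurable_fun setT (f n)) ->
  (forall m n, (m <= n)%N -> (\int[mu]_t ((f n t - f m t) ^+ 2)%:E <= (e m)%:E)%E) ->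
  e @ \oo --> (0 : R) ->
  exists2 g : T -> R, measurable_fun setT g &
    forall m, (\int[mu]_t ((f m t - g t) ^+ 2)%:E <= (e m)%:E)%E.
Proof.
move=> mf fe e0.
have ex k : exists N, forall n, (N <= n)%N -> e n <= 4^-1 ^+ k.
  have q0 : 0 < 4^-1 ^+ k :> R by rewrite exprn_gt0.
  have /cvgr0Pnorm_le/(_ _ q0)[N _ HN] := e0.
  by exists N => n Nn; rewrite (le_trans (ler_norm _))//; exact: HN.
have [N HN] := choice ex.
(* [phi k] is at least [N k], for the fast decay, and at least [k], to pass beyond any given
   index. *)
pose phi k := (\sum_(i < k.+1) (N i).+1)%N.
have phiS k : (phi k <= phi k.+1)%N by rewrite /phi [leqRHS]big_ord_recr leq_addr.
have Nphi k : (N k <= phi k)%N.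
  by rewrite /phi big_ord_recr/= (leq_trans (leqnSn _))// leq_addl.
have kphi k : (k <= phi k)%N.
  elim: k => // k ih; rewrite /phi big_ord_recr/= -/(phi k) addnS ltnS.
  by rewrite (leq_trans ih)// leq_addr.
pose u k := f (phi k).
have mu_ k : measurable_fun setT (u k) by exact: mf.
have aecv : {ae mu, forall t, cvgn (u ^~ t)}.
  by apply: fast_cauchy_cvg_ae => // k; rewrite (le_trans (fe _ _ (phiS k)))// lee_fin HN.
(* The upper limit is measurable everywhere and equals the limit wherever there is one; [fine] turns
   infinite values into 0. *)
pose g t := fine (limn_esup (fun k => (u k t)%:E)).
have mg : measurable_fun setT g.
  apply: measurableT_comp => //; apply: measurable_fun_limn_esup => k.
  exact/measurable_EFinP.
have gE t : cvgn (u ^~ t) -> u k t @[k --> \oo] --> g t.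
  move=> cu; have cue : (fun k => (u k t)%:E) @ \oo --> (limn (u ^~ t))%:E.
    by apply: cvg_EFin => //; exact: nearW.
  by rewrite /g (is_cvg_limn_esupE (cvgP _ cue)) (cvg_lim _ cue).
exists g => // m.
(* The shift by [m] keeps all indices at least [m], where the Cauchy bound [e m] is valid. *)
pose h k t := ((f m t - u (m + k)%N t) ^+ 2)%:E.
have mh k : measurable_fun setT (h k).
  by apply/measurable_EFinP; apply: measurable_funX; apply: measurable_funB; [exact: mf|exact: mu_].
have h0 k t : setT t -> (0 <= h k t)%E by move=> _; rewrite lee_fin sqr_ge0.
apply: (@le_trans _ _ (\int[mu]_t limn_einf (h ^~ t))%E).
  apply: ae_ge0_le_integral => //.
  - by move=> t _; rewrite lee_fin sqr_ge0.
  - by apply/measurable_EFinP; apply: measurable_funX; apply: measurable_funB; [exact: mf|].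
  - move=> t _; rewrite limn_einf_lim; apply: lime_ge; first exact: is_cvg_einfs.
    by near=> n; apply: le_ereal_inf_tmp => _ [k _ <-]; exact: h0.
  - rewrite (_ : (fun t => _) = \- (fun t => limn_esup (\- (h ^~ t))))%E; last first.
      apply/funext => t; rewrite -[LHS]oppeK -limn_esupN; congr (- limn_esup _)%E.
    apply: measurableT_comp => //; apply: measurable_fun_limn_esup => k.
    exact: measurableT_comp.
  - apply: filterS aecv => t ct _.
    have hc : h ^~ t @ \oo --> ((f m t - g t) ^+ 2)%:E.
      apply: cvg_EFin; first exact: nearW.
      have cgm : u (m + k)%N t @[k --> \oo] --> g t.
        by have := gE _ ct; rewrite -(cvg_shiftn m); under eq_fun do rewrite addnC.
      by rewrite expr2; apply: cvgM; (apply: cvgB => //; exact: cvg_cst).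
    by rewrite (is_cvg_limn_einfE (cvgP _ hc)) (cvg_lim _ hc).
apply: le_trans (fatou mu measurableT mh h0) _.
apply: limn_einf_le => k.
have mk : (m <= phi (m + k)%N)%N by rewrite (leq_trans _ (kphi _))// leq_addr.
apply: le_trans (fe _ _ mk).
rewrite le_eqVlt; apply/orP; left; apply/eqP; apply: eq_integral => t _.
by rewrite /h -opprB sqrrN.
Unshelve. all: by end_near. Qed.
End RieszFischer.

(** * The Fourier transform on L2(R^d) *)

Local Open Scope complex_scope.
Local Notation cmod := (@Normc.normc _).

Lemma normc_sqr (R : realType) (z : R[i]) :
  Normc.normc z ^+ 2 = complex.Re z ^+ 2 + complex.Im z ^+ 2.
Proof. by case: z => a b /=; rewrite sqr_sqrtr// addr_ge0 ?sqr_ge0. Qed.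

Lemma normc_ge0 (R : realType) (z : R[i]) : 0 <= Normc.normc z.
Proof. by case: z => a b /=; exact: sqrtr_ge0. Qed.

Section ComplexL2.
Context d (T : measurableType d) (R : realType) (mu : {measure set T -> \bar R}).
Implicit Types x y z : T -> R[i].

Definition cmeas x := measurable_fun setT (fun t => complex.Re (x t)) /\
  measurable_fun setT (fun t => complex.Im (x t)).

Definition sqnorm x : \bar R := (\int[mu]_t (cmod (x t) ^+ 2)%:E)%E.

Definition L2n x : \bar R := ('N[mu]_2%:E [EFin \o cmod \o x])%E.

Lemma sqnorm_ge0 x : (0 <= sqnorm x)%E.
Proof. by apply: integral_ge0 => t _; rewrite lee_fin sqr_ge0. Qed.

Lemma L2n_ge0 x : (0 <= L2n x)%E. Proof. exact: Lnorm_ge0. Qed.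

Lemma L2nE x : L2n x = poweR (sqnorm x) 2^-1.
Proof.
rewrite /L2n unlock /=; congr poweR; apply: eq_integral => t _.
by rewrite /= ger0_norm ?normc_ge0// powR_mulrn// normc_ge0.
Qed.

Lemma L2n_le (c : R) x : 0 <= c -> (L2n x <= c%:E)%E = (sqnorm x <= (c ^+ 2)%:E)%E.
Proof.
move=> c0; rewrite L2nE; have := sqnorm_ge0 x.
case: (sqnorm x) => [r| |] //=; rewrite ?lee_fin.
  move=> r0; rewrite powR12_sqrt// -[in RHS](sqr_sqrtr r0) ler_pXn2r ?nnegrE// sqrtr_ge0//.
by rewrite invr_eq0 pnatr_eq0.
Qed.

Lemma L2n_lty x : (L2n x < +oo)%E = (sqnorm x < +oo)%E.
Proof.
rewrite L2nE; have := sqnorm_ge0 x.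
case: (sqnorm x) => [r| |] //= r0; rewrite ?ltry//.
by rewrite invr_eq0 pnatr_eq0.
Qed.

Lemma L2n_cvg0 (x : nat -> T -> R[i]) :
  (fun n => sqnorm (x n)) @ \oo --> 0%E -> (fun n => L2n (x n)) @ \oo --> 0%E.
Proof.
move=> cv; apply: cvge0_near => [n|c c0]; first exact: L2n_ge0.
have c2 : 0 < c ^+ 2 by rewrite exprn_gt0.
by apply: filterS (cvge0_nearP cv c2) => n; rewrite L2n_le// ltW.
Qed.

Lemma measurable_cmod x : cmeas x -> measurable_fun setT (fun t => cmod (x t)).
Proof.
move=> [mr mi].
rewrite (_ : (fun t => _) = (fun t => Num.sqrt (complex.Re (x t) ^+ 2 + complex.Im (x t) ^+ 2))); last first.
  by apply/funext => t; case: (x t).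
apply: (measurableT_comp (f := @Num.sqrt R)).
  by apply: continuous_measurable_fun; exact: sqrt_continuous.
by apply: measurable_funD; exact: measurable_funX.
Qed.

Lemma cmeasD x y : cmeas x -> cmeas y -> cmeas (fun t => x t + y t).
Proof.
move=> [a b] [a' b']; split.
  rewrite (_ : (fun t => _) = (fun t => complex.Re (x t) + complex.Re (y t))); first exact: measurable_funD.
  by apply/funext => t; case: (x t); case: (y t).
rewrite (_ : (fun t => _) = (fun t => complex.Im (x t) + complex.Im (y t))); first exact: measurable_funD.
by apply/funext => t; case: (x t); case: (y t).
Qed.

Lemma cmeasN x : cmeas x -> cmeas (fun t => - x t).
Proof.
move=> [a b]; split.
  rewrite (_ : (fun t => _) = (fun t => - complex.Re (x t))); first exact: measurable_funN.
  by apply/funext => t; case: (x t).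
rewrite (_ : (fun t => _) = (fun t => - complex.Im (x t))); first exact: measurable_funN.
by apply/funext => t; case: (x t).
Qed.

Lemma cmeasB x y : cmeas x -> cmeas y -> cmeas (fun t => x t - y t).
Proof. by move=> mx my; apply: cmeasD => //; exact: cmeasN. Qed.

Definition cconj x t := (x t)^*%C.

Lemma cmeas_conj x : cmeas x -> cmeas (cconj x).
Proof.
move=> [a b]; split.
  by rewrite (_ : (fun t => _) = (fun t => complex.Re (x t)))//; apply/funext => t; rewrite /cconj; case: (x t).
rewrite (_ : (fun t => _) = (fun t => - complex.Im (x t))); first exact: measurable_funN.
by apply/funext => t; rewrite /cconj; case: (x t).
Qed.

Lemma sqnorm_conj x : sqnorm (cconj x) = sqnorm x.
Proof.
by apply: eq_integral => t _; rewrite !normc_sqr /cconj; case: (x t) => a b /=; rewrite sqrrN.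
Qed.

Lemma L2n_conj x : L2n (cconj x) = L2n x.
Proof. by rewrite !L2nE sqnorm_conj. Qed.

Lemma eq_L2n x y : x =1 y -> L2n x = L2n y.
Proof. by move=> xy; congr L2n; exact/funext. Qed.

Lemma L2n_subC x y : L2n (fun t => x t - y t) = L2n (fun t => y t - x t).
Proof.
rewrite !L2nE; congr poweR; apply: eq_integral => t _.
by rewrite !normc_sqr; case: (x t) => a b; case: (y t) => a' b' /=; congr (_%:E); ring.
Qed.

(** Minkowski's inequality for the real functions |x| and |y|, after the pointwise triangle
    inequality. *)
Lemma le_L2nD x y : cmeas x -> cmeas y -> (L2n (fun t => x t + y t)%R <= L2n x + L2n y)%E.
Proof.
move=> mx my.
have := minkowski_EFin mu (measurable_cmod mx) (measurable_cmod my) (ler1n _ 2).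
apply: le_trans; rewrite L2nE unlock /=; apply: gt0_ler_poweR.
- by rewrite invr_ge0.
- by rewrite in_itv/= leey sqnorm_ge0.
- by rewrite in_itv/= leey andbT integral_ge0// => t _; rewrite lee_fin powR_ge0.
have mD := measurable_funD (measurable_cmod mx) (measurable_cmod my).
apply: ge0_le_integral => //.
- by move=> t _; rewrite lee_fin sqr_ge0.
- by apply/measurable_EFinP; apply: measurable_funX; apply: measurable_cmod; exact: cmeasD.
- apply/measurable_EFinP; apply: (measurableT_comp (measurable_powR _)).
  exact: measurableT_comp.
- move=> t _; rewrite lee_fin ger0_norm ?addr_ge0 ?normc_ge0// powR_mulrn ?addr_ge0 ?normc_ge0//.
  rewrite ler_pXn2r ?nnegrE ?addr_ge0 ?normc_ge0//.
  exact: le_normcD.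
Qed.

Lemma sqnorm_pair x : cmeas x ->
  sqnorm x = (\int[mu]_t (complex.Re (x t) ^+ 2)%:E + \int[mu]_t (complex.Im (x t) ^+ 2)%:E)%E.
Proof.
move=> [mr mi]; rewrite -ge0_integralD; last first.
- by apply/measurable_EFinP; exact: measurable_funX.
- by move=> t _; rewrite lee_fin sqr_ge0.
- by apply/measurable_EFinP; exact: measurable_funX.
- by move=> t _; rewrite lee_fin sqr_ge0.
- exact: measurableT.
by apply: eq_integral => t _; rewrite normc_sqr EFinD.
Qed.

Lemma sqnorm_ReIm x : cmeas x ->
  (\int[mu]_t (complex.Re (x t) ^+ 2)%:E <= sqnorm x)%E /\
  (\int[mu]_t (complex.Im (x t) ^+ 2)%:E <= sqnorm x)%E.
Proof.
move=> mx; rewrite sqnorm_pair//; split.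
  by rewrite leeDl// integral_ge0// => t _; rewrite lee_fin sqr_ge0.
by rewrite leeDr// integral_ge0// => t _; rewrite lee_fin sqr_ge0.
Qed.

Lemma sqnorm_eq0 x y : cmeas x -> cmeas y -> sqnorm (fun t => x t - y t) = 0%E ->
  {ae mu, forall t, x t = y t}.
Proof.
move=> mx my h.
have mm : measurable_fun setT (fun t => (cmod (x t - y t) ^+ 2)%:E).
  by apply/measurable_EFinP; apply: measurable_funX; apply: measurable_cmod; exact: cmeasB.
have := (ae_eq_integral_abs mu measurableT mm).1.
have -> : (\int[mu]_t `|(cmod (x t - y t) ^+ 2)%:E| = 0)%E.
  by rewrite -h; apply: eq_integral => t _; rewrite gee0_abs// lee_fin sqr_ge0.
move=> /(_ erefl); apply: filterS => t /(_ I) /= [] /eqP; rewrite sqrf_eq0 => /eqP.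
by move=> /Normc.eq0_normc /eqP; rewrite subr_eq0 => /eqP.
Qed.

Lemma integrable_Rem x y : cmeas x -> cmeas y -> (sqnorm x < +oo)%E -> (sqnorm y < +oo)%E ->
  mu.-integrable setT (EFin \o (fun t => complex.Re (x t) * complex.Re (y t) - complex.Im (x t) * complex.Im (y t))).
Proof.
move=> mx my x2 y2.
have ix : mu.-integrable setT (EFin \o (fun t => cmod (x t) ^+ 2)).
  apply: ge0_integrable => //; last by move=> t; exact: sqr_ge0.
  by apply: measurable_funX; exact: measurable_cmod.
have iy : mu.-integrable setT (EFin \o (fun t => cmod (y t) ^+ 2)).
  apply: ge0_integrable => //; last by move=> t; exact: sqr_ge0.
  by apply: measurable_funX; exact: measurable_cmod.
apply: le_integrable (integrable_EFinD measurableT ix iy) => //.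
  move: mx my => [a b] [a' b'].
  by apply/measurable_EFinP; apply: measurable_funB; exact: measurable_funM.
move=> t _; rewrite lee_fin [leRHS]ger0_norm ?addr_ge0 ?sqr_ge0// !normc_sqr ler_norml.
move: (complex.Re (x t)) (complex.Im (x t)) (complex.Re (y t)) (complex.Im (y t)) => a b a' b'.
have := sqr_ge0 (a - a'); have := sqr_ge0 (a + a'); have := sqr_ge0 (b - b'); have := sqr_ge0 (b + b').
have := sqr_ge0 a; have := sqr_ge0 a'; have := sqr_ge0 b; have := sqr_ge0 b'.
by rewrite !sqrrD !sqrrN; move=> *; apply/andP; split; lra.
Qed.

(** The conjugate turns the cross term into the real part of the bilinear integral of x y, the form
    for which the transform is symmetric. *)
Lemma sqnorm_sub_conj x y : cmeas x -> cmeas y -> (sqnorm x < +oo)%E -> (sqnorm y < +oo)%E ->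
  sqnorm (fun t => x t - cconj y t) = (sqnorm x + sqnorm y - 2%:E *
    \int[mu]_t (complex.Re (x t) * complex.Re (y t) - complex.Im (x t) * complex.Im (y t))%:E)%E.
Proof.
move=> mx my x2 y2.
have ix : mu.-integrable setT (EFin \o (fun t => cmod (x t) ^+ 2)).
  apply: ge0_integrable => //; last by move=> t; exact: sqr_ge0.
  by apply: measurable_funX; exact: measurable_cmod.
have iy : mu.-integrable setT (EFin \o (fun t => cmod (y t) ^+ 2)).
  apply: ge0_integrable => //; last by move=> t; exact: sqr_ge0.
  by apply: measurable_funX; exact: measurable_cmod.
have iR := integrable_Rem mx my x2 y2.
rewrite -integralZl// -integralD// -integralB_EFin//.
- apply: eq_integral => t _; rewrite -EFinB !normc_sqr /cconj; congr (_%:E).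
  by case: (x t) => a b; case: (y t) => a' b' /=; ring.
- exact: integrable_EFinD.
- by have := integrableZl measurableT 2 iR.
Qed.
End ComplexL2.

(** * The transform of functions supported in a cube *)

Section CubeTransform.
Context (R : realType) (d : nat).
Notation mu := (lebd R d).
Notation V := (d.-tuple R).
Notation Re := (@complex.Re _).
Notation Im := (@complex.Im _).
Implicit Types x y z w : V -> R[i].

Definition trunc n x (t : V) : R[i] := if `[< cube n t >] then x t else 0.

Definition cft x (u : V) : R[i] :=
  ftre mu (@phd R d) (fun t => Re (x t)) (fun t => Im (x t)) u +i*
  ftim mu (@phd R d) (fun t => Re (x t)) (fun t => Im (x t)) u.

Definition cube_L2 n x := [/\ cmeas x, (forall t, ~ cube n t -> x t = 0) & (sqnorm mu x < +oo)%E].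

Lemma trunc_Re n x t : Re (trunc n x t) = ((fun t => Re (x t)) \_ (@cube R d n)) t.
Proof. by rewrite /trunc patchE; case: asboolP => h; [rewrite mem_set|rewrite memNset]. Qed.

Lemma trunc_Im n x t : Im (trunc n x t) = ((fun t => Im (x t)) \_ (@cube R d n)) t.
Proof. by rewrite /trunc patchE; case: asboolP => h; [rewrite mem_set|rewrite memNset]. Qed.

Lemma cmeas_trunc n x : cmeas x -> cmeas (trunc n x).
Proof.
move=> [a b]; split.
  rewrite (_ : (fun t => _) = ((fun t => Re (x t)) \_ (@cube R d n))); last by apply/funext => t; exact: trunc_Re.
  exact: ((measurable_restrictT _ (measurable_cube n)).1 (measurable_funTS a)).
rewrite (_ : (fun t => _) = ((fun t => Im (x t)) \_ (@cube R d n))); last by apply/funext => t; exact: trunc_Im.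
exact: ((measurable_restrictT _ (measurable_cube n)).1 (measurable_funTS b)).
Qed.

Lemma normc0 : cmod (0 : R[i]) = 0. Proof. exact: Normc.normc0. Qed.

Lemma le_sqnorm x y : cmeas x -> cmeas y -> (forall t, cmod (x t) <= cmod (y t)) ->
  (sqnorm mu x <= sqnorm mu y)%E.
Proof.
move=> mx my h; apply: ge0_le_integral => //.
- by move=> t _; rewrite lee_fin sqr_ge0.
- by apply/measurable_EFinP; apply: measurable_funX; exact: measurable_cmod.
- by apply/measurable_EFinP; apply: measurable_funX; exact: measurable_cmod.
- by move=> t _; rewrite lee_fin ler_pXn2r ?nnegrE ?normc_ge0.
Qed.

Lemma cube_L2_trunc n x : cmeas x -> (sqnorm mu x < +oo)%E -> cube_L2 n (trunc n x).
Proof.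
move=> mx x2; split; first exact: cmeas_trunc.
  by move=> t nt; rewrite /trunc asboolF.
apply: le_lt_trans x2; apply: le_sqnorm => //; first exact: cmeas_trunc.
by move=> t; rewrite /trunc; case: ifP => //; rewrite normc0 normc_ge0.
Qed.

Lemma cube_L2W m n x : (m <= n)%N -> cube_L2 m x -> cube_L2 n x.
Proof. by move=> mn [mx sx x2]; split => // t nt; apply: sx => /(sub_cube mn). Qed.

Lemma cube_L2_sub n x y : cube_L2 n x -> cube_L2 n y -> cube_L2 n (fun t => x t - y t).
Proof.
move=> [mx sx x2] [my sy y2]; split; first exact: cmeasB.
  by move=> t nt; rewrite sx// sy// subr0.
rewrite -L2n_lty; apply: (le_lt_trans (le_L2nD mu mx (cmeasN my))).
apply: lte_add_pinfty; first by rewrite L2n_lty.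
rewrite (_ : L2n _ _ = L2n mu y) ?L2n_lty//.
by rewrite !L2nE; congr poweR; apply: eq_integral => t _; rewrite !normc_sqr; case: (y t) => a b /=; rewrite !sqrrN.
Qed.

Lemma cube_L2_integrable n x : cube_L2 n x ->
  mu.-integrable setT (EFin \o (fun t => Re (x t))) /\ mu.-integrable setT (EFin \o (fun t => Im (x t))).
Proof.
move=> [mx sx x2]; have [r2 i2] := sqnorm_ReIm mu mx; have [mr mi] := mx.
split; apply: (integrable_sqr (measurable_cube n) (cube_fin R d n)) => //.
- by move=> t nt; rewrite sx.
- exact: le_lt_trans x2.
- by move=> t nt; rewrite sx.
- exact: le_lt_trans x2.
Qed.

(** Replaces integration over a cube by the transform of a function supported there, to which the
    isometry applies. *)
Lemma fourier_cubeE n x : fourier_cube n x = cft (trunc n x).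
Proof.
apply/funext => u; rewrite /fourier_cube /Cintegral /cft /ftre /ftim /phd.
congr (_ +i* _); rewrite Rintegral_mkcond; apply: eq_Rintegral => t _.
  rewrite patchE trunc_Re trunc_Im !patchE; case: ifP => _; last by rewrite !mul0r addr0.
  by case: (x t) => a b /=; rewrite cosN sinN; ring.
rewrite patchE trunc_Re trunc_Im !patchE; case: ifP => _; last by rewrite !mul0r subr0.
by case: (x t) => a b /=; rewrite cosN sinN; ring.
Qed.

Lemma cmeas_cft x : cmeas x -> cmeas (cft x).
Proof. move=> [a b]; split.
  exact: (@measurable_ftre _ _ _ mu _ _ _ (@measurable_phd R d) a b).
exact: (@measurable_ftim _ _ _ mu _ _ _ (@measurable_phd R d) a b). Qed.

Lemma sqnorm_cft n x : cube_L2 n x -> sqnorm mu (cft x) = sqnorm mu x.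
Proof.
move=> [mx sx x2]; have [r2 i2] := sqnorm_ReIm mu mx; have [mr mi] := mx.
rewrite /sqnorm; under eq_integral do rewrite normc_sqr /=.
under [RHS]eq_integral do rewrite normc_sqr.
apply: (@ft_isometry_lebd R d n (fun t => Re (x t)) (fun t => Im (x t)) mr mi).
- by move=> t nt; rewrite sx.
- by move=> t nt; rewrite sx.
- exact: le_lt_trans x2.
- exact: le_lt_trans x2.
Qed.

Lemma measurable_phdl (u : V) : measurable_fun setT ((@phd R d)^~ u).
Proof.
have mp : measurable_fun setT (fun t : V => (t, u)).
  by apply: measurable_fun_pair => //; exact: measurable_cst.
exact: (measurableT_comp (@measurable_phd R d) mp).
Qed.

Lemma cft_sub n x y u : cube_L2 n x -> cube_L2 n y ->
  cft (fun t => x t - y t) u = cft x u - cft y u.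
Proof.
move=> cx cy; have [ix1 ix2] := cube_L2_integrable cx; have [iy1 iy2] := cube_L2_integrable cy.
have mth := measurable_phdl u.
have mc : measurable_fun setT (fun t => cos (phd t u)) by exact: measurable_fun_cos.
have ms : measurable_fun setT (fun t => sin (phd t u)) by exact: measurable_fun_sin.
have i1 (f g : V -> R) : mu.-integrable setT (EFin \o f) -> mu.-integrable setT (EFin \o g) ->
    mu.-integrable setT (EFin \o (fun t => f t * cos (phd t u) + g t * sin (phd t u))).
  by move=> i j; apply: integrable_EFinD => //; apply: integrable_EFinM_le1 => // t; [exact: normr_cos_le1|exact: normr_sin_le1].
have i2 (f g : V -> R) : mu.-integrable setT (EFin \o f) -> mu.-integrable setT (EFin \o g) ->
    mu.-integrable setT (EFin \o (fun t => f t * cos (phd t u) - g t * sin (phd t u))).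
  by move=> i j; apply: integrable_EFinB => //; apply: integrable_EFinM_le1 => // t; [exact: normr_cos_le1|exact: normr_sin_le1].
rewrite /cft /ftre /ftim; set a := (X in X +i* _ = _); set b := (X in _ +i* X = _).
transitivity ((\int[mu]_t (Re (x t) * cos (phd t u) + Im (x t) * sin (phd t u)) -
   \int[mu]_t (Re (y t) * cos (phd t u) + Im (y t) * sin (phd t u))) +i*
  (\int[mu]_t (Im (x t) * cos (phd t u) - Re (x t) * sin (phd t u)) -
   \int[mu]_t (Im (y t) * cos (phd t u) - Re (y t) * sin (phd t u)))) => //.
rewrite -!RintegralB//; [|exact: i2|exact: i2|exact: i1|exact: i1].
congr (_ +i* _); apply: eq_Rintegral => t _; case: (x t) => p q; case: (y t) => p' q' /=; ring.
Qed.
End CubeTransform.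

Lemma dotpC (R : realType) d (t u : d.-tuple R) : dotp t u = dotp u t.
Proof. by apply: eq_bigr => i _; rewrite mulrC. Qed.

Lemma sqnormB_lty d (T : measurableType d) (R : realType) (mu : {measure set T -> \bar R})
    (x y : T -> R[i]) : cmeas x -> cmeas y -> (sqnorm mu x < +oo)%E -> (sqnorm mu y < +oo)%E ->
  (sqnorm mu (fun t => x t - y t)%R < +oo)%E.
Proof.
move=> mx my x2 y2; rewrite -L2n_lty; apply: (le_lt_trans (le_L2nD mu mx (cmeasN my))).
apply: lte_add_pinfty; rewrite L2n_lty//.
rewrite (_ : sqnorm _ _ = sqnorm mu y)//.
by apply: eq_integral => t _; rewrite !normc_sqr; case: (y t) => a b /=; rewrite !sqrrN.
Qed.

(** * Symmetry of the transform and convergence over growing cubes *)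

Section PlancherelLimit.
Context (R : realType) (d : nat).
Notation mu := (lebd R d).
Notation V := (d.-tuple R).
Notation Re := (@complex.Re _).
Notation Im := (@complex.Im _).
Implicit Types x y z w : V -> R[i].

(** Fubini and the symmetry of t . u; both functions are integrable because they are supported in a
    cube. *)
Lemma cft_sym n x y : cube_L2 n x -> cube_L2 n y ->
  (\int[mu]_u (Re (cft x u) * Re (y u) - Im (cft x u) * Im (y u))%:E =
   \int[mu]_t (Re (x t) * Re (cft y t) - Im (x t) * Im (cft y t))%:E)%E.
Proof.
move=> cx cy; have [ia ib] := cube_L2_integrable cx; have [ic ie] := cube_L2_integrable cy.
(* The real part of x(t) exp (- i phd t u) y(u). *)
pose K (p : V * V) := (Re (x p.1) * cos (phd p.1 p.2) + Im (x p.1) * sin (phd p.1 p.2)) * Re (y p.2)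
  + (Im (x p.1) * cos (phd p.1 p.2) - Re (x p.1) * sin (phd p.1 p.2)) * - Im (y p.2).
have iK : (mu \x mu)%E.-integrable setT (EFin \o K).
  have := integrable_prodM (integrable_EFinD measurableT (integrable_norm ia) (integrable_norm ib))
    (integrable_EFinD measurableT (integrable_norm ic) (integrable_norm ie)).
  have [[[mxr mxi] _ _] [[myr myi] _ _]] := (cx, cy).
  have m1 (f : V -> R) : measurable_fun setT f -> measurable_fun setT (fun p : V * V => f p.1).
    by move=> mf; exact: (measurableT_comp mf measurable_fst).
  have m2 (f : V -> R) : measurable_fun setT f -> measurable_fun setT (fun p : V * V => f p.2).
    by move=> mf; exact: (measurableT_comp mf measurable_snd).
  have mc : measurable_fun setT (fun p : V * V => cos (phd p.1 p.2)).
    by apply: measurable_fun_cos; exact: measurable_phd.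
  have ms : measurable_fun setT (fun p : V * V => sin (phd p.1 p.2)).
    by apply: measurable_fun_sin; exact: measurable_phd.
  apply: le_integrable => //.
    apply/measurable_EFinP; apply: measurable_funD; apply: measurable_funM.
    - by apply: measurable_funD; apply: measurable_funM => //; [exact: m1 mxr|exact: m1 mxi].
    - exact: m2 myr.
    - by apply: measurable_funB; apply: measurable_funM => //; [exact: m1 mxi|exact: m1 mxr].
    - by apply: measurable_funN; exact: m2 myi.
  move=> p _; rewrite lee_fin /K /= [leRHS]ger0_norm ?mulr_ge0 ?addr_ge0//.
  rewrite mulrDr; apply: (le_trans (ler_normD _ _)).
  apply: lerD; rewrite normrM ?normrN ler_wpM2r//.
    by apply: (le_trans (ler_normD _ _)); apply: lerD; rewrite normrM ler_piMr// ?normr_cos_le1 ?normr_sin_le1.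
  rewrite [leRHS]addrC; apply: (le_trans (ler_normB _ _)).
  by apply: lerD; rewrite normrM ler_piMr// ?normr_cos_le1 ?normr_sin_le1.
transitivity (\int[mu]_u \int[mu]_t (K (t, u))%:E)%E.
  apply: eq_integral => u _; rewrite /K /= (integral_ft_lincomb _ _ (measurable_phdl u) ia ib).
  by rewrite /cft /= mulrN.
rewrite -(Fubini iK); apply: eq_integral => t _.
transitivity (\int[mu]_u (((Re (y u) * cos (phd u t) + Im (y u) * sin (phd u t)) * Re (x t)
  + (Im (y u) * cos (phd u t) - Re (y u) * sin (phd u t)) * - Im (x t)))%:E)%E.
  by apply: eq_integral => u _; rewrite /K /= /phd dotpC; congr (_%:E); ring.
rewrite (integral_ft_lincomb _ _ (measurable_phdl t) ic ie).
by rewrite /cft /=; congr (_%:E); ring.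
Qed.

(** After expanding both squares, the norms agree by the isometry and the cross terms by
    [cft_sym]. *)
Lemma sqnorm_cft_conj n x y : cube_L2 n x -> cube_L2 n y ->
  sqnorm mu (fun u => cft x u - cconj y u) = sqnorm mu (fun t => x t - cconj (cft y) t).
Proof.
move=> cx cy; have [mx _ x2] := cx; have [my _ y2] := cy.
have cx2 := sqnorm_cft cx; have cy2 := sqnorm_cft cy.
rewrite !sqnorm_sub_conj ?cx2 ?cy2//; try exact: cmeas_cft.
by rewrite (cft_sym cx cy).
Qed.

Lemma sqnorm_trunc_cvg x : cmeas x -> (sqnorm mu x < +oo)%E ->
  (fun n => sqnorm mu (fun t => x t - trunc n x t)) @ \oo --> 0%E.
Proof.
move=> mx x2.
have mt n : cmeas (fun t => x t - trunc n x t) by apply: cmeasB => //; exact: cmeas_trunc.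
rewrite -(integral0 mu setT).
apply: (@dominated_cvg _ _ _ mu setT measurableT (fun n t => (cmod (x t - trunc n x t) ^+ 2)%:E) _ (fun t => (cmod (x t) ^+ 2)%:E)).
- by move=> n; apply/measurable_EFinP; apply: measurable_funX; exact: measurable_cmod.
- move=> t _; have [n0 h] := mem_cubeS t.
  apply: cvg_near_cst; exists n0.+1 => // n /= n0n.
  by rewrite /trunc asboolT ?subrr ?normc0 ?expr0n//; exact: (sub_cube n0n).
- by [].
- apply: ge0_integrable => //; last by move=> t; exact: sqr_ge0.
  by apply: measurable_funX; exact: measurable_cmod.
- move=> n t _; rewrite lee_fin ger0_norm ?sqr_ge0// ler_pXn2r ?nnegrE ?normc_ge0//.
  by rewrite /trunc; case: ifP => _; rewrite ?subrr ?normc0 ?normc_ge0// subr0.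
Qed.

Lemma sqnorm_trunc_sub m n x : cmeas x -> (m <= n)%N ->
  (sqnorm mu (fun t => trunc n x t - trunc m x t)%R <= sqnorm mu (fun t => x t - trunc m x t)%R)%E.
Proof.
move=> mx mn; apply: le_sqnorm.
- by apply: cmeasB; exact: cmeas_trunc.
- by apply: cmeasB => //; exact: cmeas_trunc.
move=> t; rewrite /trunc; case: asboolP => [cn|ncn]; case: asboolP => [cm|ncm] //.
  by case: ncn; exact: (sub_cube mn).
by rewrite subr0 normc0 normc_ge0.
Qed.

(** The bound, the tail of [x] outside the smaller cube, depends on [m] alone, as [riesz_fischer]
    requires. *)
Lemma sqnorm_fourier_cube_sub m n x : cmeas x -> (sqnorm mu x < +oo)%E -> (m <= n)%N ->
  (sqnorm mu (fun u => fourier_cube n x u - fourier_cube m x u)%R <=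
   sqnorm mu (fun t => x t - trunc m x t)%R)%E.
Proof.
move=> mx x2 mn; have cn := cube_L2_trunc n mx x2; have cm := cube_L2W mn (cube_L2_trunc m mx x2).
rewrite !fourier_cubeE; apply: le_trans (sqnorm_trunc_sub mx mn).
rewrite -(sqnorm_cft (cube_L2_sub cn cm)).
by rewrite le_eqVlt; apply/orP; left; apply/eqP; apply: eq_integral => u _; rewrite (cft_sub _ cn cm).
Qed.

Lemma fourier_cube_cvg x : cmeas x -> (sqnorm mu x < +oo)%E ->
  exists y, [/\ cmeas y, (sqnorm mu y < +oo)%E &
    (fun n => L2n mu (fun u => fourier_cube n x u - y u)) @ \oo --> 0%E].
Proof.
move=> mx x2.
have mt n : cmeas (trunc n x) by exact: cmeas_trunc.
have mf n : cmeas (fourier_cube n x) by rewrite fourier_cubeE; exact: cmeas_cft.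
have f2 n : (sqnorm mu (fourier_cube n x) < +oo)%E.
  by rewrite fourier_cubeE (sqnorm_cft (cube_L2_trunc n mx x2)); have [] := cube_L2_trunc n mx x2.
have efin n : sqnorm mu (fun t => x t - trunc n x t) \is a fin_num.
  rewrite ge0_fin_numE ?sqnorm_ge0//; apply: sqnormB_lty => //.
  by have [] := cube_L2_trunc n mx x2.
pose e n := fine (sqnorm mu (fun t => x t - trunc n x t)).
have e0 : e @ \oo --> (0 : R) by apply: fine_cvg; exact: sqnorm_trunc_cvg.
have cau m n : (m <= n)%N -> (sqnorm mu (fun u => fourier_cube n x u - fourier_cube m x u)%R <= (e m)%:E)%E.
  by move=> mn; rewrite /e fineK//; exact: sqnorm_fourier_cube_sub.
have mB m n : cmeas (fun u => fourier_cube n x u - fourier_cube m x u) by exact: cmeasB.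
have [n|m n mn|g mg g2] := @riesz_fischer _ _ _ mu (fun n u => Re (fourier_cube n x u)) e _ _ e0.
- by have [] := mf n.
- apply: le_trans (cau _ _ mn); apply: le_trans (sqnorm_ReIm mu (mB m n)).1.
  rewrite le_eqVlt; apply/orP; left; apply/eqP; apply: eq_integral => u _.
  by case: (fourier_cube n x u); case: (fourier_cube m x u).
have [n|m n mn|h mh h2] := @riesz_fischer _ _ _ mu (fun n u => Im (fourier_cube n x u)) e _ _ e0.
- by have [] := mf n.
- apply: le_trans (cau _ _ mn); apply: le_trans (sqnorm_ReIm mu (mB m n)).2.
  rewrite le_eqVlt; apply/orP; left; apply/eqP; apply: eq_integral => u _.
  by case: (fourier_cube n x u); case: (fourier_cube m x u).
have my : cmeas (fun u => g u +i* h u) by split.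
have hle n : (sqnorm mu (fun u => fourier_cube n x u - (g u +i* h u))%R <= (e n + e n)%:E)%E.
  rewrite sqnorm_pair ?EFinD; last exact: cmeasB.
  apply: leeD; [apply: le_trans (g2 n)|apply: le_trans (h2 n)]; rewrite le_eqVlt; apply/orP; left; apply/eqP; apply: eq_integral => u _.
    by case: (fourier_cube n x u).
  by case: (fourier_cube n x u).
exists (fun u => g u +i* h u); split => //.
  (* The limit is square integrable as the difference of one member of the sequence and its distance
     to the limit. *)
  rewrite (_ : sqnorm _ _ = sqnorm mu (fun u => fourier_cube 0 x u - (fourier_cube 0 x u - (g u +i* h u)))); last first.
    by apply: eq_integral => u _; rewrite opprB addrC subrK.
  apply: sqnormB_lty => //; first exact: cmeasB.
  by apply: le_lt_trans (hle 0%N) _; rewrite ltry.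
apply: L2n_cvg0; apply: cvge0_near => [n|c c0]; first exact: sqnorm_ge0.
have c2 : 0 < c / 2 by rewrite divr_gt0.
have /cvgrPdist_le/(_ _ c2) := e0; apply: filterS => n; rewrite sub0r normrN => en.
apply: (le_trans (hle n)); rewrite lee_fin.
by have := ler_norm (e n); lra.
Qed.
End PlancherelLimit.

Lemma cvge0_leD (R : realType) (u v w : nat -> \bar R) : (forall n, 0 <= w n)%E ->
  (forall n, w n <= u n + v n)%E -> u @ \oo --> 0%E -> v @ \oo --> 0%E -> w @ \oo --> 0%E.
Proof.
move=> w0 wuv u0 v0; apply: cvge0_near => // c c0; have c2 : 0 < c / 2 by rewrite divr_gt0.
near=> n; apply: (le_trans (wuv n)); rewrite [c]splitr EFinD; apply: leeD.
  by near: n; exact: cvge0_nearP u0 c2.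
by near: n; exact: cvge0_nearP v0 c2.
Unshelve. all: by end_near. Qed.

Section L2limits.
Context d (T : measurableType d) (R : realType) (mu : {measure set T -> \bar R}).
Implicit Types (x y z : T -> R[i]) (f : nat -> T -> R[i]).

Lemma ae_eq_sqnorm x y : cmeas x -> cmeas y -> {ae mu, forall t, x t = y t} ->
  sqnorm mu x = sqnorm mu y.
Proof.
move=> mx my xy; apply: ge0_ae_eq_integral => //.
- by apply/measurable_EFinP; apply: measurable_funX; exact: measurable_cmod.
- by apply/measurable_EFinP; apply: measurable_funX; exact: measurable_cmod.
- by move=> t _; rewrite lee_fin sqr_ge0.
- by move=> t _; rewrite lee_fin sqr_ge0.
- by apply: filterS xy => t -> _.
Qed.

Lemma le_L2n_sub x y z : cmeas x -> cmeas y -> cmeas z ->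
  (L2n mu (fun t => x t - z t)%R <= L2n mu (fun t => x t - y t)%R + L2n mu (fun t => y t - z t)%R)%E.
Proof.
move=> mx my mz; apply: le_trans (le_L2nD mu (cmeasB mx my) (cmeasB my mz)).
by rewrite le_eqVlt; apply/orP; left; apply/eqP; apply: eq_L2n => t; rewrite addrA subrK.
Qed.

Lemma L2_cvg_unique f x y : (forall n, cmeas (f n)) -> cmeas x -> cmeas y ->
  (fun n => L2n mu (fun t => f n t - x t)) @ \oo --> 0%E ->
  (fun n => L2n mu (fun t => f n t - y t)) @ \oo --> 0%E ->
  {ae mu, forall t, x t = y t}.
Proof.
move=> mf mx my fx fy; apply: sqnorm_eq0 => //.
have : (fun n : nat => L2n mu (fun t => x t - y t)) @ \oo --> 0%E.
  apply: (cvge0_leD _ _ fx fy) => n; first exact: L2n_ge0.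
  by rewrite (L2n_subC mu (f n) x); exact: le_L2n_sub.
move=> h0; have h := cvg_unique (@ereal_hausdorff R) h0 (@cvg_cst _ (L2n mu (fun t => x t - y t)) _ _ _).
apply/eqP; rewrite eq_le sqnorm_ge0 andbT.
by have := L2n_le mu (fun t => x t - y t) (lexx (0 : R)); rewrite -h lexx expr0n => /esym.
Qed.

(** Squeezed by the two triangle inequalities; norms are treated as distances to the zero
    function. *)
Lemma L2_cvg_norm f x : (forall n, cmeas (f n)) -> cmeas x -> (sqnorm mu x < +oo)%E ->
  (fun n => L2n mu (fun t => f n t - x t)) @ \oo --> 0%E ->
  (fun n => L2n mu (f n)) @ \oo --> L2n mu x.
Proof.
move=> mf mx x2 fx.
have xfin : L2n mu x \is a fin_num by rewrite ge0_fin_numE ?L2n_ge0// L2n_lty.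
have sub0 z : L2n mu (fun t => z t - 0) = L2n mu z by apply: eq_L2n => t; rewrite subr0.
have m0 : cmeas (fun _ : T => 0 : R[i]) by split; exact: measurable_cst.
apply: (@squeeze_cvge _ _ _ _ (fun n => L2n mu x - L2n mu (fun t => f n t - x t)%R)%E _
  (fun n => L2n mu x + L2n mu (fun t => f n t - x t)%R)%E).
- near=> n; apply/andP; split.
    rewrite leeBlDr; last first.
      rewrite ge0_fin_numE ?L2n_ge0//; apply: (@le_lt_trans _ _ 1%E); last exact: ltry.
      by near: n; exact: cvge0_nearP fx ltr01.
    have := le_L2n_sub mx (mf n) m0; rewrite !sub0 L2n_subC => h; apply: (le_trans h).
    by rewrite addeC.
  have := le_L2n_sub (mf n) mx m0; rewrite !sub0 => h; apply: (le_trans h).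
  by rewrite addeC.
- rewrite -[X in _ --> X]sube0; apply: cvgeB => //; first by rewrite fin_num_adde_defr.
  exact: cvg_cst.
- rewrite -[X in _ --> X]adde0; apply: cvgeD => //; first by rewrite fin_num_adde_defr.
  exact: cvg_cst.
Unshelve. all: by end_near. Qed.
End L2limits.

(** * The Fourier-Plancherel transform and its inverse *)

Section FourierPlancherel.
Context (R : realType) (d : nat).
Notation mu := (lebd R d).
Notation V := (d.-tuple R).
Implicit Types x y z w : V -> R[i].

Lemma L2normE x : L2norm x = L2n mu x.
Proof. by rewrite /L2norm /L2n unlock; congr (poweR _ _). Qed.

Lemma L2P x : L2 x <-> cmeas x /\ (sqnorm mu x < +oo)%E.
Proof.
split=> [[mr mi x2]|[[mr mi] x2]].
  by split => //; rewrite -L2n_lty -L2normE.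
by split => //; rewrite L2normE L2n_lty.
Qed.

(** The limit exists on L2, so the choice made in [fourier] is a true limit and not the default
    value. *)
Lemma fourier_spec x : L2 x -> L2 (fourier x) /\
  (fun n => L2n mu (fun u => fourier_cube n x u - fourier x u)) @ \oo --> 0%E.
Proof.
move=> /L2P[mx x2]; have [y [my y2 cv]] := fourier_cube_cvg mx x2.
have e (z : V -> R[i]) : (fun n => L2norm (fun u => fourier_cube n x u - z u)) =
    (fun n => L2n mu (fun u => fourier_cube n x u - z u)).
  by apply/funext => n; rewrite L2normE.
rewrite -e; apply: (@xgetPex _ (fun=> 0) [set y | L2 y /\
    (fun n => L2norm (fun u => fourier_cube n x u - y u)) @ \oo --> 0%E]).
by exists y; split; [apply/L2P|rewrite e].
Qed.

Lemma cmeas_fourier_cube n x : cmeas x -> cmeas (fourier_cube n x).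
Proof. by move=> mx; rewrite fourier_cubeE; apply: cmeas_cft; exact: cmeas_trunc. Qed.

Lemma L2n_fourier_cube n x : L2 x -> L2n mu (fourier_cube n x) = L2n mu (trunc n x).
Proof.
by move=> /L2P[mx x2]; rewrite !L2nE fourier_cubeE (sqnorm_cft (cube_L2_trunc n mx x2)).
Qed.

Lemma L2n_trunc_cvg x : L2 x -> (fun n => L2n mu (fun t => trunc n x t - x t)) @ \oo --> 0%E.
Proof.
move=> /L2P[mx x2].
rewrite (_ : (fun n => _) = (fun n => L2n mu (fun t => x t - trunc n x t))); last first.
  by apply/funext => n; rewrite L2n_subC.
by apply: L2n_cvg0; exact: sqnorm_trunc_cvg.
Qed.

(** The norms of [fourier_cube n x] and [trunc n x] agree for each n, and so do their limits. *)
Lemma L2norm_fourier x : L2 x -> L2norm (fourier x) = L2norm x.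
Proof.
move=> Lx; have [Lf cf] := fourier_spec Lx.
have /L2P[mx x2] := Lx; have /L2P[mf f2] := Lf.
have h1 := L2_cvg_norm (fun n => cmeas_fourier_cube n mx) mf f2 cf.
have h2 := L2_cvg_norm (fun n => cmeas_trunc n mx) mx x2 (L2n_trunc_cvg Lx).
have e : (fun n => L2n mu (fourier_cube n x)) = (fun n => L2n mu (trunc n x)).
  by apply/funext => n; exact: L2n_fourier_cube.
rewrite !L2normE; rewrite e in h1; exact: (cvg_unique (@ereal_hausdorff R) h1 h2).
Qed.

(* The witness is the conjugate of the transform of the conjugate of [z]. By
   [sqnorm_cft_conj] no inversion formula is needed to check it. *)
Lemma fourier_surj z : L2 z ->
  exists y, L2 y /\ {ae mu, forall t, fourier y t = z t}.
Proof.
move=> Lz; have /L2P[mz z2] := Lz.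
have mzc : cmeas (cconj z) by exact: cmeas_conj.
have Lzc : L2 (cconj z) by apply/L2P; split => //; rewrite sqnorm_conj.
have [Lw cw] := fourier_spec Lzc; have /L2P[mw w2] := Lw.
pose y := cconj (fourier (cconj z)).
have my : cmeas y by exact: cmeas_conj.
have y2 : (sqnorm mu y < +oo)%E by rewrite sqnorm_conj.
have Ly : L2 y by apply/L2P.
exists y; split => //; have [Lf cf] := fourier_spec Ly; have /L2P[mf f2] := Lf.
have mfy n : cmeas (fourier_cube n y) by exact: cmeas_fourier_cube.
have mfz n : cmeas (cconj (fourier_cube n (cconj z))) by apply: cmeas_conj; exact: cmeas_fourier_cube.
apply: (L2_cvg_unique mfy mf mz cf).
(* The identity for the truncations of [y] and of the conjugate of [z]; both functions on the right
   tend to [y]. *)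
have key n : L2n mu (fun u => fourier_cube n y u - trunc n z u) =
    L2n mu (fun t => trunc n y t - cconj (fourier_cube n (cconj z)) t).
  have cy := cube_L2_trunc n my y2.
  have cz : cube_L2 n (trunc n (cconj z)) by apply: cube_L2_trunc => //; rewrite sqnorm_conj.
  rewrite !L2nE !fourier_cubeE -(sqnorm_cft_conj cy cz); congr (poweR (sqnorm _ _) _).
  apply/funext => u; congr (_ - _); rewrite /cconj /trunc; case: ifP => _; last by rewrite conjc0.
  by rewrite conjcK.
have h : (fun n => L2n mu (fun u => fourier_cube n y u - trunc n z u)) @ \oo --> 0%E.
  apply: (cvge0_leD _ _ (L2n_trunc_cvg Ly) cw) => n; first exact: L2n_ge0.
  rewrite key; apply: le_trans (le_L2n_sub mu (cmeas_trunc n my) my (mfz n)) _; apply: leeD => //.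
  rewrite L2n_subC -(L2n_conj mu (fun u => fourier_cube n _ u - _)) le_eqVlt; apply/orP; left; apply/eqP.
  by apply: eq_L2n => t; rewrite /y /cconj rmorphB.
apply: (cvge0_leD _ _ h (L2n_trunc_cvg Lz)) => n; first exact: L2n_ge0.
by apply: le_L2n_sub => //; exact: cmeas_trunc.
Qed.

Lemma inv_fourier_spec z : L2 z ->
  L2 (inv_fourier z) /\ {ae mu, forall t, fourier (inv_fourier z) t = z t}.
Proof.
move=> Lz; apply: (@xgetPex _ (fun=> 0) [set y | L2 y /\
  {ae lebesgue_Rd R d, forall t, fourier y t = z t}]).
by have [y [Ly h]] := fourier_surj Lz; exists y.
Qed.

Lemma L2norm_inv_fourier z : L2 z -> L2norm (inv_fourier z) = L2norm z.
Proof.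
move=> Lz; have [Li h] := inv_fourier_spec Lz; rewrite -(L2norm_fourier Li).
have [Lf _] := fourier_spec Li; have /L2P[mf f2] := Lf; have /L2P[mz z2] := Lz.
have e : L2n mu (fourier (inv_fourier z)) = L2n mu z by rewrite !L2nE (ae_eq_sqnorm mf mz h).
by rewrite !L2normE.
Qed.
End FourierPlancherel.

(** * Interpolation and sharpness *)

Section WeightedHoelder.
Variable R : realType.

(** Pólya's proof of the weighted inequality of means: a_j / S <= exp (a_j / S - 1), and the
    weighted exponents sum to 0 because S is the weighted mean. *)
Lemma sum_ge_powR_prod m (lam a : 'I_m.+1 -> R) : (forall j, 0 < lam j) -> \sum_j lam j = 1 ->
  (forall j, 0 <= a j) -> \prod_j a j `^ lam j <= \sum_j lam j * a j.
Proof.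
move=> l0 l1 a0; set S := \sum_j _.
have S0 : 0 <= S by apply: sumr_ge0 => j _; rewrite mulr_ge0// ltW.
have [Sz|Sn] := eqVneq S 0.
  have a00 j : a j = 0.
    have /eqP := Sz; rewrite psumr_eq0 => [/allP/(_ j (mem_index_enum j))|i _]; last by rewrite mulr_ge0// ltW.
    by rewrite mulf_eq0 gt_eqF//= => /eqP.
  by rewrite (bigD1 ord0)//= a00 powR0 ?mul0r// gt_eqF.
have Sp : 0 < S by rewrite lt_neqAle eq_sym Sn.
have aj j : a j `^ lam j <= S `^ lam j * expR (lam j * (a j / S - 1)).
  rewrite [lam j * _]mulrC expRM -powRM ?expR_ge0//.
  apply: ge0_ler_powR; rewrite ?nnegrE ?mulr_ge0 ?expR_ge0//; first exact: ltW.
  rewrite -ler_pdivrMl// mulrC; have := expR_ge1Dx (a j / S - 1); lra.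
apply: (@le_trans _ _ (\prod_j (S `^ lam j * expR (lam j * (a j / S - 1))))).
  by apply: ler_prod => j _; rewrite powR_ge0/=.
rewrite big_split/= -expR_sum.
have -> : \sum_j lam j * (a j / S - 1) = 0.
  under eq_bigr do rewrite mulrBr mulrA mulr1.
  by rewrite sumrB -mulr_suml l1 -/S divff// subrr.
rewrite expR0 mulr1 (_ : S = expR (ln S)); last by rewrite lnK// posrE.
under eq_bigr do rewrite -expRM mulrC.
by rewrite -expR_sum -mulr_suml l1 mul1r.
Qed.

(** Hölder's inequality for several functions: each is divided by its integral, and the inequality
    of means is integrated. *)
Lemma integral_prod_powR_le d (T : measurableType d) (mu : {measure set T -> \bar R}) m
    (lam A : 'I_m.+1 -> R) (f : 'I_m.+1 -> T -> R) :
  (forall j, 0 < lam j) -> \sum_j lam j = 1 ->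
  (forall j, measurable_fun setT (f j)) -> (forall j t, 0 <= f j t) ->
  (forall j, \int[mu]_t (f j t)%:E = (A j)%:E)%E ->
  (\int[mu]_t (\prod_j f j t `^ lam j)%:E <= (\prod_j A j `^ lam j)%:E)%E.
Proof.
move=> l0 l1 mf f0 fA.
have mp : measurable_fun setT (fun t => (\prod_j f j t `^ lam j)%:E).
  apply/measurable_EFinP; apply: measurable_prod => j _.
  exact: (measurableT_comp (measurable_powR (lam j)) (mf j)).
have A0 j : 0 <= A j by rewrite -lee_fin -fA; apply: integral_ge0 => t _; rewrite lee_fin.
(* If A j = 0, normalisation is impossible, but [f j] and hence the product vanish almost
   everywhere. *)
have [[j Aj]|An] := pselect (exists j, A j = 0).
  rewrite (_ : integral _ _ _ = 0%E); first by rewrite lee_fin prodr_ge0// => i _; exact: powR_ge0.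
  have : (\int[mu]_t `|(f j t)%:E| = 0)%E.
    transitivity (A j)%:E; last by rewrite Aj.
    by rewrite -fA; apply: eq_integral => t _; rewrite gee0_abs// lee_fin.
  move=> /(ae_eq_integral_abs mu measurableT _).1.
  have mfj : measurable_fun setT (fun t => (f j t)%:E) by apply/measurable_EFinP.
  move=> /(_ mfj) fj0.
  rewrite -(integral0 mu setT); apply: ge0_ae_eq_integral => //.
    by move=> t _; rewrite lee_fin prodr_ge0// => i _; exact: powR_ge0.
  apply: filterS fj0 => t /(_ I) /= [] ft _.
  by rewrite (bigD1 j)//= ft powR0 ?mul0r// gt_eqF.
have Ap j : 0 < A j.
  by rewrite lt_neqAle A0 andbT; apply/eqP => Aj; apply: An; exists j.
have nn j t : (0 <= (lam j / A j)%:E * (f j t)%:E)%E by rewrite -EFinM lee_fin mulr_ge0// divr_ge0// ltW.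
have mj j : measurable_fun setT (fun t => ((lam j / A j)%:E * (f j t)%:E)%E).
  by apply/measurable_EFinP; exact: measurable_funM.
pose P := \prod_j A j `^ lam j.
have P0 : 0 <= P by apply: prodr_ge0 => j _; exact: powR_ge0.
apply: (@le_trans _ _ (\int[mu]_t (P%:E * \sum_j (lam j / A j)%:E * (f j t)%:E))%E).
  apply: ge0_le_integral => //.
  - by move=> t _; rewrite lee_fin prodr_ge0// => i _; exact: powR_ge0.
  - by apply: emeasurable_funM => //; exact: emeasurable_sum.
  move=> t _.
  have -> : (\sum_j (lam j / A j)%:E * (f j t)%:E = (\sum_j lam j / A j * f j t)%:E)%E.
    by rewrite -sumEFin; apply: eq_bigr => j _; rewrite EFinM.
  rewrite -EFinM lee_fin.
  have -> : \prod_j f j t `^ lam j = P * \prod_j (f j t / A j) `^ lam j.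
    rewrite -big_split/=; apply: eq_bigr => j _; rewrite -powRM ?divr_ge0//.
    by rewrite mulrC divfK// gt_eqF.
  apply: ler_wpM2l => //; apply: (le_trans (sum_ge_powR_prod l0 l1 _)) => [j|]; first by rewrite divr_ge0.
  by apply: ler_sum => j _; rewrite [_ / A j]mulrC mulrA.
rewrite ge0_integralZl//; last first.
- by move=> t _; exact: sume_ge0.
- exact: emeasurable_sum.
rewrite ge0_integral_sum//.
rewrite (eq_bigr (fun j => (lam j)%:E)) => [|j _]; last first.
  rewrite ge0_integralZl_EFin//; last first.
  - by rewrite divr_ge0// ltW.
  - exact/measurable_EFinP.
  - by move=> t _; rewrite lee_fin.
  by rewrite fA -EFinM divfK// gt_eqF.
by rewrite sumEFin l1 mule1.
Qed.
End WeightedHoelder.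

(** * Moduli of the multipliers and membership in L^k *)

Section Multipliers.
Variable R : realType.

Lemma measurable_sgr : measurable_fun setT (Num.sg : R -> R).
Proof.
rewrite (_ : Num.sg = (fun a => \1_(`]0, +oo[%classic : set R) a - \1_(`]-oo, 0[%classic : set R) a)).
  by apply: measurable_funB; apply: measurable_indic.
apply/funext => a; rewrite !indicE.
have -> : (a \in `]0, +oo[%classic) = (0 < a).
  by apply/idP/idP; rewrite inE/= in_itv/= andbT.
have -> : (a \in `]-oo, 0[%classic) = (a < 0).
  by apply/idP/idP; rewrite inE/= in_itv.
by case: sgrP => h; rewrite ?ltxx ?h ?(lt_gtF h) ?subr0 ?sub0r//.
Qed.

Lemma normc_ipow (a b : R) : cmod (ipow a b) = `|2 * pi * a| `^ b.
Proof.
rewrite /ipow Normc.normcM /expi /= expr0n addr0 sqrtr_sqr ger0_norm ?powR_ge0//.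
by rewrite cos2Dsin2 sqrtr1 mulr1.
Qed.

Lemma cmeasM d (T : measurableType d) (x y : T -> R[i]) :
  cmeas x -> cmeas y -> cmeas (fun t => x t * y t).
Proof.
move=> [a b] [a' b']; split.
  rewrite (_ : (fun t => _) = (fun t => complex.Re (x t) * complex.Re (y t) - complex.Im (x t) * complex.Im (y t))).
    by apply: measurable_funB; exact: measurable_funM.
  by apply/funext => t; case: (x t); case: (y t).
rewrite (_ : (fun t => _) = (fun t => complex.Re (x t) * complex.Im (y t) + complex.Im (x t) * complex.Re (y t))).
  by apply: measurable_funD; exact: measurable_funM.
by apply/funext => t; case: (x t); case: (y t).
Qed.

Lemma cmeas_prod d (T : measurableType d) (I : Type) (s : seq I) (x : I -> T -> R[i]) :
  (forall i, cmeas (x i)) -> cmeas (fun t => \prod_(i <- s) x i t).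
Proof.
move=> mx; elim: s => [|i s ih].
  rewrite (_ : (fun t => _) = (fun _ => 1)); last by apply/funext => t; rewrite big_nil.
  by split; exact: measurable_cst.
rewrite (_ : (fun t => _) = (fun t => x i t * \prod_(i <- s) x i t)); first exact: cmeasM.
by apply/funext => t; rewrite big_cons.
Qed.

Variable d : nat.
Notation mu := (lebd R d).
Notation V := (d.-tuple R).

Lemma cmeas_ipow (i : 'I_d) (b : R) : cmeas (fun t : V => ipow (tnth t i) b).
Proof.
have mi : measurable_fun setT (fun t : V => tnth t i) by exact: measurable_tnth.
apply: cmeasM; split => /=; try exact: measurable_cst.
- apply: (measurableT_comp (measurable_powR b)); apply: measurableT_comp => //.
  exact: measurable_funM.
- apply: measurable_fun_cos; apply: measurable_funM => //; apply: measurable_funM => //.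
  exact: (measurableT_comp measurable_sgr mi).
- apply: measurable_fun_sin; apply: measurable_funM => //; apply: measurable_funM => //.
  exact: (measurableT_comp measurable_sgr mi).
Qed.

Lemma cmeas_Emul (k : 'rV[R]_d) (f : V -> R[i]) : cmeas f -> cmeas (Emul k f).
Proof. by move=> mf; apply: cmeasM => //; apply: cmeas_prod => i; exact: cmeas_ipow. Qed.

Lemma normc_Emul (k : 'rV[R]_d) (f : V -> R[i]) t :
  cmod (Emul k f t) = (\prod_i `|2 * pi * tnth t i| `^ (k 0 i)) * cmod (f t).
Proof.
rewrite /Emul Normc.normcM; congr (_ * _).
elim: (index_enum _) => [|i s ih]; first by rewrite !big_nil Normc.normc1.
by rewrite !big_cons Normc.normcM ih normc_ipow.
Qed.

(** Valid at every t: where a coordinate is 0, both sides have the factor 1 if the exponent is 0,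
    and 0 otherwise. *)
Lemma sqr_normc_Emul (k : 'rV[R]_d) (f : V -> R[i]) t :
  cmod (Emul k f t) ^+ 2 = (2 * pi) `^ (\sum_(i < d) 2 * k 0 i) *
    ((\prod_(i < d) `|tnth t i| `^ (2 * k 0 i)) * cmod (f t) ^+ 2).
Proof.
have p0 : 0 < 2 * pi :> R by rewrite mulr_gt0// pi_gt0.
rewrite normc_Emul exprMn mulrA; congr (_ * _).
rewrite [in RHS](_ : 2 * pi = expR (ln (2 * pi))); last by rewrite lnK// posrE.
rewrite -expRM mulr_sumr expR_sum -big_split/= -prodrXl; apply: eq_bigr => i _.
rewrite expRM lnK ?posrE// -powR_mulrn ?powR_ge0// -powRrM [k 0 i * _]mulrC.
by rewrite normrM (gtr0_norm p0) (powRM _ (ltW p0)).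
Qed.

Lemma Lknorm_sqE (k : 'rV[R]_d) (x : V -> R[i]) : L2 x ->
  Lknorm_sq k x = sqnorm mu (Emul k (fourier x)).
Proof.
move=> Lx; have [/L2P[mf _] _] := fourier_spec Lx.
rewrite /Lknorm_sq -ge0_integralZl//.
- by apply: eq_integral => t _; rewrite sqr_normc_Emul.
- apply/measurable_EFinP; apply: measurable_funM; last by apply: measurable_funX; exact: measurable_cmod.
  apply: measurable_prod => i _; apply: (measurableT_comp (measurable_powR _)).
  by apply: measurableT_comp => //; exact: measurable_tnth.
- by move=> t _; rewrite lee_fin mulr_ge0 ?sqr_ge0// prodr_ge0// => i _; exact: powR_ge0.
- by rewrite lee_fin powR_ge0.
Qed.

(** Puts membership into the form under which the inverse transform is isometric. *)
Lemma LkP (k : 'rV[R]_d) (x : V -> R[i]) : Lk k x <-> L2 x /\ L2 (Emul k (fourier x)).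
Proof.
split=> [[Lx]|[Lx] /L2P[_ e2]]; last by split => //; rewrite Lknorm_sqE.
rewrite Lknorm_sqE// => e2; split => //; apply/L2P; split => //; apply: cmeas_Emul.
by have [/L2P[]] := fourier_spec Lx.
Qed.

Lemma L2norm_Dder (k : 'rV[R]_d) (x : V -> R[i]) : Lk k x ->
  L2norm (Dder k x) = poweR (sqnorm mu (Emul k (fourier x))) 2^-1.
Proof. by move=> /LkP[Lx Le]; rewrite /Dder L2norm_inv_fourier// L2normE L2nE. Qed.

Lemma ae_tnth_neq0 : {ae mu, forall t : V, forall i, tnth t i != 0}.
Proof.
apply: filter_forall => i; exists [set t | tnth t i = 0]; split.
- rewrite (_ : mkset _ = (fun t : V => tnth t i) @^-1` [set 0]) // -[X in measurable X]setTI.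
  exact: (measurable_tnth i).
- exact: hyperplane_null.
- by move=> t /= /negP; rewrite negbK => /eqP.
Qed.

(** Logarithm of the modulus of the multiplier, off the coordinate hyperplanes. It is linear in [k],
    so a convex combination of exponents becomes a product of powers. *)
Definition lnw (k : 'rV[R]_d) (t : V) : R := \sum_i k 0 i * ln `|2 * pi * tnth t i|.

Lemma normc_Emul_expR (k : 'rV[R]_d) (f : V -> R[i]) t : (forall i, tnth t i != 0) ->
  cmod (Emul k f t) = expR (lnw k t) * cmod (f t).
Proof.
move=> t0; rewrite normc_Emul /lnw expR_sum; congr (_ * _); apply: eq_bigr => i _.
rewrite [RHS](_ : _ = expR (ln `|2 * pi * tnth t i| * k 0 i)); last by rewrite mulrC.
rewrite expRM lnK// posrE normr_gt0 !mulf_neq0//.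
by rewrite gt_eqF// pi_gt0.
Qed.

Lemma lnw_sum m (lam : 'I_m -> R) (r : 'I_m -> 'rV[R]_d) t :
  lnw (\sum_j lam j *: r j) t = \sum_j lam j * lnw (r j) t.
Proof.
rewrite /lnw; under [RHS]eq_bigr do rewrite mulr_sumr.
rewrite exchange_big/=; apply: eq_bigr => i _.
by rewrite summxE mulr_suml; apply: eq_bigr => j _; rewrite mxE mulrA.
Qed.

End Multipliers.

Section Interpolation.
Variables (R : realType) (d m : nat) (lam : 'I_m.+1 -> R).
Hypotheses (lam_gt0 : forall j, 0 < lam j) (lam_sum : \sum_j lam j = 1).
Notation mu := (lebd R d).
Notation V := (d.-tuple R).

(** The multiplier splits since [lnw] is linear, and |f| since the weights sum to 1. The condition
    on [t] matters: where a coordinate is 0, its exponent in the combination may be 0, with factor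
    1, although the single exponents give 0. *)
Lemma normc_Emul_prod (r : 'I_m.+1 -> 'rV[R]_d) (f : V -> R[i]) t :
  (forall i, tnth t i != 0) ->
  cmod (Emul (\sum_j lam j *: r j) f t) ^+ 2 = \prod_j (cmod (Emul (r j) f t) ^+ 2) `^ lam j.
Proof.
(* A zero of [f] has no logarithm; there both sides are 0, because the weights are positive. *)
move=> t0; have [c0|cn] := eqVneq (cmod (f t)) 0.
  by rewrite normc_Emul_expR// c0 mulr0 (bigD1 ord0)//= normc_Emul_expR// c0 mulr0 expr0n powR0 ?mul0r// gt_eqF.
have cE : cmod (f t) = expR (ln (cmod (f t))).
  by rewrite lnK// posrE lt_neqAle eq_sym cn normc_ge0.
rewrite normc_Emul_expR// cE; set g := ln _.
transitivity (\prod_j expR (2 * (lnw (r j) t + g) * lam j)); last first.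
  apply: eq_bigr => j _; rewrite normc_Emul_expR// cE -/g -expRD -expRM_natl expRM.
  by rewrite mulrC.
rewrite -expR_sum -expRD -expRM_natl; congr expR; rewrite lnw_sum.
rewrite -[in LHS](mulr1 g) -lam_sum mulr_sumr -big_split/= mulr_sumr.
by apply: eq_bigr => j _; ring.
Qed.

(** Hölder's inequality for the squared moduli. Finiteness of its right-hand side also puts [x] into
    L^k, so that [Dder] is a genuine inverse transform there. *)
Lemma Lk_interp (r : 'I_m.+1 -> 'rV[R]_d) (x : V -> R[i]) : (forall j, Lk (r j) x) ->
  Lk (\sum_j lam j *: r j) x /\
  (L2norm (Dder (\sum_j lam j *: r j) x) <= \prod_j poweR (L2norm (Dder (r j) x)) (lam j))%E.
Proof.
move=> Lr; have [Lx _] := (LkP (r ord0) x).1 (Lr ord0).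
have [/L2P[mf _] _] := fourier_spec Lx; set f := fourier x in mf.
have mE q : cmeas (Emul q f) by exact: cmeas_Emul.
pose A j := fine (sqnorm mu (Emul (r j) f)).
have AE j : (sqnorm mu (Emul (r j) f) = (A j)%:E)%E.
  rewrite /A fineK// ge0_fin_numE ?sqnorm_ge0//.
  by have /LkP[_ /L2P[]] := Lr j.
have A0 j : 0 <= A j by rewrite -lee_fin -AE sqnorm_ge0.
have mn q : measurable_fun setT (fun t => cmod (Emul q f t) ^+ 2).
  by apply: measurable_funX; exact: measurable_cmod.
have key : (sqnorm mu (Emul (\sum_j lam j *: r j) f) <= (\prod_j A j `^ lam j)%:E)%E.
  apply: le_trans (integral_prod_powR_le lam_gt0 lam_sum (fun j => mn (r j)) _ AE); last first.
    by move=> j t; exact: sqr_ge0.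
  rewrite le_eqVlt; apply/orP; left; apply/eqP.
  apply: ge0_ae_eq_integral => //.
  - exact/measurable_EFinP.
  - apply/measurable_EFinP; apply: measurable_prod => j _.
    exact: (measurableT_comp (measurable_powR (lam j)) (mn (r j))).
  - by move=> t _; rewrite lee_fin sqr_ge0.
  - by move=> t _; rewrite lee_fin prodr_ge0// => j _; exact: powR_ge0.
  - by apply: filterS (@ae_tnth_neq0 R d) => t t0 _; rewrite normc_Emul_prod.
have Lk' : Lk (\sum_j lam j *: r j) x.
  by apply/LkP; split => //; apply/L2P; split => //; apply: (le_lt_trans key); rewrite ltry.
split => //; rewrite L2norm_Dder//.
have -> : (\prod_j poweR (L2norm (Dder (r j) x)) (lam j) = poweR (\prod_j A j `^ lam j)%:E 2^-1)%E.
  rewrite poweR_EFin; transitivity (\prod_j ((A j `^ lam j) `^ 2^-1)%:E)%E.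
    by apply: eq_bigr => j _; rewrite L2norm_Dder// AE !poweR_EFin -!powRrM mulrC.
  rewrite prodEFin; congr (_%:E).
  elim: (index_enum _) => [|i s ih]; first by rewrite !big_nil powR1.
  by rewrite !big_cons ih powRM ?powR_ge0// prodr_ge0// => j _; exact: powR_ge0.
apply: gt0_ler_poweR => //; rewrite ?invr_ge0// in_itv/= leey andbT ?sqnorm_ge0//.
by rewrite lee_fin prodr_ge0// => j _; exact: powR_ge0.
Qed.
End Interpolation.

(** * Nearly extremal functions and the sharp constant *)

Section Sharpness.
Variables (R : realType) (d : nat).
Notation mu := (lebd R d).
Notation V := (d.-tuple R).

Definition norm1 (k : 'rV[R]_d) : R := \sum_i `|k 0 i|.

(* The Fourier transform of [x] is the indicator of the cube
   [1 / (2 pi), e^delta / (2 pi)]^d, on which all multipliers are close to 1. *)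
Lemma near_extremal (delta : R) : 0 < delta ->
  exists (x : V -> R[i]) (v : R) (th : 'rV[R]_d -> R),
    [/\ 0 < v, forall k, Lk k x, forall k, L2norm (Dder k x) = (v * expR (th k))%:E &
        forall k, `|th k| <= delta * norm1 k].
Proof.
move=> de0; have p0 : 0 < 2 * pi :> R by rewrite mulr_gt0// pi_gt0.
(* On the box 1 <= 2 pi t_i <= e^delta, so every ln |2 pi t_i| lies in [0, delta]. *)
pose a : R := (2 * pi)^-1; pose b : R := expR delta / (2 * pi).
have a0 : 0 < a by rewrite invr_gt0.
have ab : a < b by rewrite /b -[ltLHS]mul1r ltr_pM2r ?invr_gt0// -[ltLHS]expR0 ltr_expR.
pose B : set V := box a b; pose g : V -> R[i] := fun t => (\1_B t : R)%:C.
have mB : measurable B by exact: measurable_box.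
have vB : (mu B = ((b - a) ^+ d)%:E)%E by exact: lebesgue_Rd_box.
have v0 : 0 < (b - a) ^+ d by rewrite exprn_gt0// subr_gt0.
have mg : cmeas g by split; [exact: measurable_indic|exact: measurable_cst].
have g2 t : cmod (g t) = \1_B t.
  by rewrite /g /= expr0n addr0 sqrtr_sqr ger0_norm// indicE ler0n.
have Lg : L2 g.
  apply/L2P; split => //; rewrite /sqnorm (_ : integral _ _ _ = mu B) ?vB ?ltry//.
  transitivity (\int[mu]_t (\1_B t)%:E)%E; last by rewrite integral_indic// setIT.
  by apply: eq_integral => t _; rewrite g2 indicE; case: (_ \in _); rewrite ?expr1n ?expr0n.
have [y [Ly fy]] := fourier_surj Lg.
have [/L2P[mf _] _] := fourier_spec Ly.
have lnB t i : B t -> 0 <= ln `|2 * pi * tnth t i| <= delta.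
  move=> /(_ i)/andP[at_ tb].
  have h1 : 1 <= 2 * pi * tnth t i by rewrite -ler_pdivrMl// mulr1.
  have h2 : 2 * pi * tnth t i <= expR delta by rewrite -ler_pdivlMl// mulrC.
  rewrite ger0_norm ?(le_trans _ h1)// ln_ge0//= -[leRHS]expRK ler_ln ?posrE ?expR_gt0//.
  exact: lt_le_trans h1.
have tB t : B t -> forall i, tnth t i != 0.
  by move=> Bt i; have /andP[h _] := Bt i; rewrite gt_eqF// (lt_le_trans a0).
have wB k t : B t -> `|lnw k t| <= delta * norm1 k.
  move=> Bt; apply: (le_trans (ler_norm_sum _ _ _)); rewrite /norm1 mulr_sumr; apply: ler_sum => i _.
  by rewrite normrM mulrC ler_wpM2r// ger0_norm; have /andP[] := lnB t i Bt.
have sE k : sqnorm mu (Emul k (fourier y)) = sqnorm mu (Emul k g).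
  apply: ae_eq_sqnorm; [exact: cmeas_Emul|exact: cmeas_Emul|].
  by apply: filterS fy => t ft; rewrite /Emul ft.
have mE k : measurable_fun setT (fun t => cmod (Emul k g t) ^+ 2).
  by apply: measurable_funX; apply: measurable_cmod; exact: cmeas_Emul.
have mc (c : R) : measurable_fun setT (fun t => (c%:E * (\1_B t)%:E)%E).
  by apply/measurable_EFinP; apply: measurable_funM => //; exact: measurable_indic.
have ic (c : R) : 0 <= c -> (\int[mu]_t (c%:E * (\1_B t)%:E) = (c * (b - a) ^+ d)%:E)%E.
  move=> c0; rewrite ge0_integralZl//.
  - by rewrite integral_indic// setIT EFinM; congr (_ * _)%E; exact: vB.
  - by apply/measurable_EFinP; exact: measurable_indic.
have lo k : ((expR (- (2 * (delta * norm1 k))) * (b - a) ^+ d)%:E <= sqnorm mu (Emul k g))%E.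
  rewrite -ic ?expR_ge0//; apply: ge0_le_integral => //.
    exact/measurable_EFinP.
  move=> t _; rewrite -EFinM lee_fin indicE; case: (boolP (t \in B)) => [/set_mem tb|_]; last first.
    by rewrite mulr0 sqr_ge0.
  rewrite normc_Emul_expR; last exact: tB.
  rewrite g2 indicE mem_set// !mulr1 -expRM_natl ler_expR.
  by have := wB k t tb; rewrite ler_norml => /andP[]; lra.
have hi k : (sqnorm mu (Emul k g) <= (expR (2 * (delta * norm1 k)) * (b - a) ^+ d)%:E)%E.
  rewrite -ic ?expR_ge0//; apply: ge0_le_integral => //.
  - by move=> t _; rewrite lee_fin sqr_ge0.
  - exact/measurable_EFinP.
  move=> t _; rewrite -EFinM lee_fin indicE; case: (boolP (t \in B)) => [/set_mem tb|tb]; last first.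
    by rewrite normc_Emul g2 indicE (negbTE tb) !mulr0 expr0n.
  rewrite normc_Emul_expR; last exact: tB.
  rewrite g2 indicE mem_set// !mulr1 -expRM_natl ler_expR.
  by have := wB k t tb; rewrite ler_norml => /andP[]; lra.
have Lky k : Lk k y.
  apply/LkP; split => //; apply/L2P; split; first exact: cmeas_Emul.
  by rewrite sE; apply: le_lt_trans (hi k) _; rewrite ltry.
(* The square root of the volume of the box, which is the norm of [g]. *)
pose v := expR (ln ((b - a) ^+ d) / 2).
pose S k := fine (sqnorm mu (Emul k g)).
have SE k : sqnorm mu (Emul k g) = (S k)%:E.
  by rewrite /S fineK// ge0_fin_numE ?sqnorm_ge0// (le_lt_trans (hi k))// ltry.
have Slo k : expR (- (2 * (delta * norm1 k)) + ln ((b - a) ^+ d)) <= S k.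
  by rewrite -lee_fin -SE expRD lnK.
have Shi k : S k <= expR (2 * (delta * norm1 k) + ln ((b - a) ^+ d)).
  by rewrite -lee_fin -SE expRD lnK.
have S0 k : 0 < S k by apply: lt_le_trans (Slo k); exact: expR_gt0.
(* [th k] is half the logarithm of the squared norm over the volume; the bounds [Slo] and [Shi]
   confine it to delta times [norm1 k]. *)
exists y, v, (fun k => (ln (S k) - ln ((b - a) ^+ d)) / 2); split => //.
- exact: expR_gt0.
- move=> k; rewrite L2norm_Dder// sE SE poweR_EFin -expRD -mulrDl addrC subrK.
  by rewrite expRM lnK// posrE.
move=> k; have lnS : S k = expR (ln (S k)) by rewrite lnK// posrE.
have h1 := Shi k; have h2 := Slo k; rewrite {1}lnS ler_expR in h1; rewrite lnS ler_expR in h2.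
by rewrite ler_norml; apply/andP; split; lra.
Qed.
End Sharpness.

(** On a nearly extremal function the common factor [v] cancels because the weights sum to 1. What
    remains is the exponential of a number at least - delta M, and exp x >= 1 + x gives 1 - delta M
    <= c for every delta > 0. *)
Lemma sharp_constant (R : realType) d m (r : 'I_m.+1 -> 'rV[R]_d) (lam : 'I_m.+1 -> R) (k : 'rV[R]_d) (c : R) :
  (forall j, 0 < lam j) -> \sum_j lam j = 1 ->
  (forall x : d.-tuple R -> R[i], (forall j, Lk (r j) x) ->
    (L2norm (Dder k x) <= c%:E * \prod_j poweR (L2norm (Dder (r j) x)) (lam j))%E) ->
  1 <= c.
Proof.
move=> l0 l1 H.
pose M := norm1 k + \sum_j lam j * norm1 (r j).
have n0 q : 0 <= norm1 q :> R by apply: sumr_ge0.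
have M0 : 0 <= M by rewrite addr_ge0// sumr_ge0// => j _; rewrite mulr_ge0// ltW.
have bound delta : 0 < delta -> 1 - delta * M <= c.
  move=> /(@near_extremal R d)[x [v [th [v0 Lx xE thb]]]].
  have := H x (fun j => Lx (r j)).
  have -> : (\prod_j poweR (L2norm (Dder (r j) x)) (lam j) = (v * expR (\sum_j lam j * th (r j)))%:E)%E.
    rewrite (eq_bigr (fun j => (v `^ lam j * expR (lam j * th (r j)))%:E)) => [|j _]; last first.
      by rewrite xE poweR_EFin powRM ?(ltW v0) ?expR_ge0// -expRM mulrC [lam j * _]mulrC mulrC.
    rewrite prodEFin big_split/= -expR_sum; congr (_ * _)%:E.
    rewrite [in RHS](_ : v = expR (ln v * 1)); last by rewrite mulr1 lnK.
    by rewrite -[in RHS]l1 mulr_sumr expR_sum; apply: eq_bigr => j _; rewrite expRM lnK.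
  rewrite xE -EFinM lee_fin mulrCA ler_pM2l// -ler_pdivrMr ?expR_gt0// -expRN -expRD.
  apply: le_trans; apply: le_trans (expR_ge1Dx _); rewrite lerD2l /M mulrDr opprD.
  have := thb k; rewrite ler_norml => /andP[hk _]; apply: lerD => //.
  rewrite lerN2 mulr_sumr; apply: ler_sum => j _; rewrite mulrCA ler_wpM2l ?(ltW (l0 j))//.
  exact: le_trans (ler_norm _) (thb _).
rewrite leNgt; apply/negP => c1.
(* Chosen so that e M <= (1 - c) / 2, which contradicts 1 - e M <= c; the added 1 keeps the
   denominator positive when M = 0. *)
set e := (1 - c) / (2 * (M + 1)).
have e0 : 0 < e by rewrite divr_gt0 ?subr_gt0// mulr_gt0// ltr_wpDl.
have eM : e * (M + 1) = (1 - c) / 2.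
  by rewrite /e invfM mulrA divfK// gt_eqF// ltr_wpDl.
have := bound _ e0; rewrite mulrDr mulr1 in eM; lra.
Qed.

Theorem theorem16 (R : realType) (d : nat) (d_gt0 : (0 < d)%N) (m : nat)
    (k : 'rV[R]_d) (r : 'I_m.+1 -> 'rV[R]_d) (lam : 'I_m.+1 -> R)
    (lam_gt0 : forall j, 0 < lam j)
    (lam_sum : \sum_(j < m.+1) lam j = 1)
    (k_comb : k = \sum_(j < m.+1) lam j *: r j) :
  (forall x : d.-tuple R -> R[i],
     (forall j, Lk (r j) x) ->
     Lk k x /\
     (L2norm (Dder k x) <=
        \prod_(j < m.+1) poweR (L2norm (Dder (r j) x)) (lam j))%E) /\
  (* sharpness: no constant smaller than 1 will do *)
  (forall c : R,
     (forall x : d.-tuple R -> R[i],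
        (forall j, Lk (r j) x) ->
        (L2norm (Dder k x) <=
           c%:E * \prod_(j < m.+1) poweR (L2norm (Dder (r j) x)) (lam j))%E) ->
     1 <= c).
Proof.
split=> [x Lr|c]; last exact: sharp_constant.
by rewrite k_comb; exact: Lk_interp.
Qed.
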